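(* Let $T>0$, $x\in\mathbb{R}$, and let $b:[0,T]\times\mathbb{R}\times\mathcal{P}_1(\mathbb{R})\to\mathbb{R}$ and $\sigma:[0,T]\times\mathbb{R}\to\mathbb{R}$ be bounded Borel measurable functions such that: (a) there exists $C>0$ such that for every $t\in[0,T]$, $y\in\mathbb{R}$ and $\mu,\nu\in\mathcal{P}_1(\mathbb{R})$, $|b(t,y,\mu)-b(t,y,\nu)|\le C\,W_1(\mu,\nu)$; (b) there exists a strictly increasing function $\rho$ on $[0,+\infty)$ with $\rho(0)=0$, $\rho^2$ convex and $\int_{0^+}\rho^{-2}(u)\,du=+\infty$, such that for every $t\in[0,T]$ and $y,z\in\mathbb{R}$, $|\sigma(t,y)-\sigma(t,z)|\le\rho(|y-z|)$; (c) there exists a strictly increasing function $\kappa$ on $[0,+\infty)$ with $\kappa(0)=0$, $\kappa$ concave and $\int_{0^+}\kappa^{-1}(u)\,du=+\infty$, such that for every $t\in[0,T]$, $y,z\in\mathbb{R}$ and $\mu\in\mathcal{P}_2(\mathbb{R})$, $|b(t,y,\mu)-b(t,z,\mu)|\le\kappa(|y-z|)$. Then pathwise uniqueness holds for the McKean-Vlasov stochastic differential equation $$dX_t=b(t,X_t,\mathbb{P}_{X_t})\,dt+\sigma(t,X_t)\,dB_t,\qquad X_0=x,\quad t\in[0,T].$$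
   Context: $\mathbb{P}_{X_t}$ denotes the law of the random variable $X_t$. $\mathcal{P}_p(\mathbb{R})$ is the set of probability measures on $\mathbb{R}$ with finite moment of order $p$, and $W_p(\mu,\nu)=\inf_{\pi\in\Pi(\mu,\nu)}\left[\int|x-y|^p\,d\pi(x,y)\right]^{1/p}$ is the $p$-Wasserstein distance, where $\Pi(\mu,\nu)$ is the set of couplings of $\mu$ and $\nu$. $B$ is a one-dimensional $(\mathcal{F}_t)$-Brownian motion on a filtered probability space satisfying the usual conditions; solutions are continuous adapted processes. The notation $\int_{0^+}f(u)\,du=+\infty$ means $\int_0^\varepsilon f(u)\,du=+\infty$ for every small $\varepsilon>0$; here $\rho^{-2}(u)=1/\rho(u)^2$ and $\kappa^{-1}(u)=1/\kappa(u)$. Pathwise uniqueness means: any two solutions $X^1,X^2$ defined on the same filtered probability space, with the same Brownian motion and the same initial condition $x$, are indistinguishable. *)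

(* Defs.v *)
From HB Require Import structures.
From mathcomp Require Import all_boot all_order all_algebra.
From mathcomp Require Import all_classical all_reals all_analysis.
From mathcomp Require Import measurable_realfun.

Set Implicit Arguments.
Unset Strict Implicit.
Unset Printing Implicit Defensive.

Import Order.TTheory GRing.Theory Num.Theory.
Import numFieldNormedType.Exports.

Local Open Scope classical_set_scope.
Local Open Scope ring_scope.

Section Wasserstein.
Context {R : realType}.
Local Notation Rm := (measurableTypeR R).

Definition finite_moment (p : R) (mu : probability Rm R) : Prop :=
  (\int[mu]_y (`|y| `^ p)%:E < +oo)%E.

Definition coupling (mu nu : probability Rm R) :
    set (probability (Rm * Rm)%type R) :=
  [set pi | forall A : set Rm, measurable A ->
     pi (A `*` setT) = mu A /\ pi (setT `*` A) = nu A].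

Definition wasserstein (p : R) (mu nu : probability Rm R) : \bar R :=
  ereal_inf [set ((\int[pi]_z (`|z.1 - z.2| `^ p)%:E) `^ p^-1)%E
            | pi in coupling mu nu].

End Wasserstein.

Definition Pspace (R : realType) (p : R) : Type :=
  {mu : probability (measurableTypeR R) R | finite_moment p mu}.

Definition Pspace_law (R : realType) (p : R) (mu : Pspace p) :
  probability (measurableTypeR R) R := proj1_sig mu.

Section BorelPspace.
Context {R : realType} (p : R).

(* Measurable types of MathComp-Analysis are pointed. *)
Lemma finite_moment_dirac0 :
  finite_moment p (dirac (0 : measurableTypeR R) : probability _ R).
Proof.
rewrite /finite_moment integral_dirac//=; first by rewrite diracT mul1e ltry.
apply/measurable_EFinP.
by apply: (measurableT_comp (f := fun y : R => y `^ p)).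
Qed.

HB.instance Definition _ := gen_eqMixin (Pspace p).
HB.instance Definition _ := gen_choiceMixin (Pspace p).
HB.instance Definition _ :=
  isPointed.Build (Pspace p) (exist _ _ finite_moment_dirac0).

Definition wasserstein_open (U : set (Pspace p)) : Prop :=
  forall mu, U mu -> exists2 e : R, 0 < e &
    forall nu, (wasserstein p (Pspace_law mu) (Pspace_law nu) < e%:E)%E -> U nu.

(* The Borel sigma-algebra of the metric space (P_p(R), W_p).  As this space is
   separable, the product sigma-algebra that MathComp-Analysis puts on
   R * R * Pspace 1 is the Borel sigma-algebra of the product. *)
HB.instance Definition _ :=
  Measurable.copy (Pspace p) (g_sigma_algebraType wasserstein_open).

End BorelPspace.

(* Time runs through [0, T]: the values of filtrations and processes at times
   outside [0, T] are irrelevant. *)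
Section StochasticCalculus.
Context {R : realType} (T : R) {d : measure_display} {Omega : measurableType d}.
Variables (P : probability Omega R) (F : R -> set (set Omega)).
Implicit Types (B H I X Y : R -> Omega -> R).

Definition filtration : Prop :=
  (forall t, t \in `[0, T] ->
     sigma_algebra setT (F t) /\ F t `<=` measurable) /\
  (forall s t, 0 <= s -> s <= t -> t <= T -> F s `<=` F t).

(* [P.-negligible N] does not require N to be measurable, so the second clause
   makes the probability space complete. *)
Definition usual_conditions : Prop :=
  [/\ filtration,
      forall N : set Omega, P.-negligible N -> F 0 N &
      forall t, 0 <= t -> t < T ->
        F t = \bigcap_(s in [set s | t < s /\ s <= T]) F s].

Definition measurable_wrt (G : set (set Omega)) (f : Omega -> R) : Prop :=
  forall A : set R, measurable A -> G (f @^-1` A).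

Definition adapted X : Prop :=
  forall t, t \in `[0, T] -> measurable_wrt (F t) (X t).

Definition continuous_process X : Prop :=
  forall w, {within `[0, T], continuous (X ^~ w)}.

(* The second argument of [normal_prob] is the standard deviation. *)
Definition brownian_motion B : Prop :=
  [/\ adapted B, continuous_process B, {ae P, forall w, B 0 w = 0} &
      forall s t, 0 <= s -> s < t -> t <= T ->
        (forall A : set R, measurable A ->
           P ((B t \- B s) @^-1` A) =
           normal_prob 0 (Num.sqrt (t - s)) A) /\
        (forall (E : set Omega) (A : set R), F s E -> measurable A ->
           P (E `&` (B t \- B s) @^-1` A) =
           (P E * P ((B t \- B s)%R @^-1` A))%E)].

Definition progressively_measurable H : Prop :=
  forall t, t \in `[0, T] ->
    measurable_fun (`[0, t] `*` [set: g_sigma_algebraType (F t)])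
      (fun z : measurableTypeR R * g_sigma_algebraType (F t) => H z.1 z.2).

(* The simple process
     sum_(i < sp_size) sp_coef i * 1_(]sp_time i, sp_time i.+1]). *)
Record simple_process := SimpleProcess {
  sp_size : nat;
  sp_time : nat -> R;
  sp_coef : nat -> Omega -> R }.

Definition simple_adapted (S : simple_process) : Prop :=
  [/\ 0 <= sp_time S 0,
      forall i, (i < sp_size S)%N -> sp_time S i <= sp_time S i.+1,
      sp_time S (sp_size S) <= T &
      forall i, (i < sp_size S)%N ->
        measurable_wrt (F (sp_time S i)) (sp_coef S i) /\
        exists M, forall w, `|sp_coef S i w| <= M].

Definition sp_val (S : simple_process) (s : R) (w : Omega) : R :=
  \sum_(i < sp_size S)
    sp_coef S i w * \1_(`]sp_time S i, sp_time S i.+1]) s.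

Definition sp_int (S : simple_process) B (t : R) (w : Omega) : R :=
  \sum_(i < sp_size S) sp_coef S i w *
    (B (Num.min (sp_time S i.+1) t) w - B (Num.min (sp_time S i) t) w).

(* I is (a version of) the Ito integral of H against B on [0, T], for H in the
   space L^2(P x dt) of progressively measurable processes: the continuous
   extension to this space of the isometry [sp_int]. *)
Definition ito_integral B H I : Prop :=
  [/\ progressively_measurable H,
      (\int[P]_w \int[lebesgue_measure]_(s in `[0%R, T])
         (`|H s w| ^+ 2)%:E < +oo)%E,
      adapted I, continuous_process I &
      exists S : nat -> simple_process,
        [/\ forall n, simple_adapted (S n),
            (fun n => \int[P]_w \int[lebesgue_measure]_(s in `[0%R, T])
               (`|sp_val (S n) s w - H s w| ^+ 2)%:E)%E @ \oo --> 0%E &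
            forall t, t \in `[0, T] ->
              (fun n => \int[P]_w (`|sp_int (S n) B t w - I t w| ^+ 2)%:E)%E
                @ \oo --> 0%E]].

(* Solutions of dX_t = b(t, X_t, P_{X_t}) dt + sigma(t, X_t) dB_t, X_0 = x.
   Since the third argument of b ranges over P_1(R), the equation only makes
   sense if the law of each X_t belongs to P_1(R); [law t] is this law. *)
Definition mckean_vlasov_solution (x : R) (b : R -> R -> Pspace (1 : R) -> R)
    (sigma : R -> R -> R) B X : Prop :=
  [/\ adapted X, continuous_process X, {ae P, forall w, X 0 w = x} &
      exists (law : R -> Pspace (1 : R)) I,
        [/\ forall t, t \in `[0, T] -> forall A : set R, measurable A ->
              Pspace_law (law t) A = P (X t @^-1` A),
            ito_integral B (fun s w => sigma s (X s w)) I &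
            {ae P, forall w, forall t, t \in `[0, T] ->
              X t w = x +
                (\int[lebesgue_measure]_(s in `[0, t]) b s (X s w) (law s)) +
                I t w}]].

Definition indistinguishable X Y : Prop :=
  {ae P, forall w, forall t, t \in `[0, T] -> X t w = Y t w}.

End StochasticCalculus.

Definition pathwise_uniqueness (R : realType) (T x : R)
    (b : R -> R -> Pspace (1 : R) -> R) (sigma : R -> R -> R) : Prop :=
  forall (d : measure_display) (Omega : measurableType d)
    (P : probability Omega R) (F : R -> set (set Omega)) (B : R -> Omega -> R),
    usual_conditions T P F -> brownian_motion T P F B ->
  forall X1 X2 : R -> Omega -> R,
    mckean_vlasov_solution T P F x b sigma B X1 ->
    mckean_vlasov_solution T P F x b sigma B X2 ->
    indistinguishable T P X1 X2.

(* int_{0+} f(u) du = +oo *)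
Definition diverges_at_0 (R : realType) (f : R -> R) : Prop :=
  \forall e \near 0^'+,
    (\int[lebesgue_measure]_(u in `]0%R, e]) (f u)%:E = +oo)%E.

Definition strictly_increasing_on_nneg (R : realType) (f : R -> R) : Prop :=
  forall u v, 0 <= u -> u < v -> f u < f v.

(* Main.v *)
(* Let [Y = X1 - X2], and let [H] be the difference of the two diffusion
   coefficients.  Since [rho ^ 2] is convex and vanishes at 0, [H ^ 2 <= c |Y|].
   For smooth [f] close to the absolute value, namely averages over dyadic [a]
   of [sqrt (y ^ 2 + a ^ 2)], the product [|y| f''(y)] is then uniformly small, and a
   discretised Ito formula (Taylor expansion along a partition, with a Lindeberg
   estimate of the remainder) bounds [g t = E |Y t|] by the time integral of the
   expected difference of the drifts.  That difference is at most
   [kappa |Y| + C W_1 (law X1, law X2)], where [W_1 <= g].  As [kappa] is concave,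
   [kappa u <= kappa v (1 + u / v)], so that [E (kappa |Y|) <= 2 kappa g], and
   [g t <= \int_0^t (2 kappa (g r) + C g r) dr].  Near 0 the concave function [kappa]
   dominates a linear one, hence [g = 0] by Osgood's lemma.

   For the drifts to be measurable in time, the laws have to be so; they are even
   [W_1]-continuous, since [E |X s - X t|] tends to 0 as [s] tends to [t]. *)
Require Import Defs.
From HB Require Import structures.
From mathcomp Require Import all_boot all_order all_algebra.
From mathcomp Require Import all_classical all_reals all_analysis.
From mathcomp Require Import measurable_realfun.
From mathcomp Require Import ring lra.

Set Implicit Arguments.
Unset Strict Implicit.
Unset Printing Implicit Defensive.

Import Order.TTheory GRing.Theory Num.Theory.
Import numFieldNormedType.Exports.

Local Open Scope classical_set_scope.
Local Open Scope ring_scope.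

(** The Ito integral is given only through L2 limits of elementary integrals at fixed times, so two
    moment facts about an increment of the martingale part [J] stand in for stochastic calculus: it
    has mean zero, and its square is controlled by the time integral of [H ^ 2], both after
    multiplication by a bounded weight known at the left endpoint. In each cell of the partition
    [f'] and [f''] at the left endpoint serve as these weights. Going from [c |Y r|] back to
    [c |Y s|] then costs an error of order [sqrt h] per unit of time, with [h] the mesh. Constant
    factors in the second moment bound are harmless, since [|y| f''(y)] is as small as desired.

    The second obstacle is an apparent circle: the drift is measurable in time if the laws are, the
    laws are because they are continuous, and their continuity needs a bound on the drift integral.
    The circle is broken by bounding that integral without measurability; the increments of [X - I]
    then tend to 0 in mean by dominated convergence along continuous paths. *)

(** * Expectations, integrable and square-integrable variables *)

Section Expectation.
Context {R : realType} {d : measure_display} {T : measurableType d}.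
Variable P : probability T R.
Implicit Types f g h : T -> R.

Definition L1 f := P.-integrable setT (EFin \o f).
(** Real-valued: an infinite integral counts as 0, so an upper bound on [Ex] carries information
    only next to an [L1] fact. *)
Definition Ex f : R := \int[P]_w f w.

Lemma L1_measurable f : L1 f -> measurable_fun setT f.
Proof. by move=> /(measurable_int P)/measurable_EFinP. Qed.

Lemma L1P f : measurable_fun setT f ->
  (\int[P]_w (`|f w|)%:E < +oo)%E -> L1 f.
Proof. by move=> mf fi; apply/integrableP; split; [exact/measurable_EFinP|exact: fi]. Qed.

Lemma ExE f : L1 f -> (Ex f)%:E = (\int[P]_w (f w)%:E)%E.
Proof. by move=> fi; rewrite /Ex /Rintegral fineK//; exact: integrable_fin_num. Qed.

Lemma L1_le f g : measurable_fun setT f -> (forall w, `|f w| <= g w) ->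
  L1 g -> L1 f.
Proof.
move=> mf fg; apply: le_integrable => //; first exact/measurable_EFinP.
by move=> w _ /=; rewrite lee_fin (le_trans (fg w))// ler_norm.
Qed.

Lemma L1_cst c : L1 (fun=> c).
Proof. exact: (finite_measure_integrable_cst P c). Qed.

Lemma L1_bounded f M : measurable_fun setT f -> (forall w, `|f w| <= M) -> L1 f.
Proof. by move=> mf fM; apply: (L1_le mf fM); exact: L1_cst. Qed.

Lemma L1D f g : L1 f -> L1 g -> L1 (fun w => f w + g w).
Proof. by move=> *; exact: (@integrableD _ _ _ P setT _ (EFin \o f) (EFin \o g)). Qed.

Lemma L1Z c f : L1 f -> L1 (fun w => c * f w).
Proof. by move=> *; exact: (@integrableZl _ _ _ P setT _ c (EFin \o f)). Qed.

Lemma L1N f : L1 f -> L1 (fun w => - f w).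
Proof. by move=> *; exact: (@integrableN _ _ _ P setT (EFin \o f)). Qed.

Lemma L1B f g : L1 f -> L1 g -> L1 (fun w => f w - g w).
Proof. by move=> *; apply: L1D => //; exact: L1N. Qed.

Lemma L1_norm f : L1 f -> L1 (fun w => `|f w|).
Proof. exact: integrable_norm. Qed.

Lemma L1_sum I (s : seq I) (F : I -> T -> R) :
  (forall i, L1 (F i)) -> L1 (fun w => \sum_(i <- s) F i w).
Proof.
move=> FL; elim: s => [|i s IH].
  by under eq_fun do rewrite big_nil; exact: L1_cst.
by under eq_fun do rewrite big_cons; exact: L1D.
Qed.

Lemma L1Mbounded M f g : measurable_fun setT f -> (forall w, `|f w| <= M) ->
  L1 g -> L1 (fun w => f w * g w).
Proof.
move=> mf fM gL; apply: (@L1_le _ (fun w => M * `|g w|)).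
- by apply: measurable_funM => //; exact: L1_measurable.
- by move=> w; rewrite normrM ler_wpM2r.
- exact/L1Z/L1_norm.
Qed.

Lemma Ex_cst c : Ex (fun=> c) = c.
Proof.
rewrite /Ex Rintegral_cst// (_ : fine _ = 1) ?mulr1//.
exact: (congr1 fine (@probability_setT _ _ _ P)).
Qed.

Lemma ExD f g : L1 f -> L1 g -> Ex (fun w => f w + g w) = Ex f + Ex g.
Proof. by move=> fL gL; rewrite /Ex RintegralD. Qed.

Lemma ExB f g : L1 f -> L1 g -> Ex (fun w => f w - g w) = Ex f - Ex g.
Proof. by move=> fL gL; rewrite /Ex RintegralB. Qed.

Lemma ExZ c f : L1 f -> Ex (fun w => c * f w) = c * Ex f.
Proof. by move=> fL; rewrite /Ex RintegralZl. Qed.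

Lemma Ex_sum I (s : seq I) (F : I -> T -> R) : (forall i, L1 (F i)) ->
  Ex (fun w => \sum_(i <- s) F i w) = \sum_(i <- s) Ex (F i).
Proof.
move=> FL; elim: s => [|i s IH].
  by under eq_fun do rewrite big_nil; rewrite Ex_cst big_nil.
under eq_fun do rewrite big_cons; rewrite ExD//; last exact: L1_sum.
by rewrite big_cons IH.
Qed.

Lemma eq_Ex f g : f =1 g -> Ex f = Ex g.
Proof. by move=> /funext ->. Qed.

Lemma Ex_ge0 f : (forall w, 0 <= f w) -> 0 <= Ex f.
Proof. by move=> f0; exact: Rintegral_ge0. Qed.

Lemma Ex_le f g : L1 f -> L1 g -> (forall w, f w <= g w) -> Ex f <= Ex g.
Proof. by move=> fL gL fg; exact: le_Rintegral. Qed.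

(** The difference [g - f] agrees almost everywhere with its absolute value, whose integral is
    nonnegative. *)
Lemma Ex_ae_le f g : L1 f -> L1 g -> {ae P, forall w, f w <= g w} ->
  Ex f <= Ex g.
Proof.
move=> fL gL fg; rewrite -subr_ge0 -ExB//.
pose h w := g w - f w; have hL : L1 h by exact: L1B.
have mh : measurable_fun setT h by exact: L1_measurable.
suff -> : Ex h = Ex (fun w => `|h w|) by exact: Ex_ge0.
rewrite /Ex /Rintegral; congr fine; apply: ae_eq_integral => //.
- exact/measurable_EFinP.
- exact/measurable_EFinP/measurableT_comp.
- by apply: filterS fg => w fgw _; rewrite /= ger0_norm// subr_ge0.
Qed.

Lemma Ex_norm f : L1 f -> `|Ex f| <= Ex (fun w => `|f w|).
Proof. by move=> fL; exact: le_normr_Rintegral. Qed.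

Lemma Ex_eq0_ae f : L1 f -> Ex (fun w => `|f w|) = 0 ->
  {ae P, forall w, f w = 0}.
Proof.
move=> fL f0.
have : (\int[P]_w `|(f w)%:E| = 0)%E.
  by rewrite -(ExE (L1_norm fL)) f0.
move/(ae_eq_integral_abs P measurableT (measurable_int P fL)).
by apply: filterS => w /(_ Logic.I)/= [].
Qed.

Definition L2 f := measurable_fun setT f /\ L1 (fun w => f w ^+ 2).

Lemma L2_measurable f : L2 f -> measurable_fun setT f. Proof. by case. Qed.

Lemma L2D f g : L2 f -> L2 g -> L2 (fun w => f w + g w).
Proof.
move=> [mf f2] [mg g2]; have mfg := measurable_funD mf mg; split=> //.
apply: (@L1_le _ (fun w => 2 * f w ^+ 2 + 2 * g w ^+ 2)).
- exact: measurable_funX.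
- by move=> w; rewrite ger0_norm ?sqr_ge0//; have := sqr_ge0 (f w - g w); nra.
- by apply: L1D; exact: L1Z.
Qed.

Lemma L2Mbounded M f g : measurable_fun setT f -> (forall w, `|f w| <= M) ->
  L2 g -> L2 (fun w => f w * g w).
Proof.
move=> mf fM [mg g2]; split; first exact: measurable_funM.
apply: (@L1_le _ (fun w => M ^+ 2 * g w ^+ 2)).
- by apply: measurable_funX; exact: measurable_funM.
- move=> w; rewrite ger0_norm ?sqr_ge0// exprMn ler_wpM2r ?sqr_ge0//.
  rewrite -(real_normK (num_real (f w))) lerXn2r ?nnegrE//.
  exact: le_trans (fM w).
- exact: L1Z.
Qed.

Lemma L2Z c f : L2 f -> L2 (fun w => c * f w).
Proof. by move=> fL; apply: (@L2Mbounded `|c|). Qed.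

Lemma L2B f g : L2 f -> L2 g -> L2 (fun w => f w - g w).
Proof.
move=> fL gL; apply: (L2D fL).
by under eq_fun do rewrite -mulN1r; exact: L2Z.
Qed.

Lemma L2_bounded M f : measurable_fun setT f -> (forall w, `|f w| <= M) -> L2 f.
Proof.
move=> mf fM; split=> //; apply: (@L1_bounded _ (M ^+ 2)).
  exact: measurable_funX.
move=> w; rewrite normrX lerXn2r ?nnegrE//; exact: le_trans (fM w).
Qed.

Lemma L2_sum I (s : seq I) (F : I -> T -> R) :
  (forall i, L2 (F i)) -> L2 (fun w => \sum_(i <- s) F i w).
Proof.
move=> FL; elim: s => [|i s IH].
  by under eq_fun do rewrite big_nil; apply: (@L2_bounded 0) => // w; rewrite normr0.
by under eq_fun do rewrite big_cons; exact: L2D.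
Qed.

Lemma L2M_L1 f g : L2 f -> L2 g -> L1 (fun w => f w * g w).
Proof.
move=> [mf f2] [mg g2].
apply: (@L1_le _ (fun w => f w ^+ 2 + g w ^+ 2)).
- exact: measurable_funM.
- move=> w; rewrite normrM -(real_normK (num_real (f w))).
  rewrite -(real_normK (num_real (g w))).
  by have := sqr_ge0 (`|f w| - `|g w|); have := sqr_ge0 (`|f w| + `|g w|); nra.
- exact: L1D.
Qed.

Lemma L2_L1 f : L2 f -> L1 f.
Proof.
move=> fL; have -> : f = (fun w => 1 * f w) by apply/funext => w; rewrite mul1r.
by apply: (@L2M_L1 (fun=> 1)) => //; exact: (@L2_bounded `|1|).
Qed.

(* AM-GM, used with [e] of the order of the L2 norm of [f] in place of the
   Cauchy-Schwarz inequality. *)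
Lemma Ex_norm_le_sqr f e : L2 f -> 0 < e ->
  Ex (fun w => `|f w|) <= e + e^-1 * Ex (fun w => f w ^+ 2).
Proof.
move=> fL e0; have := fL => -[mf f2].
rewrite -[X in X + _](Ex_cst e) -ExZ// -ExD; last 2 first.
  exact: L1_cst.
  exact: L1Z.
apply: Ex_le.
- exact/L1_norm/L2_L1.
- by apply: L1D; [exact: L1_cst|exact: L1Z].
- move=> w; rewrite -(real_normK (num_real (f w))).
  have := sqr_ge0 (`|f w| - e); have x0 := normr_ge0 (f w).
  move=> h; rewrite -(@ler_pM2l _ e)// mulrDr mulrA divff ?gt_eqF// mul1r.
  nra.
Qed.

End Expectation.

(** * Change of density *)

Section Density.
Context {R : realType} {d : measure_display} {T : measurableType d}.
Variables (mu nu : {measure set T -> \bar R}) (p : T -> R).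
Hypotheses (p_ge0 : forall x, 0 <= p x) (mp : measurable_fun setT p).
Hypothesis nuE : forall A, measurable A -> nu A = (\int[mu]_(x in A) (p x)%:E)%E.
Local Open Scope ereal_scope.
Import HBNNSimple.

(** Agreement on simple functions, where the density enters through the fibres, passes to [f] by
    monotone convergence on both sides. *)
Lemma ge0_integral_density (f : T -> \bar R) : measurable_fun setT f ->
  (forall x, 0 <= f x) -> \int[nu]_x f x = \int[mu]_x (f x * (p x)%:E).
Proof.
move=> mf f0; have mpE : measurable_fun setT (EFin \o p) by exact/measurable_EFinP.
have nnE (h : {nnsfun T >-> R}) :
    \int[nu]_x (h x)%:E = \int[mu]_x ((h x)%:E * (p x)%:E).
  under [LHS]eq_integral do rewrite fimfunE -fsumEFin//.
  rewrite [LHS]ge0_integral_fsum//; last 2 first.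
    - by move=> r; exact/measurable_EFinP/measurableT_comp.
    - by move=> n x _; rewrite EFinM nnfun_muleindic_ge0.
  under [RHS]eq_integral.
    move=> x _; rewrite fimfunE -fsumEFin// muleC ge0_mule_fsumr; last first.
      by move=> r; rewrite EFinM nnfun_muleindic_ge0.
    over.
  rewrite [RHS]ge0_integral_fsum//; last 2 first.
    - move=> r; apply: emeasurable_funM => //.
      by apply/measurable_EFinP; exact/measurableT_comp.
    - move=> r x _; apply: mule_ge0; first by rewrite lee_fin.
      by rewrite EFinM nnfun_muleindic_ge0.
  apply: eq_fsbigr => r _; rewrite integralZl_indic_nnsfun//=.
  have mA : measurable (h @^-1` [set r]) by [].
  rewrite integral_indic// setIT nuE// [in LHS]integral_mkcond.
  (* Over a negative value the fibre is empty; otherwise [r] is a nonnegative factor that can be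
     moved through the integral. *)
  have [r0|r0] := ltP r 0%R.
    rewrite preimage_nnfun0//; rewrite [X in _ * X]integral0_eq ?mule0.
      rewrite integral0_eq// => x _; rewrite indicE in_set0 mulr0 mule0//.
    by move=> x _; rewrite patchE in_set0.
  rewrite -ge0_integralZl_EFin//; last first.
  - by apply/(measurable_restrictT _ _).1 => //; exact: measurable_funTS.
  - by move=> x _; apply: erestrict_ge0 => y _; rewrite lee_fin.
  apply: eq_integral => x _; rewrite patchE indicE.
  by case: (x \in _); rewrite ?mulr1 ?mulr0 ?mule0// muleC.
pose f_ := nnsfun_approx measurableT mf.
transitivity (lim (\int[nu]_x (f_ n x)%:E @[n --> \oo])).
  rewrite -monotone_convergence//=.
  - by apply: eq_integral => x _; apply/esym/cvg_lim => //; exact: cvg_nnsfun_approx.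
  - by move=> n; exact/measurable_EFinP.
  - by move=> n x _; rewrite lee_fin.
  - by move=> x _ m n mn; rewrite lee_fin; exact/lefP/nd_nnsfun_approx.
transitivity (lim (\int[mu]_x ((f_ n x)%:E * (p x)%:E) @[n --> \oo])).
  by apply: congr_lim; apply/funext => n /=; exact: nnE.
rewrite -monotone_convergence//=.
- apply: eq_integral => x _; apply/cvg_lim => //.
  apply: cvgeZr => //; exact: cvg_nnsfun_approx.
- by move=> n; apply: emeasurable_funM => //; exact/measurable_EFinP.
- by move=> n x _; rewrite -EFinM lee_fin mulr_ge0.
- move=> x _ m n mn; rewrite -!EFinM lee_fin ler_wpM2r//.
  exact/lefP/nd_nnsfun_approx.
Qed.

End Density.

(** * Integrals of derivatives over the real line *)

Section IntegralDerivative.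
Context {R : realType}.
Notation mu := (@lebesgue_measure R).

Lemma integral_derivative_eq0 (F f : R -> R) :
  continuous f -> (forall x, is_derive x (1 : R) F (f x)) ->
  mu.-integrable setT (EFin \o f) ->
  F n.+1%:R @[n --> \oo] --> (0 : R) -> F (- n.+1%:R) @[n --> \oo] --> (0 : R) ->
  (\int[mu]_x (f x)%:E = 0)%E.
Proof.
move=> cf Ff fi F1 F2.
pose D (n : nat) : set R := `[- n.+1%:R, n.+1%:R]%classic.
have DE n : (\int[mu]_(x in D n) (f x)%:E = (F n.+1%:R - F (- n.+1%:R))%:E)%E.
  rewrite (@continuous_FTC2 _ f F)//.
  - by rewrite -subr_gt0 opprK -natrD ltr0n.
  - exact: continuous_subspaceT.
  - have cF x : F @ x --> F x.
      by apply: differentiable_continuous; apply/derivable1_diffP; case: (Ff x).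
    split.
    + by move=> x _; case: (Ff x).
    + exact/cvg_at_right_filter/cF.
    + exact/cvg_at_left_filter/cF.
  - by move=> x _; rewrite derive1E; apply: derive_val.
have c1 : (\int[mu]_(x in D n) (f x)%:E)%E @[n --> \oo] --> (\int[mu]_x (f x)%:E)%E.
  under eq_fun do rewrite integral_mkcond.
  have mf : measurable_fun setT (EFin \o f) by exact: measurable_int fi.
  have [] := @dominated_convergence _ _ _ mu setT measurableT
     (fun n => (EFin \o f) \_ (D n)) (EFin \o f) (fun x => `|(f x)%:E|%E).
  - move=> n; apply/(measurable_restrictT _ _).1 => //; first exact: measurable_itv.
    exact: measurable_funTS.
  - by [].
  - apply: aeW => x _; apply: cvg_near_cst.
    near=> n; rewrite patchE ifT// inE /D/= in_itv/=.
    have : `|x| <= n.+1%:R.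
      near: n; exists (Num.Def.truncn `|x|) => // n /= xn.
      apply/ltW; apply: (lt_le_trans (Num.Theory.truncnS_gt _)).
      by rewrite ler_nat ltnS.
    by rewrite ler_norml.
  - exact: integrable_abse fi.
  - move=> /=; apply: aeW => x n _; rewrite patchE; case: ifPn => // _.
    by rewrite abse0.
  - by move=> _ _.
have c2 : (F n.+1%:R - F (- n.+1%:R))%:E @[n --> \oo] --> (0 : R)%:E.
  apply: cvg_EFin; first exact: nearW.
  by rewrite /comp/= -[X in _ --> X](subr0 (0 : R)); exact: cvgB.
move: c1; under eq_fun do rewrite DE.
by move=> /(cvg_unique _ c2) <-.
Unshelve. all: by end_near. Qed.

End IntegralDerivative.

(** * Gaussian moments *)

Section GaussianMoments.
Context {R : realType}.
Notation mu := (@lebesgue_measure R).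
Variable s : R.
Hypothesis s0 : 0 < s.

Let e (t x : R) : R := normal_fun 0 t x.

Let eE t x : e t x = expR (- (x ^+ 2 / (t ^+ 2 *+ 2))).
Proof. by rewrite /e /normal_fun subr0 mulNr. Qed.

(** Part of the Gaussian decay pays for the power: with [u = x^2 / s^2], [exp (- u / 2)] is
    [exp (- u / 8)], the Gaussian of deviation [2 s], times [exp (- 3 u / 8)]. The constant 30
    serves because [30 * (3 / 16)^2 >= 1]. *)
Lemma normal_fun_moment_le k x : (k <= 4)%N ->
  `|x| ^+ k * normal_fun 0 s x <= 30 * s ^+ k * normal_fun 0 (2 * s) x.
Proof.
move=> k4; rewrite -/(e s x) -/(e (2 * s) x) !eE.
pose u := x ^+ 2 / s ^+ 2; have u0 : 0 <= u by rewrite divr_ge0// sqr_ge0.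
have sn0 : s != 0 by rewrite gt_eqF.
have -> : - (x ^+ 2 / (s ^+ 2 *+ 2)) =
    - (x ^+ 2 / ((2 * s) ^+ 2 *+ 2)) - (3 * u / 16 + 3 * u / 16).
  by rewrite /u; field.
rewrite expRD mulrCA [leRHS]mulrC.
rewrite ler_wpM2l ?expR_ge0// expRN ler_pdivrMr ?expR_gt0//.
pose v := `|x| / s; have v0 : 0 <= v by rewrite divr_ge0// ltW.
have xv : `|x| = v * s by rewrite /v divfK.
have uv : u = v ^+ 2 by rewrite /u /v expr_div_n real_normK ?num_real.
rewrite xv exprMn mulrC [30 * _]mulrC -[leRHS]mulrA ler_wpM2l ?exprn_ge0 ?(ltW s0)//.
have h1 : 1 + 3 * u / 16 <= expR (3 * u / 16) by exact: expR_ge1Dx.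
(* Squaring the linear bound on the exponential gives degree 4 in [v], enough for [k <= 4]. *)
have h2 : (1 + 3 * u / 16) ^+ 2 <= expR (3 * u / 16 + 3 * u / 16).
  rewrite expRD expr2; apply: ler_pM => //; lra.
apply: (@le_trans _ _ (30 * (1 + 3 * u / 16) ^+ 2)); last by rewrite ler_wpM2l.
apply: (@le_trans _ _ (1 + v ^+ 4)).
  have [v1|v1] := leP v 1.
    by apply: (@le_trans _ _ 1); [exact: exprn_ile1|rewrite lerDl exprn_ge0].
  apply: (@le_trans _ _ (v ^+ 4)); last by rewrite lerDr.
  by rewrite ler_eXn2l.
by rewrite uv; have := sqr_ge0 v; nra.
Qed.

Lemma normal_peak_double : normal_peak s = 2 * normal_peak (2 * s).
Proof.
rewrite /normal_peak.
have -> : (2 * s) ^+ 2 * pi *+ 2 = 2 ^+ 2 * (s ^+ 2 * pi *+ 2) :> R.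
  by ring.
rewrite sqrtrM ?sqr_ge0// sqrtr_sqr ger0_norm// invfM mulrA divff ?mul1r//.
Qed.

(** The factor 60 is twice 30 because the peak of the density halves when the deviation doubles. *)
Lemma normal_pdf_moment_le k x : (k <= 4)%N ->
  `|x| ^+ k * normal_pdf 0 s x <= 60 * s ^+ k * normal_pdf 0 (2 * s) x.
Proof.
move=> k4; rewrite !normal_pdfE ?gt_eqF ?mulr_gt0//.
rewrite mulrCA normal_peak_double.
have -> : 60 * s ^+ k * (normal_peak (2 * s) * normal_fun 0 (2 * s) x) =
  2 * normal_peak (2 * s) * (30 * s ^+ k * normal_fun 0 (2 * s) x) by ring.
by rewrite ler_wpM2l ?mulr_ge0 ?normal_peak_ge0// normal_fun_moment_le.
Qed.

Let p := normal_pdf (0 : R) s.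

Let pE x : p x = normal_peak s * e s x.
Proof. by rewrite /p normal_pdfE// gt_eqF. Qed.

Let dp (x : R) : is_derive x (1 : R) p (- (x / s ^+ 2) * p x).
Proof.
pose g (x : R) := - (s ^+ 2 *+ 2)^-1 * x ^+ 2.
have -> : p = normal_peak s \*: (expR \o g).
  apply/funext => y; rewrite pE eE /g /= mulNr; congr (_ * expR (- _)).
  exact: mulrC.
have h : is_derive x 1 g (- (x / s ^+ 2)).
  apply: is_derive_eq.
  by rewrite /GRing.scale/= mulr1; field; rewrite gt_eqF.
have h2 : is_derive x 1 (expR \o g) (expR (g x) * - (x / s ^+ 2)).
  exact: is_derive1_comp.
apply: is_derive_eq.
rewrite (_ : (normal_peak s \*: (expR \o g)) x = normal_peak s * expR (g x))//.
by rewrite /GRing.scale/=; ring.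
Qed.

Lemma integrable_normal_moment k : (k <= 4)%N ->
  mu.-integrable setT (EFin \o (fun x => x ^+ k * p x)).
Proof.
move=> k4.
apply: (@le_integrable _ _ _ mu setT measurableT _
   (fun x => (60 * s ^+ k)%:E * (normal_pdf 0 (2 * s) x)%:E)%E).
- apply/measurable_EFinP/measurable_funM; first exact: measurable_funX.
  exact: measurable_normal_pdf.
- move=> x _ /=; rewrite lee_fin normrM normrX (ger0_norm (normal_pdf_ge0 _ _ _)).
  by rewrite (le_trans (normal_pdf_moment_le x k4))// ler_norm.
- by apply: integrableZl => //; exact: integrable_normal_pdf.
Qed.

Lemma continuous_normal_moment k : continuous (fun x : R => x ^+ k * p x).
Proof.
move=> x; apply: (@cvgM _ _ (nbhs x)); first exact: exprn_continuous.
by apply: continuous_normal_pdf; rewrite gt_eqF.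
Qed.

(** With one more power of [|x|] the product is still bounded, by [60 s^(k+1)] times a peak;
    dividing that power out gives the rate [1 / n.+1]. *)
Lemma cvg_normal_moment0 k (y : nat -> R) : (k <= 1)%N ->
  (forall n, `|y n| = n.+1%:R) ->
  (y n) ^+ k * p (y n) @[n --> \oo] --> (0 : R).
Proof.
move=> k1 yn; pose C := 60 * s ^+ k.+1 * normal_peak (2 * s).
apply/norm_cvg0P.
apply: (@squeeze_cvgr _ _ _ _ (fun=> 0) (fun n => C * harmonic n)); last 2 first.
- exact: cvg_cst.
- by rewrite -[X in _ --> X](mulr0 C); apply: cvgMr => //; exact: cvg_harmonic.
near=> n; rewrite normr_ge0/= ler_pdivlMr// normrM normrX -yn.
rewrite mulrAC -exprSr (ger0_norm (normal_pdf_ge0 _ _ _)).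
apply: le_trans (normal_pdf_moment_le _ _) _; first by case: k k1 {C} => [|[]].
rewrite /C ler_wpM2l ?mulr_ge0 ?exprn_ge0 ?(ltW s0)//.
by rewrite normal_pdf_ub// gt_eqF// mulr_gt0.
Unshelve. all: by end_near. Qed.

(** Multiplied by [- 1 / s^2], the integrand is the derivative of the density. *)
Lemma normal_mean0 : (\int[mu]_x (x * p x)%:E = 0)%E.
Proof.
have i1 := integrable_normal_moment (isT : 1 <= 4)%N.
have : (\int[mu]_x (- (s ^+ 2)^-1 * (x * p x))%:E = 0)%E.
  apply: (@integral_derivative_eq0 _ p (fun x => - (s ^+ 2)^-1 * (x * p x))).
  - move=> x; apply: cvgM; first exact: cvg_cst.
    by have := @continuous_normal_moment 1 x.
  - by move=> x; have dpx := dp x; apply: is_derive_eq; ring.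
  - exact: (@integrableZl _ _ _ mu setT _ (- (s ^+ 2)^-1) (EFin \o (fun x => x * p x))).
  - have := @cvg_normal_moment0 0 (fun n => n.+1%:R) isT.
    under eq_fun do rewrite expr0 mul1r; apply=> n; by rewrite normr_nat.
  - have := @cvg_normal_moment0 0 (fun n => - n.+1%:R) isT.
    under eq_fun do rewrite expr0 mul1r; apply=> n; by rewrite normrN normr_nat.
under eq_integral do rewrite EFinM.
rewrite integralZl//; move/eqP; rewrite mule_eq0 => /orP[|/eqP//].
by rewrite eqe oppr_eq0 invr_eq0 sqrf_eq0 gt_eqF.
Qed.

(** The derivative of [x * p x] is [p x - x^2 p x / s^2]; its integral is 0 and that of [p] is 1. *)
Lemma normal_variance : (\int[mu]_x (x ^+ 2 * p x)%:E = (s ^+ 2)%:E)%E.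
Proof.
have i2 := integrable_normal_moment (isT : 2 <= 4)%N.
have i0 := integrable_normal_pdf (0 : R) s.
have iZ : mu.-integrable setT (fun x => (- (s ^+ 2)^-1)%:E * (x ^+ 2 * p x)%:E)%E.
  exact: (@integrableZl _ _ _ mu setT _ (- (s ^+ 2)^-1) (EFin \o (fun x => x ^+ 2 * p x))).
have : (\int[mu]_x (p x - (s ^+ 2)^-1 * (x ^+ 2 * p x))%:E = 0)%E.
  apply: (@integral_derivative_eq0 _ (fun x => x * p x)
    (fun x => p x - (s ^+ 2)^-1 * (x ^+ 2 * p x))).
  - move=> x; apply: cvgB; first by apply: continuous_normal_pdf; rewrite gt_eqF.
    by apply: cvgM; [exact: cvg_cst|exact: continuous_normal_moment].
  - move=> x; have dpx := dp x; apply: is_derive_eq.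
    by rewrite /GRing.scale/=; ring.
  - apply: eq_integrable (integrableD measurableT i0 iZ) => // x _.
    by rewrite /= -EFinM -EFinD mulNr.
  - have := @cvg_normal_moment0 1 (fun n => n.+1%:R) isT.
    by apply=> n; rewrite normr_nat.
  - have := @cvg_normal_moment0 1 (fun n => - n.+1%:R) isT.
    by apply=> n; rewrite normrN normr_nat.
under eq_integral do rewrite EFinD -mulNr EFinM.
rewrite integralD// integral_normal_pdf integralZl//.
have := integrable_fin_num measurableT i2.
rewrite /comp/=; case: (integral _ _ _) => [r| |]//= _.
rewrite -EFinM -EFinD => -[]; move=> h; congr (_%:E).
have s2 : s ^+ 2 != 0 by rewrite sqrf_eq0 gt_eqF.
by apply/(mulfI (invr_neq0 s2)); rewrite mulVf//; lra.
Qed.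

Lemma normal_moment_le k : (k <= 4)%N ->
  (\int[mu]_x (`|x| ^+ k * p x)%:E <= (60 * s ^+ k)%:E)%E.
Proof.
move=> k4; apply: (@le_trans _ _
   (\int[mu]_x ((60 * s ^+ k)%:E * (normal_pdf 0 (2 * s) x)%:E))%E).
  apply: ge0_le_integral => //.
  - by move=> x _; rewrite lee_fin mulr_ge0 ?exprn_ge0 ?normal_pdf_ge0.
  - apply/measurable_EFinP/measurable_funM; last exact: measurable_normal_pdf.
    by apply: measurable_funX; exact: normr_measurable.
  - apply: emeasurable_funM => //; apply/measurable_EFinP.
    exact: measurable_normal_pdf.
  - by move=> x _; rewrite -EFinM lee_fin normal_pdf_moment_le.
rewrite integralZl//; last exact: integrable_normal_pdf.
by rewrite integral_normal_pdf mule1.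
Qed.

End GaussianMoments.

(** * Moments of a Gaussian random variable *)

Section GaussianVariable.
Context {R : realType} {d : measure_display} {T : measurableType d}.
Variable P : probability T R.
Variables (s : R) (W : T -> R).
Hypotheses (s0 : 0 < s) (mW : measurable_fun setT W).
Hypothesis WE : forall A : set R, measurable A ->
  P (W @^-1` A) = normal_prob 0 s A.

Lemma ge0_integral_gaussian (f : R -> \bar R) : measurable_fun setT f ->
  (forall x, 0 <= f x)%E ->
  (\int[P]_w f (W w) = \int[lebesgue_measure]_x (f x * (normal_pdf 0 s x)%:E))%E.
Proof.
move=> mf f0.
have mW' : measurable_fun setT (W : T -> measurableTypeR R) by exact: mW.
pose W' : {mfun T >-> measurableTypeR R} := HB.pack W (isMeasurableFun.Build _ _ _ _ _ mW').
have <- : (\int[distribution P W']_y f y = \int[P]_w f (W w))%E.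
  by rewrite ge0_integral_distribution.
apply: (@ge0_integral_density R _ _ lebesgue_measure (distribution P W')
  (normal_pdf 0 s)) => //.
- by move=> x; exact: normal_pdf_ge0.
- exact: measurable_normal_pdf.
Qed.

Lemma gaussian_L1 k : (k <= 4)%N -> L1 P (fun w => W w ^+ k).
Proof.
move=> k4; apply: L1P; first exact: measurable_funX.
have -> : (\int[P]_w (`|W w ^+ k|)%:E =
   \int[lebesgue_measure]_x ((`|x ^+ k|)%:E * (normal_pdf 0 s x)%:E))%E.
  rewrite (@ge0_integral_gaussian (fun x => (`|x ^+ k|)%:E)) => [//||x].
    by apply/measurable_EFinP/measurableT_comp => //; exact: measurable_funX.
  by rewrite lee_fin.
under eq_integral do rewrite -EFinM normrX.
by rewrite (le_lt_trans (normal_moment_le s0 k4))// ltry.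
Qed.

Lemma gaussian_ExE k : (k <= 4)%N ->
  (Ex P (fun w => W w ^+ k))%:E =
  (\int[lebesgue_measure]_x (x ^+ k * normal_pdf 0 s x)%:E)%E.
Proof.
move=> k4; rewrite ExE; last exact: gaussian_L1.
have mk : measurable_fun setT (fun x : R => x ^+ k) by exact: measurable_funX.
pose q (x : R) := (x ^+ k)%:E; have mq : measurable_fun setT q by exact/measurable_EFinP.
(* The transfer to the density is stated for nonnegative integrands, hence the split into positive
   and negative parts. *)
rewrite integralE [RHS]integralE; congr (_ - _)%E.
  transitivity (\int[P]_w (q^\+ (W w)))%E.
    by apply: eq_integral => w _; rewrite !funeposE.
  rewrite ge0_integral_gaussian//; last exact: measurable_funepos.
  apply: eq_integral => x _; rewrite !funeposE/= maxe_pMl ?lee_fin ?normal_pdf_ge0//.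
  by rewrite mul0e.
transitivity (\int[P]_w (q^\- (W w)))%E.
    by apply: eq_integral => w _; rewrite !funenegE.
  rewrite ge0_integral_gaussian//; last exact: measurable_funeneg.
apply: eq_integral => x _; rewrite !funenegE/= maxe_pMl ?lee_fin ?normal_pdf_ge0//.
  by rewrite mul0e -EFinM mulNr.
Qed.

Lemma gaussian_Ex : Ex P W = 0.
Proof.
apply: EFin_inj; rewrite -[LHS]/(Ex P (fun w => W w ^+ 1))%:E gaussian_ExE//.
exact: normal_mean0.
Qed.

Lemma gaussian_Ex2 : Ex P (fun w => W w ^+ 2) = s ^+ 2.
Proof. by apply: EFin_inj; rewrite -(normal_variance s0) gaussian_ExE. Qed.

Lemma gaussian_Ex_norm3_le : Ex P (fun w => `|W w| ^+ 3) <= 60 * s ^+ 3.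
Proof.
rewrite -lee_fin ExE; last first.
  have := L1_norm (gaussian_L1 (isT : 3 <= 4)%N).
  by under eq_fun do rewrite normrX.
rewrite (@ge0_integral_gaussian (fun x => (`|x| ^+ 3)%:E)) => [||x].
- by under eq_integral do rewrite -EFinM; exact: (normal_moment_le s0 (isT : 3 <= 4)%N).
- by apply/measurable_EFinP/measurable_funX; exact: normr_measurable.
- by rewrite lee_fin exprn_ge0.
Qed.

End GaussianVariable.

(** * Products of independent variables *)

Section Independence.
Context {R : realType} {d : measure_display} {T : measurableType d}.
Variable P : probability T R.
Variables Z W : T -> R.
Hypotheses (ZL : L1 P Z) (WL : L1 P W).
Hypothesis ZW : forall A A' : set R, measurable A -> measurable A' ->
  P (Z @^-1` A `&` W @^-1` A') = (P (Z @^-1` A) * P (W @^-1` A'))%E.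

Let mZ := L1_measurable ZL.
Let mW := L1_measurable WL.
Let Z' : {mfun T >-> R} := HB.pack Z (isMeasurableFun.Build _ _ _ _ _ mZ).
Let W' : {mfun T >-> R} := HB.pack W (isMeasurableFun.Build _ _ _ _ _ mW).
Let mV : measurable_fun setT (fun w => (Z w, W w)) := measurable_fun_pair mZ mW.
Let V : {mfun T >-> (R * R)%type} :=
  HB.pack (fun w => (Z w, W w)) (isMeasurableFun.Build _ _ _ _ _ mV).

(** The joint law and the product law agree on rectangles by independence, hence everywhere; this
    opens the way to Fubini. *)
Let VE (A : set (R * R)) : measurable A ->
  distribution P V A = (distribution P Z' \x distribution P W')%E A.
Proof.
move=> mA; apply/esym; apply: product_measure_unique => // C D mC mD.
Qed.

Let mM : measurable_fun setT (fun z : R * R => z.1 * z.2).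
Proof. by apply: measurable_funM. Qed.

Let fubE (f : R * R -> \bar R) : measurable_fun setT f ->
  (\int[distribution P Z' \x distribution P W']_z f z =
   \int[distribution P V]_z f z)%E.
Proof. by move=> mf; apply: eq_measure_integral => A mA _; exact/esym/VE. Qed.

Let ZWi : ((distribution P Z' \x distribution P W')%E).-integrable setT
  (fun z : R * R => (z.1 * z.2)%:E).
Proof.
have mE : measurable_fun setT (fun z : R * R => (z.1 * z.2)%:E).
  exact/measurable_EFinP.
apply/(integrable12ltyP _ _ mE) => /=.
have mn D : measurable_fun D (fun y : R => (`|y|)%:E).
  by apply/measurable_EFinP; exact: normr_measurable.
under eq_integral => x _.
  under eq_integral do rewrite normrM EFinM.
  rewrite ge0_integralZl//.
  over.
rewrite ge0_integralZr//; last by apply: integral_ge0.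
rewrite !ge0_integral_distribution//.
have -> : (\int[P]_x ((fun x : R => (`|x|)%:E) \o Z) x = (Ex P (fun w => `|Z w|))%:E)%E.
  by rewrite (ExE (L1_norm ZL)).
have -> : (\int[P]_x ((fun x : R => (`|x|)%:E) \o W) x = (Ex P (fun w => `|W w|))%:E)%E.
  by rewrite (ExE (L1_norm WL)).
by rewrite -EFinM ltry.
Qed.

Lemma L1M_independent : L1 P (fun w => Z w * W w).
Proof.
apply: L1P; first exact: measurable_funM.
have [_] := integrableP _ _ _ ZWi.
rewrite fubE; last by apply: measurableT_comp => //; exact/measurable_EFinP.
rewrite ge0_integral_distribution//.
by apply: measurableT_comp => //; exact/measurable_EFinP.
Qed.

Lemma ExM_independent : Ex P (fun w => Z w * W w) = Ex P Z * Ex P W.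
Proof.
have mE : measurable_fun setT (fun z : R * R => (z.1 * z.2)%:E).
  exact/measurable_EFinP.
have := integral12_prod_meas1 ZWi; rewrite fubE// integral_distribution//; last first.
  exact: L1M_independent.
rewrite /fubini_F/=; under eq_integral => x _.
  under eq_integral do rewrite EFinM.
  rewrite integralZl//; last first.
    by apply: integrable_pushforward.
  rewrite integral_distribution// -/(comp _ _) /=.
  rewrite -(ExE WL) -EFinM.
  over.
move=> h; apply: EFin_inj; rewrite ExE; last exact: L1M_independent.
rewrite -h integral_distribution//=.
- under eq_integral do rewrite EFinM.
  by rewrite integralZr// -(ExE ZL) EFinM.
- by apply/measurable_EFinP; exact: measurable_funM.
- have := L1Z (Ex P W) ZL; apply: eq_integrable => // w _ /=; by rewrite mulrC.
Qed.

End Independence.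

(** * Measurability with respect to a sub-sigma-algebra *)

Section MeasurableWrt.
Context {R : realType} {d : measure_display} {Omega : measurableType d}.
Variable G : set (set Omega).
Hypothesis sG : sigma_algebra setT G.
Implicit Types f g : Omega -> R.

(** Measurability for a sub-sigma-algebra becomes ordinary measurability on another measurable type,
    and inherits its closure properties. *)
Lemma measurable_wrtP f : measurable_wrt G f <->
  measurable_fun setT (f : g_sigma_algebraType G -> R).
Proof.
split=> [mf _ A mA|mf A mA].
  by rewrite setTI /measurable/= sigma_algebra_id//; exact: mf.
by have := mf measurableT A mA; rewrite setTI /measurable/= sigma_algebra_id.
Qed.

Lemma measurable_wrt_comp (h : R -> R) f : measurable_fun setT h ->
  measurable_wrt G f -> measurable_wrt G (fun w => h (f w)).
Proof.
by move=> mh mf A mA; apply: (mf (h @^-1` A)); rewrite -[X in measurable X]setTI; exact: mh.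
Qed.

Lemma measurable_wrt_cst (c : R) : measurable_wrt G (fun=> c).
Proof. by apply/measurable_wrtP; exact: measurable_cst. Qed.

Lemma measurable_wrtB f g : measurable_wrt G f -> measurable_wrt G g ->
  measurable_wrt G (fun w => f w - g w).
Proof. by move=> /measurable_wrtP mf /measurable_wrtP mg; apply/measurable_wrtP;
  exact: measurable_funB. Qed.

Lemma measurable_wrtM f g : measurable_wrt G f -> measurable_wrt G g ->
  measurable_wrt G (fun w => f w * g w).
Proof. by move=> /measurable_wrtP mf /measurable_wrtP mg; apply/measurable_wrtP;
  exact: measurable_funM. Qed.

End MeasurableWrt.

(** * Moments of Brownian increments *)

Section BrownianIncrements.
Context {R : realType} {T : R} {d : measure_display} {Omega : measurableType d}.
Variables (P : probability Omega R) (F : R -> set (set Omega)).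
Variable B : R -> Omega -> R.
Hypotheses (filF : filtration T F) (bmB : brownian_motion T P F B).

Lemma filtration_sigma_algebra t : 0 <= t -> t <= T -> sigma_algebra setT (F t).
Proof. by move=> t0 tT; have [] := filF.1 t; rewrite ?in_itv/= ?t0. Qed.

Lemma filtration_measurable t f : 0 <= t -> t <= T ->
  measurable_wrt (F t) f -> measurable_fun setT (f : Omega -> R).
Proof.
move=> t0 tT mf _ A mA; rewrite setTI.
have [|_ h] := filF.1 t; first by rewrite in_itv/= t0 tT.
by apply: h; exact: mf.
Qed.

Lemma filtration_mono s t f : 0 <= s -> s <= t -> t <= T ->
  measurable_wrt (F s) f -> measurable_wrt (F t) (f : Omega -> R).
Proof. by move=> s0 st tT mf A mA; apply: (filF.2 s t) => //; exact: mf. Qed.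

Lemma brownian_measurable_wrt s t : 0 <= s -> s <= t -> t <= T ->
  measurable_wrt (F t) (B s).
Proof.
move=> s0 st tT; apply: (filtration_mono s0 st tT).
by case: bmB => + _ _ _; apply; rewrite in_itv/= s0 (le_trans st).
Qed.

Lemma brownian_measurable t : 0 <= t -> t <= T -> measurable_fun setT (B t).
Proof. by move=> t0 tT; exact/(filtration_measurable t0 tT)/brownian_measurable_wrt. Qed.

Section Increment.
Variables s t : R.
Hypotheses (s0 : 0 <= s) (st : s < t) (tT : t <= T).

Let W w := B t w - B s w.
Let h0 : 0 < Num.sqrt (t - s). Proof. by rewrite sqrtr_gt0 subr_gt0. Qed.

Let mW : measurable_fun setT W.
Proof.
apply: measurable_funB; apply: brownian_measurable => //.
- exact: le_trans (ltW st).
- exact: le_trans (ltW st) tT.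
Qed.

Let WE : forall A : set R, measurable A ->
  P (W @^-1` A) = normal_prob 0 (Num.sqrt (t - s)) A.
Proof. by case: bmB => _ _ _ /(_ s t s0 st tT)[]. Qed.

Let iW (E : set Omega) (A : set R) : F s E -> measurable A ->
  P (E `&` W @^-1` A) = (P E * P (W @^-1` A))%E.
Proof. by case: bmB => _ _ _ /(_ s t s0 st tT)[_ h]; exact: h. Qed.

Lemma brownian_increment_L1 : L1 P W.
Proof. exact: (gaussian_L1 h0 mW WE (isT : 1 <= 4)%N). Qed.

Lemma brownian_increment_L2 : L2 P W.
Proof. by split=> //; exact: (gaussian_L1 h0 mW WE (isT : 2 <= 4)%N). Qed.

Lemma brownian_increment_L1_norm3 : L1 P (fun w => `|W w| ^+ 3).
Proof.
have := L1_norm (gaussian_L1 h0 mW WE (isT : 3 <= 4)%N).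
by under eq_fun do rewrite normrX.
Qed.

Lemma brownian_increment_norm3_le :
  Ex P (fun w => `|W w| ^+ 3) <= 60 * Num.sqrt (t - s) ^+ 3.
Proof. exact: gaussian_Ex_norm3_le. Qed.

Variable Z : Omega -> R.
Hypotheses (ZL : L1 P Z) (FZ : measurable_wrt (F s) Z).

Lemma brownian_increment_mean0 : L1 P (fun w => Z w * W w) /\
  Ex P (fun w => Z w * W w) = 0.
Proof.
have ZW A A' : measurable A -> measurable A' ->
  P (Z @^-1` A `&` W @^-1` A') = (P (Z @^-1` A) * P (W @^-1` A'))%E.
  by move=> mA mA'; apply: iW => //; exact: FZ.
have WL := brownian_increment_L1.
split; first exact: L1M_independent.
by rewrite (ExM_independent ZL WL ZW) (gaussian_Ex h0 mW WE) mulr0.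
Qed.

Lemma brownian_increment_sqr : L1 P (fun w => Z w * W w ^+ 2) /\
  Ex P (fun w => Z w * W w ^+ 2) = Ex P Z * (t - s).
Proof.
pose W2 w := W w ^+ 2.
have ZW A A' : measurable A -> measurable A' ->
  P (Z @^-1` A `&` W2 @^-1` A') = (P (Z @^-1` A) * P (W2 @^-1` A'))%E.
  (* An event about the square is an event about the increment itself, to which independence of the
     past applies. *)
  move=> mA mA'; pose A2 := (fun x : R => x ^+ 2) @^-1` A'.
  have mA2 : measurable A2.
    by rewrite -[X in measurable X]setTI; exact: exprn_measurable.
  by apply: (iW (A := A2)) => //; exact: FZ.
have [_ W2L] := brownian_increment_L2.
split; first exact: L1M_independent.
rewrite (ExM_independent ZL W2L ZW) (gaussian_Ex2 h0 mW WE) sqr_sqrtr//.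
by rewrite subr_ge0 ltW.
Qed.

End Increment.

End BrownianIncrements.

(** * Elementary stochastic integrals *)

Section ElementaryIntegral.
Context {R : realType} {T : R} {d : measure_display} {Omega : measurableType d}.
Variables (P : probability Omega R) (F : R -> set (set Omega)).
Variable B : R -> Omega -> R.
Hypotheses (filF : filtration T F) (bmB : brownian_motion T P F B).
Notation mu := (@lebesgue_measure R).

(** Here and below the degenerate case [s = t] is included because clamping can collapse the
    interval of an elementary process to a point. *)
Lemma brownian_increment_mean0_le s t Z : 0 <= s -> s <= t -> t <= T ->
  L1 P Z -> measurable_wrt (F s) Z ->
  L1 P (fun w => Z w * (B t w - B s w)) /\ Ex P (fun w => Z w * (B t w - B s w)) = 0.
Proof.
move=> s0; rewrite le_eqVlt => /predU1P[<-|st] tT ZL FZ; last first.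
  exact: (brownian_increment_mean0 filF bmB).
under eq_fun do rewrite subrr mulr0.
by split; [exact: L1_cst|exact: Ex_cst].
Qed.

Lemma brownian_increment_sqr_le s t Z : 0 <= s -> s <= t -> t <= T ->
  L1 P Z -> measurable_wrt (F s) Z ->
  L1 P (fun w => Z w * (B t w - B s w) ^+ 2) /\
  Ex P (fun w => Z w * (B t w - B s w) ^+ 2) = Ex P Z * (t - s).
Proof.
move=> s0; rewrite le_eqVlt => /predU1P[<-|st] tT ZL FZ; last first.
  exact: (brownian_increment_sqr filF bmB).
under eq_fun do rewrite subrr expr0n/= mulr0.
by rewrite subrr mulr0; split; [exact: L1_cst|exact: Ex_cst].
Qed.

Lemma brownian_increment_L2_le s t : 0 <= s -> s <= t -> t <= T ->
  L2 P (fun w => B t w - B s w).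
Proof.
move=> s0; rewrite le_eqVlt => /predU1P[<-|st] tT; last first.
  exact: (brownian_increment_L2 filF bmB).
by under eq_fun do rewrite subrr; apply: (@L2_bounded _ _ _ _ 0) => // w; rewrite normr0.
Qed.

Lemma brownian_increment_norm3_le_le s t : 0 <= s -> s <= t -> t <= T ->
  L1 P (fun w => `|B t w - B s w| ^+ 3) /\
  Ex P (fun w => `|B t w - B s w| ^+ 3) <= 60 * Num.sqrt (t - s) ^+ 3.
Proof.
move=> s0; rewrite le_eqVlt => /predU1P[<-|st] tT; last first.
  by split; [exact: (brownian_increment_L1_norm3 filF bmB)|
             exact: (brownian_increment_norm3_le filF bmB)].
under eq_fun do rewrite subrr normr0 expr0n/=.
split; first exact: L1_cst.
by rewrite Ex_cst mulr_ge0// exprn_ge0// sqrtr_ge0.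
Qed.

(* The elementary process [co * 1_(]lo, hi])]. *)
Record elem := Elem {
  lo : R; hi : R; co : Omega -> R;
  lo_ge0 : 0 <= lo; lo_le_hi : lo <= hi; hi_leT : hi <= T;
  co_measurable : measurable_fun setT co;
  co_bounded : exists M, forall w, `|co w| <= M;
  co_wrt : lo < hi -> measurable_wrt (F lo) co }.

Definition einc u w := co u w * (B (hi u) w - B (lo u) w).

(** Length of the intersection of the two intervals, also when they are disjoint. *)
Definition overlap u v := Num.max 0 (Num.min (hi u) (hi v) - Num.max (lo u) (lo v)).

Lemma co2_bounded u v : exists M, forall w, `|co u w * co v w| <= M.
Proof.
have [M1 h1] := co_bounded u; have [M2 h2] := co_bounded v.
by exists (M1 * M2) => w; rewrite normrM; exact: ler_pM.
Qed.

Lemma co2_measurable u v : measurable_fun setT (fun w => co u w * co v w).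
Proof. by apply: measurable_funM; exact: co_measurable. Qed.

Lemma co2_L1 u v : L1 P (fun w => co u w * co v w).
Proof. by have [M h] := co2_bounded u v; apply: (L1_bounded _ (co2_measurable u v) h). Qed.

Lemma einc_L2 u : L2 P (einc u).
Proof.
have [M h] := co_bounded u.
apply: (L2Mbounded (co_measurable u) h); apply: brownian_increment_L2_le.
- exact: lo_ge0.
- exact: lo_le_hi.
- exact: hi_leT.
Qed.

(** Cut at [a' = lo v] and at the smaller right end [m]. Outside the common part []a', m]], each
    term is an increment multiplied by factors known at its start, so it has mean zero; the common
    part contributes the square of one increment. *)
Let einc_mul_le u v : lo u <= lo v ->
  Ex P (fun w => einc u w * einc v w) =
  Ex P (fun w => co u w * co v w) * overlap u v.
Proof.
move=> uv; rewrite /overlap (max_r uv).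
have [lu0 lhu huT] := And3 (lo_ge0 u) (lo_le_hi u) (hi_leT u).
have [lv0 lhv hvT] := And3 (lo_ge0 v) (lo_le_hi v) (hi_leT v).
have [uE|lu] := leP (hi u) (lo u).
  have e : hi u = lo u by lra.
  under eq_Ex do rewrite /einc e subrr mulr0 mul0r.
  rewrite Ex_cst max_l ?mulr0// subr_le0 ge_min; apply/orP; left; lra.
have [vE|lv] := leP (hi v) (lo v).
  have e : hi v = lo v by lra.
  under eq_Ex do rewrite /einc e subrr !mulr0.
  by rewrite Ex_cst max_l ?mulr0// subr_le0 ge_min e lexx orbT.
set a := lo u in uv lu lu0 lhu *; set b := hi u in lu huT lhu *.
set a' := lo v in uv lv lv0 lhv *; set b' := hi v in lv hvT lhv *.
pose cd w := co u w * co v w.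
have [M cdM] := co2_bounded u v.
have mcd : measurable_fun setT cd by exact: co2_measurable.
have a'T : a' <= T by lra.
have sF t : 0 <= t -> t <= T -> sigma_algebra setT (F t) by exact: filtration_sigma_algebra.
have Fcd : measurable_wrt (F a') cd.
  apply: measurable_wrtM; [exact: sF| |exact: co_wrt].
  by apply: (filtration_mono filF lu0 uv a'T); exact: co_wrt.
have FB s t : 0 <= s -> s <= t -> t <= T -> measurable_wrt (F t) (B s).
  exact: (brownian_measurable_wrt filF bmB).
have ZF r s t : 0 <= r -> r <= s -> a' <= s -> s <= t -> t <= T ->
    measurable_wrt (F t) (fun w => cd w * (B s w - B r w)).
  move=> r0 rs a's st tT; have t0 : 0 <= t by lra.
  apply: measurable_wrtM; first exact: sF.
    by apply: (filtration_mono filF lv0 _ tT) => //; lra.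
  by apply: measurable_wrtB; [exact: sF|apply: FB => //; lra|apply: FB => //; lra].
have ZL r s : 0 <= r -> r <= s -> s <= T -> L1 P (fun w => cd w * (B s w - B r w)).
  move=> r0 rs sT; apply: (L1Mbounded mcd cdM).
  exact/L2_L1/brownian_increment_L2_le.
have cdL : L1 P cd by exact: co2_L1.
(* If the intervals do not meet, the first increment is already known at time [a']. *)
have [ba'|a'b] := leP b a'.
  rewrite max_l ?mulr0; last by rewrite subr_le0 ge_min ba'.
  have FZ : measurable_wrt (F a') (fun w => cd w * (B b w - B a w)).
    apply: measurable_wrtM => //; first exact: sF.
    by apply: measurable_wrtB; [exact: sF|apply: FB => //; lra|exact: FB].
  have [_ <-] := brownian_increment_mean0_le lv0 lhv hvT (ZL _ _ lu0 lhu huT) FZ.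
  by apply: eq_Ex => w; rewrite /einc /cd -/a -/b -/a' -/b'; ring.
pose X1 w := cd w * (B a' w - B a w) * (B b' w - B a' w).
have FX1 : measurable_wrt (F a') (fun w => cd w * (B a' w - B a w)) by exact: ZF.
have [X1L X10] := brownian_increment_mean0_le lv0 lhv hvT (ZL _ _ lu0 uv a'T) FX1.
pose m := Num.min b b'; pose M' := Num.max b b'.
have [am mM MT] : [/\ a' <= m, m <= M' & M' <= T].
  by rewrite /m /M'; case: (leP b b') => ?; split; lra.
have mT : m <= T by lra.
have [X2L X20] := brownian_increment_sqr_le lv0 am mT cdL Fcd.
have m0 : 0 <= m by lra.
have FX3 : measurable_wrt (F m) (fun w => cd w * (B m w - B a' w)) by exact: ZF.
have [X3L X30] := brownian_increment_mean0_le m0 mM MT (ZL _ _ lv0 am mT) FX3.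
transitivity (Ex P (fun w => cd w * (B a' w - B a w) * (B b' w - B a' w)
  + cd w * (B m w - B a' w) ^+ 2 + cd w * (B m w - B a' w) * (B M' w - B m w))).
  apply: eq_Ex => w; rewrite /einc -/a -/b -/a' -/b' /cd /m /M'.
  by case: (leP b b') => _; ring.
rewrite ExD//; last exact: L1D.
rewrite ExD// X10 X20 X30 add0r addr0; congr (_ * _).
by rewrite max_r// subr_ge0.
Qed.

Lemma Ex_einc_mul u v : Ex P (fun w => einc u w * einc v w) =
  Ex P (fun w => co u w * co v w) * overlap u v.
Proof.
have [uv|/ltW vu] := leP (lo u) (lo v); first exact: einc_mul_le.
transitivity (Ex P (fun w => einc v w * einc u w)).
  by apply: eq_Ex => w; rewrite mulrC.
rewrite einc_mul_le//; congr (_ * _); first by apply: eq_Ex => w; rewrite mulrC.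
by rewrite /overlap minC (maxC (lo v)).
Qed.

Lemma Ex_einc (xi : Omega -> R) u : measurable_fun setT xi -> (exists M, forall w, `|xi w| <= M) ->
  measurable_wrt (F (lo u)) xi -> Ex P (fun w => xi w * einc u w) = 0.
Proof.
move=> mxi [M xiM] Fxi.
have [lu0 lhu huT] := And3 (lo_ge0 u) (lo_le_hi u) (hi_leT u).
have [uE|lu] := leP (hi u) (lo u).
  have e : hi u = lo u by lra.
  by under eq_Ex do rewrite /einc e subrr !mulr0; rewrite Ex_cst.
have [M2 coM] := co_bounded u.
have ZL : L1 P (fun w => xi w * co u w).
  by apply: (L1Mbounded mxi xiM); exact: (L1_bounded _ (co_measurable u) coM).
have FZ : measurable_wrt (F (lo u)) (fun w => xi w * co u w).
  apply: measurable_wrtM => //; last exact: co_wrt.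
  by apply: (filtration_sigma_algebra filF) => //; exact: le_trans huT.
have [_ <-] := brownian_increment_mean0_le lu0 lhu huT ZL FZ.
by apply: eq_Ex => w; rewrite /einc mulrA.
Qed.

Section Localize.
Variables s t : R.
Hypotheses (s0 : 0 <= s) (st : s <= t) (tT : t <= T).

(** Projection onto [[s, t]] when [s <= t]. It restricts elementary integrals to []s, t]]; with
    [s = 0] and [t = T] it later freezes processes outside [[0, T]]. *)
Definition clamp (x : R) := Num.max s (Num.min t x).

Lemma clamp_ge x : s <= clamp x.
Proof. by rewrite /clamp le_max lexx. Qed.

Lemma clamp_le x : clamp x <= t.
Proof. by rewrite /clamp ge_max st ge_min lexx. Qed.

Lemma clamp_mono x y : x <= y -> clamp x <= clamp y.
Proof.
move=> xy; rewrite /clamp ge_max le_max lexx/= le_max; apply/orP; right.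
by rewrite le_min ge_min lexx/= ge_min xy orbT.
Qed.

Variable xi : Omega -> R.
Hypotheses (mxi : measurable_fun setT xi) (xiM : exists M, forall w, `|xi w| <= M).
Hypothesis Fxi : measurable_wrt (F s) xi.

Let loc_co u w := xi w * co u w.

Let loc_ge0 u : 0 <= clamp (lo u). Proof. exact: le_trans (clamp_ge _). Qed.
Let loc_le u : clamp (lo u) <= clamp (hi u). Proof. exact/clamp_mono/lo_le_hi. Qed.
Let loc_leT u : clamp (hi u) <= T. Proof. exact: le_trans (clamp_le _) tT. Qed.

Let loc_measurable u : measurable_fun setT (loc_co u).
Proof. by apply: measurable_funM => //; exact: co_measurable. Qed.

Let loc_bounded u : exists M, forall w, `|loc_co u w| <= M.
Proof.
have [M1 h1] := xiM; have [M2 h2] := co_bounded u.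
by exists (M1 * M2) => w; rewrite normrM; exact: ler_pM.
Qed.

(** An interval that starts after [t] collapses to the point [t], at which its coefficient need not
    be known yet. The premise excludes this case, and [co_wrt] is conditional for the same
    reason. *)
Let loc_wrt u : clamp (lo u) < clamp (hi u) -> measurable_wrt (F (clamp (lo u))) (loc_co u).
Proof.
move=> lh; have cT : clamp (lo u) <= T by exact: le_trans (clamp_le _) tT.
apply: measurable_wrtM.
- exact: (filtration_sigma_algebra filF).
- by apply: (filtration_mono filF s0) => //; exact: clamp_ge.
- apply: (filtration_mono filF (lo_ge0 u)) => //; last apply: co_wrt.
    have [lt|tl] := leP (lo u) t; first by rewrite /clamp (min_r lt) le_max lexx orbT.
    by move: lh; rewrite ltNge {2}/clamp (min_l (ltW tl)) (max_r st) clamp_le.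
  by rewrite ltNge; apply: contraTN lh => /clamp_mono; rewrite -leNgt.
Qed.

(** The product of [u] with [xi * 1_(]s, t])]: a weight known at time [s] can be absorbed into a
    coefficient because the clamped interval starts no earlier than [s]. *)
Definition localize u :=
  Elem (loc_ge0 u) (loc_le u) (loc_leT u) (loc_measurable u) (loc_bounded u) (@loc_wrt u).

End Localize.

(** The stochastic integral over []s, t]] of the elementary process [lval L]: clamping both ends
    cuts each interval down to []s, t]]. *)
Definition lint s t (L : seq elem) w :=
  \sum_(u <- L) co u w * (B (clamp s t (hi u)) w - B (clamp s t (lo u)) w).

Definition lval (L : seq elem) (r : R) w : R :=
  \sum_(u <- L) co u w * \1_(`]lo u, hi u]%classic) r.

End ElementaryIntegral.

Section RintegralSum.
Context {R : realType} {d : measure_display} {T : measurableType d}.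
Variables (mu : {measure set T -> \bar R}) (D : set T).
Hypothesis mD : measurable D.

Lemma integrable_Rsum I (s : seq I) (F : I -> T -> R) :
  (forall i, mu.-integrable D (EFin \o F i)) ->
  mu.-integrable D (EFin \o (fun x => \sum_(i <- s) F i x)).
Proof.
move=> FL; elim: s => [|i s IH].
  rewrite (_ : _ \o _ = cst 0%E); first exact: integrable0.
  by apply/funext => x /=; rewrite big_nil.
have := integrableD mD (FL i) IH.
by apply: eq_integrable => // x _ /=; rewrite big_cons EFinD.
Qed.

Lemma Rintegral_sum I (s : seq I) (F : I -> T -> R) :
  (forall i, mu.-integrable D (EFin \o F i)) ->
  \int[mu]_(x in D) (\sum_(i <- s) F i x) = \sum_(i <- s) \int[mu]_(x in D) F i x.
Proof.
move=> FL; elim: s => [|i s IH].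
  rewrite big_nil; under eq_Rintegral do rewrite big_nil.
  by rewrite Rintegral_cst// mul0r.
under eq_Rintegral do rewrite big_cons.
by rewrite RintegralD//; [rewrite IH big_cons|exact: integrable_Rsum].
Qed.

End RintegralSum.

(** Both sides are the length of the trace of []L, H]] on []s, t]]. *)
Lemma max0_clampB (R : realType) (s t H L : R) : s <= t ->
  Num.max 0 (Num.max s (Num.min t H) - Num.max s (Num.min t L)) =
  Num.max 0 (Num.min t H - Num.max s L).
Proof.
move=> st; rewrite /Num.max /Num.min.
by case: (ltP t H) => ?; case: (ltP t L) => ?; case: (ltP s L) => ?;
  rewrite ?[s < t]lt_neqAle ?st ?andbT; (try case: (ltP s H) => ?);
  (try case: (eqVneq s t) => ? /=); case: ltP => ?; try case: ltP => ?; lra.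
Qed.

(** * The Ito isometry for elementary processes, with a weight known at the left endpoint *)

Section Isometry.
Context {R : realType} {T : R} {d : measure_display} {Omega : measurableType d}.
Variables (P : probability Omega R) (F : R -> set (set Omega)).
Variable B : R -> Omega -> R.
Hypotheses (filF : filtration T F) (bmB : brownian_motion T P F B).
Notation mu := (@lebesgue_measure R).
Variables s t : R.
Hypotheses (s0 : 0 <= s) (st : s <= t) (tT : t <= T).
Variable xi : Omega -> R.
Hypotheses (mxi : measurable_fun setT xi) (xiM : exists M, forall w, `|xi w| <= M).
Hypothesis Fxi : measurable_wrt (F s) xi.

Notation elem := (@elem R T d Omega F).

Let loc (u : elem) := localize filF s0 st tT mxi xiM Fxi u.

Let m1 : measurable_fun setT (fun _ : Omega => 1 : R). Proof. by []. Qed.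
Let M1 : exists M, forall w : Omega, `|(fun _ => 1 : R) w| <= M.
Proof. by exists 1 => w; rewrite normr1. Qed.
Let F1 : measurable_wrt (F s) (fun _ : Omega => 1 : R).
Proof. by apply: measurable_wrt_cst; apply: (filtration_sigma_algebra filF) => //;
  exact: le_trans tT. Qed.
(** The second factor of each product is localized with weight 1, so that a square carries [xi] only
    once. *)
Let loc1 (u : elem) := localize filF s0 st tT m1 M1 F1 u.

Let ind2 (u v : elem) (r : R) : R :=
  \1_(`]lo u, hi u]%classic) r * \1_(`]lo v, hi v]%classic) r.

Let ind2E u v : ind2 u v =
  \1_(`]Num.max (lo u) (lo v), Num.min (hi u) (hi v)]%classic).
Proof.
apply/funext => r; rewrite /ind2 !indicE -natrM mulnb; congr (_%:R); congr nat_of_bool.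
apply/andP/idP => [[]|]; rewrite !inE/= !in_itv/= !(ge_max, le_min, gt_max, lt_min).
  by move=> /andP[-> ->] /andP[-> ->].
by move=> /andP[/andP[-> ->] /andP[-> ->]].
Qed.

Let ind2_integrable u v : mu.-integrable (`]s, t] : set R) (EFin \o ind2 u v).
Proof.
apply: (@integrableS _ _ _ mu setT) => //; rewrite ind2E.
exact: integrable_indic_itv.
Qed.

Let overlap_loc u v : \int[mu]_(r in `]s, t]) ind2 u v r = overlap (loc u) (loc1 v).
Proof.
rewrite /overlap /=.
have -> : Num.min (clamp s t (hi u)) (clamp s t (hi v)) =
    clamp s t (Num.min (hi u) (hi v)).
  have [h|/ltW h] := leP (hi u) (hi v).
    by rewrite min_l//; exact: clamp_mono.
  by rewrite min_r//; exact: clamp_mono.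
have -> : Num.max (clamp s t (lo u)) (clamp s t (lo v)) =
    clamp s t (Num.max (lo u) (lo v)).
  have [h|/ltW h] := leP (lo u) (lo v).
    by rewrite max_r//; exact: clamp_mono.
  by rewrite max_l//; exact: clamp_mono.
rewrite /clamp max0_clampB// ind2E /Rintegral integral_indic//.
rewrite (_ : _ `&` _ = `]Num.max s (Num.max (lo u) (lo v)),
    Num.min t (Num.min (hi u) (hi v))]%classic); last first.
  apply/seteqP; split => r /=; rewrite !in_itv/= !(gt_max, le_min).
    by move=> [/andP[/andP[-> ->] /andP[-> ->]] /andP[-> ->]].
  by move=> /andP[/and3P[-> -> ->] /and3P[-> -> ->]].
rewrite /= lebesgue_measure_itv/= lte_fin.
case: ltP => h; first by rewrite -EFinB/= [RHS]max_r// subr_ge0 ltW.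
by rewrite /= [RHS]max_l// subr_le0.
Qed.

Lemma Rintegral_lval_sqr (L : seq elem) w :
  \int[mu]_(r in `]s, t]) (lval L r w ^+ 2) =
  \sum_(u <- L) \sum_(v <- L) co u w * co v w * overlap (loc u) (loc1 v).
Proof.
have E r : lval L r w ^+ 2 = \sum_(u <- L) \sum_(v <- L) co u w * co v w * ind2 u v r.
  rewrite expr2 /lval big_distrlr/=; apply: eq_bigr => u _; apply: eq_bigr => v _.
  by rewrite /ind2; ring.
under eq_Rintegral do rewrite E.
have i2 u v : mu.-integrable (`]s, t] : set R)
    (EFin \o (fun r => co u w * co v w * ind2 u v r)).
  exact: (integrableZl _ _ (ind2_integrable u v)).
have mD : @measurable _ (measurableTypeR R) `]s, t]%classic by exact: measurable_itv.
have i1 u := integrable_Rsum mD L (i2 u).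
rewrite Rintegral_sum//; apply: eq_bigr => u _.
rewrite Rintegral_sum//; apply: eq_bigr => v _.
by rewrite RintegralZl// overlap_loc.
Qed.

Lemma lint_L2 (L : seq elem) : L2 P (lint B s t L).
Proof. by apply: L2_sum => u; have := einc_L2 filF bmB (loc1 u); rewrite /einc/=;
  under eq_fun do rewrite mul1r. Qed.

Lemma Ex_lint (L : seq elem) : Ex P (fun w => xi w * lint B s t L w) = 0.
Proof.
have [M hM] := xiM.
have e w : xi w * lint B s t L w = \sum_(u <- L) einc B (loc u) w.
  by rewrite /lint mulr_sumr; apply: eq_bigr => u _; rewrite mulrA.
rewrite (eq_Ex _ e) Ex_sum => [|u]; last exact/L2_L1/(einc_L2 filF bmB).
rewrite big1// => u _.
transitivity (Ex P (fun w => xi w * einc B (loc1 u) w)).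
  by apply: eq_Ex => w; rewrite /einc/=; ring.
apply: (Ex_einc filF bmB) => //=.
apply: (filtration_mono filF s0) => //; first exact: clamp_ge.
exact: le_trans (clamp_le st _) tT.
Qed.

(** Testing against a bounded [xi] known at time [s] stands in for conditioning on [F s]. Both
    expectations expand into the same double sum of coefficients and overlaps. *)
Lemma Ex_lint_sqr (L : seq elem) :
  L1 P (fun w => xi w * lint B s t L w ^+ 2) /\
  Ex P (fun w => xi w * lint B s t L w ^+ 2) =
  Ex P (fun w => xi w * \int[mu]_(r in `]s, t]) (lval L r w ^+ 2)).
Proof.
have [M hM] := xiM.
split; first by apply: (L1Mbounded mxi hM); have [] := lint_L2 L.
transitivity (Ex P (fun w => \sum_(u <- L) \sum_(v <- L) einc B (loc u) w * einc B (loc1 v) w)).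
  apply: eq_Ex => w; rewrite expr2 mulrA /lint [xi w * _]mulr_sumr big_distrlr/=.
  by apply: eq_bigr => u _; apply: eq_bigr => v _; rewrite /einc/=; ring.
transitivity (Ex P (fun w => \sum_(u <- L) \sum_(v <- L)
   overlap (loc u) (loc1 v) * (co (loc u) w * co (loc1 v) w))); last first.
  apply: eq_Ex => w; rewrite Rintegral_lval_sqr mulr_sumr.
  apply: eq_bigr => u _; rewrite mulr_sumr; apply: eq_bigr => v _ /=.
  by rewrite mul1r; ring.
have i1 u v : L1 P (fun w => einc B (loc u) w * einc B (loc1 v) w).
  by apply: L2M_L1; exact: (einc_L2 filF bmB).
have i2 u v : L1 P (fun w => overlap (loc u) (loc1 v) * (co (loc u) w * co (loc1 v) w)).
  by apply: L1Z; exact: co2_L1.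
rewrite Ex_sum; last by move=> u; exact: L1_sum.
rewrite [RHS]Ex_sum; last by move=> u; exact: L1_sum.
apply: eq_bigr => u _; rewrite Ex_sum// [RHS]Ex_sum//; apply: eq_bigr => v _.
rewrite (Ex_einc_mul filF bmB) ExZ; last exact: co2_L1.
by rewrite mulrC.
Qed.

End Isometry.

(** * Exchanging expectation and time integral *)

Section TimeFubini.
Context {R : realType} {d : measure_display} {Omega : measurableType d}.
Variable P : probability Omega R.
Notation mu := (@lebesgue_measure R).
Variables (G : R -> Omega -> R) (K : R).
Hypothesis mG : measurable_fun setT (fun z : R * Omega => G z.1 z.2).
Hypothesis GK : forall r w, `|G r w| <= K.

Lemma jointly_measurable_time w : measurable_fun setT (G ^~ w).
Proof. exact: (measurable_fun_pair1 w mG). Qed.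

Lemma jointly_measurable_space r : measurable_fun setT (G r).
Proof. exact: (measurable_fun_pair2 r mG). Qed.

Variables s t : R.
Hypothesis st : s <= t.

Let mD : @measurable _ (measurableTypeR R) `]s, t]%classic.
Proof. exact: measurable_itv. Qed.

Let muD : mu `]s, t]%classic = (t - s)%:E.
Proof.
rewrite lebesgue_measure_itv/= lte_fin; case: ltP => //= ts.
by rewrite (@le_anti _ _ t s) ?subrr// ts st.
Qed.

Let muDy : (mu `]s, t]%classic < +oo)%E. Proof. by rewrite muD ltry. Qed.

Lemma bounded_time_integrable w : mu.-integrable `]s, t] (EFin \o (G ^~ w)).
Proof.
apply: measurable_bounded_integrable => //.
- by apply: measurable_funTS; exact: (jointly_measurable_time w).
- exists K; split; first by rewrite num_real.
  by move=> x Kx r _ /=; exact: (le_trans (GK _ _) (ltW Kx)).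
Qed.

Lemma norm_time_integral_le w : `|\int[mu]_(r in `]s, t]) G r w| <= K * (t - s).
Proof.
apply: le_trans (le_normr_Rintegral mD (bounded_time_integrable w)) _.
apply: (@le_trans _ _ (\int[mu]_(r in `]s, t]) K)).
  apply: le_Rintegral => //.
  - exact: integrable_norm (bounded_time_integrable w).
  - by apply: measurable_bounded_integrable => //; exists `|K|; split;
    [rewrite num_real|move=> x /ltW Kx r _].
rewrite Rintegral_cst// (_ : fine _ = t - s)//.
exact: (congr1 fine muD).
Qed.

(** The indicator moves the time domain into the integrand, so that Fubini applies on the whole
    product. *)
Let f (z : measurableTypeR R * Omega) : \bar R :=
  (G z.1 z.2 * \1_(`]s, t]%classic) z.1)%:E.

Let mf : measurable_fun setT f.
Proof.
apply/measurable_EFinP/measurable_funM; first exact: mG.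
by apply: (measurableT_comp (measurable_indic _)) => //; exact: measurable_itv.
Qed.

Let fi : (mu \x P)%E.-integrable setT f.
Proof.
have K0 : 0 <= K by exact: le_trans (normr_ge0 _) (GK 0 point).
apply/(integrable12ltyP _ _ mf) => /=.
apply: (@le_lt_trans _ _ (\int[mu]_(r in `]s, t]) K%:E)%E); last first.
  by rewrite integral_cst//; apply: lte_mul_pinfty.
rewrite [leRHS]integral_mkcond/=.
apply: ge0_le_integral => //.
- by move=> r _; apply: integral_ge0.
- apply: (measurable_fun_fubini_tonelli_F (abse \o f)).
  + exact: measurableT_comp.
  + by move=> z; exact: abse_ge0.
- by apply: (measurable_restrictT _ mD).1; exact: measurable_funTS.
- move=> r _; rewrite /f/= patchE indicE; case: ifPn => _.
    under eq_integral do rewrite mulr1.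
    apply: (@le_trans _ _ (\int[P]_w K%:E)%E).
      apply: ge0_le_integral => //.
      + apply/measurable_EFinP/measurableT_comp => //.
        exact: jointly_measurable_space.
      + by move=> w _; rewrite lee_fin.
    by rewrite integral_cst// [X in (_ * X)%E](@probability_setT _ _ _ P) mule1.
  under eq_integral do rewrite mulr0 normr0.
  by rewrite integral0.
Qed.

Let fE w : (\int[mu]_(r in `]s, t]) (G r w)%:E = \int[mu]_r f (r, w))%E.
Proof.
rewrite integral_mkcond; apply: eq_integral => r _; rewrite patchE /f/= indicE.
by case: ifPn; rewrite ?mulr1 ?mulr0.
Qed.

Lemma measurable_time_integral :
  measurable_fun setT (fun w => \int[mu]_(r in `]s, t]) G r w).
Proof.
have := measurable_fubini_G fi.
move=> /(measurableT_comp (fine_measurable measurableT)).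
by congr measurable_fun; apply/funext => w /=; rewrite /Rintegral fE.
Qed.

Lemma time_integral_L1 : L1 P (fun w => \int[mu]_(r in `]s, t]) G r w).
Proof. exact: (L1_bounded _ measurable_time_integral norm_time_integral_le). Qed.

Let GL1 r : L1 P (G r).
Proof. exact: (L1_bounded _ (jointly_measurable_space r) (GK r)). Qed.

Lemma norm_Ex_time_le r : `|Ex P (G r)| <= K.
Proof.
apply: le_trans (Ex_norm (GL1 r)) _; rewrite -[leRHS](Ex_cst P).
by apply: Ex_le; [exact: L1_norm|exact: L1_cst|].
Qed.

Lemma Ex_time_integral : Ex P (fun w => \int[mu]_(r in `]s, t]) G r w) =
  \int[mu]_(r in `]s, t]) Ex P (G r).
Proof.
apply: EFin_inj; rewrite ExE; last exact: time_integral_L1.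
have -> : (\int[P]_w (\int[mu]_(r in `]s, t]) G r w)%:E =
    \int[P]_w \int[mu]_r f (r, w))%E.
  apply: eq_integral => w _; rewrite -fE /Rintegral fineK//.
  exact: (integrable_fin_num mD (bounded_time_integrable w)).
rewrite -(Fubini fi).
have -> : (\int[mu]_r \int[P]_w f (r, w) = \int[mu]_(r in `]s, t]) (Ex P (G r))%:E)%E.
  rewrite [RHS]integral_mkcond; apply: eq_integral => r _; rewrite patchE /f/= indicE.
  case: ifPn => _; first by under eq_integral do rewrite mulr1; rewrite ExE.
  by under eq_integral do rewrite mulr0; rewrite integral0.
rewrite /Rintegral fineK//.
have := integrable_fin_num measurableT (integrable_fubini_F fi).
rewrite /fubini_F; congr (_ \is a fin_num).
rewrite [RHS]integral_mkcond; apply: eq_integral => r _; rewrite patchE /f/= indicE.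
case: ifPn => _; first by under eq_integral do rewrite mulr1; rewrite ExE.
by under eq_integral do rewrite mulr0; rewrite integral0.
Qed.

End TimeFubini.

Lemma measurable_Ex_time (R : realType) (d : measure_display)
  (Omega : measurableType d) (P : probability Omega R) (G : R -> Omega -> R) (K : R) :
  measurable_fun setT (fun z : R * Omega => G z.1 z.2) ->
  (forall r w, `|G r w| <= K) -> measurable_fun setT (fun r => Ex P (G r)).
Proof.
move=> mG GK.
(* Adding [K] makes the integrand nonnegative, as Tonelli requires; it is subtracted again below. *)
have mG' : measurable_fun setT (fun z : R * Omega => (G z.1 z.2 + K)%:E).
  by apply/measurable_EFinP/measurable_funD.
have GK0 r w : 0 <= G r w + K by have := GK r w; rewrite ler_norml => /andP[]; lra.
have := measurable_fun_fubini_tonelli_F (m2 := P) _ mG'.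
move=> /(_ _)/(measurableT_comp (fine_measurable measurableT)) h.
have -> : (fun r => Ex P (G r)) =
  (fun r => fine (\int[P]_w (G r w + K)%:E)%E - K).
  apply/funext => r.
  have GL : L1 P (G r) by exact: (L1_bounded _ (jointly_measurable_space mG r) (GK r)).
  rewrite -[X in X - K]/(Ex P (fun w => G r w + K)) ExD//; last exact: L1_cst.
  by rewrite Ex_cst addrK.
by apply: measurable_funB => //; apply: h => z; rewrite lee_fin.
Qed.

(** Discards errors proportional to an arbitrary tolerance, so that constants need no
    normalization. *)
Lemma le_eps_mul (R : realType) (x y C : R) :
  (forall e, 0 < e -> x <= y + C * e) -> x <= y.
Proof.
move=> h; apply/ler_addgt0Pr => e e0.
apply: (le_trans (h (e / (1 + `|C|)) _)); first by rewrite divr_gt0// ltr_pwDl.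
rewrite lerD2l mulrCA -[leRHS]mulr1 ler_pM2l// ler_pdivrMr ?ltr_pwDl// mul1r.
by rewrite (le_trans (ler_norm C))// lerDr.
Qed.

Section SplitInterval.
Context {R : realType}.
Notation mu := (@lebesgue_measure R).

Lemma Rintegral_itv_cat (f : R -> R) (a b c : R) : a <= b -> b <= c ->
  mu.-integrable (`]a, c] : set R) (EFin \o f) ->
  \int[mu]_(r in `]a, c]) f r = \int[mu]_(r in `]a, b]) f r + \int[mu]_(r in `]b, c]) f r.
Proof.
move=> ab bc fi.
have := @Rintegral_itvB _ f (BRight a) (BRight c) b fi.
by rewrite !bnd_simp => /(_ ab bc) <-; rewrite addrC subrK.
Qed.

Lemma integrable_itv_sub (f : R -> R) (a b a' b' : R) : a <= a' -> b' <= b ->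
  mu.-integrable (`]a, b] : set R) (EFin \o f) ->
  mu.-integrable (`]a', b'] : set R) (EFin \o f).
Proof.
move=> aa bb; apply: integrableS => // r /=; rewrite !in_itv/= => /andP[ar rb].
by rewrite (le_lt_trans aa)//= (le_trans rb).
Qed.

Lemma Rintegral_grid (f : R -> R) (h : R) (n : nat) : 0 <= h ->
  mu.-integrable (`]0, n%:R * h] : set R) (EFin \o f) ->
  \sum_(i < n) \int[mu]_(r in `](i%:R * h), (i.+1%:R * h)]) f r =
  \int[mu]_(r in `]0, n%:R * h]) f r.
Proof.
move=> h0; elim: n => [|n IH] fi.
  rewrite big_ord0 mul0r set_itv_ge ?Rintegral_set0// bnd_simp ltxx//.
have nn : n%:R * h <= n.+1%:R * h by rewrite ler_wpM2r// ler_nat.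
have n0 : 0 <= n%:R * h by rewrite mulr_ge0.
rewrite big_ord_recr/= IH; last exact: integrable_itv_sub fi.
by rewrite -(Rintegral_itv_cat n0 nn fi).
Qed.

End SplitInterval.

(* The shape of the second-order Taylor remainder of a function with bounded
   second and third derivatives. *)
Definition cubic_min (R : realType) (x : R) : R := Num.min (`|x| ^+ 3) (x ^+ 2).

Section CubicMin.
Context {R : realType}.
Implicit Types x y : R.

Lemma cubic_min_ge0 x : 0 <= cubic_min x.
Proof. by rewrite /cubic_min le_min exprn_ge0// sqr_ge0. Qed.

Lemma cubic_min_le_sqr x : cubic_min x <= x ^+ 2.
Proof. by rewrite /cubic_min ge_min lexx orbT. Qed.

Lemma cubic_min_le_cube x : cubic_min x <= `|x| ^+ 3.
Proof. by rewrite /cubic_min ge_min lexx. Qed.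

Lemma measurable_cubic_min : measurable_fun setT (@cubic_min R).
Proof.
apply: measurable_minr; last exact: exprn_measurable.
by apply: measurable_funX; exact: normr_measurable.
Qed.

(** The larger term absorbs the smaller: [|x + y| <= 2 |y|], and 8 bounds both [2 ^ 3] and
    [2 ^ 2]. *)
Let cubic_min_double x y : `|x| <= `|y| -> cubic_min (x + y) <= 8 * cubic_min y.
Proof.
move=> xy; have h : `|x + y| <= 2 * `|y| by rewrite (le_trans (ler_normD _ _))//; lra.
have y0 := normr_ge0 y; have s0 := normr_ge0 (x + y).
rewrite /cubic_min minr_pMr// le_min !ge_min; apply/andP; split; apply/orP; [left|right].
  apply: (@le_trans _ _ ((2 * `|y|) ^+ 3)); first by rewrite lerXn2r// nnegrE mulr_ge0.
  by rewrite exprMn; rewrite ler_wpM2r ?exprn_ge0//; lra.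
rewrite -(real_normK (num_real (x + y))) -(real_normK (num_real y)).
apply: (@le_trans _ _ ((2 * `|y|) ^+ 2)); first by rewrite lerXn2r// nnegrE mulr_ge0.
by rewrite exprMn; rewrite ler_wpM2r ?exprn_ge0//; lra.
Qed.

Lemma cubic_minD x y : cubic_min (x + y) <= 8 * cubic_min x + 8 * cubic_min y.
Proof.
have := cubic_min_ge0 x; have := cubic_min_ge0 y.
have [xy|/ltW yx] := leP `|x| `|y|; first by have := cubic_min_double xy; lra.
by have := cubic_min_double yx; rewrite addrC; lra.
Qed.

(** Asymmetric form for a perturbation [y] that is controlled in L2 only: when it dominates,
    [(x + y)^2 <= 4 y^2]. *)
Lemma cubic_minD_sqr x y : cubic_min (x + y) <= 8 * cubic_min x + 4 * y ^+ 2.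
Proof.
have x0 := cubic_min_ge0 x; have y0 := sqr_ge0 y.
have [xy|/ltW yx] := leP `|x| `|y|; last first.
  by have := cubic_min_double yx; rewrite addrC; lra.
apply: (le_trans (cubic_min_le_sqr _)).
have : x ^+ 2 <= y ^+ 2.
  by rewrite -(real_normK (num_real x)) -(real_normK (num_real y)) lerXn2r ?nnegrE.
by have := sqr_ge0 (x - y); nra.
Qed.

End CubicMin.

(** * Limits of elementary stochastic integrals *)

Section ItoClass.
Context {R : realType} {T : R} {d : measure_display} {Omega : measurableType d}.
Variables (P : probability Omega R) (F : R -> set (set Omega)).
Variable B : R -> Omega -> R.
Hypotheses (filF : filtration T F) (bmB : brownian_motion T P F B).
Hypothesis T0 : 0 <= T.
Notation mu := (@lebesgue_measure R).
Notation elem := (@elem R T d Omega F).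
Implicit Types (H J : R -> Omega -> R) (L : seq elem).

Lemma lval_bounded L : exists K, forall r w, `|lval L r w| <= K.
Proof.
elim: L => [|u L [K hK]]; first by exists 0 => r w; rewrite /lval big_nil normr0.
have [M hM] := co_bounded u; exists (M + K) => r w.
rewrite /lval big_cons; apply: le_trans (ler_normD _ _) _; apply: lerD; last exact: hK.
rewrite normrM indicE (le_trans _ (hM w))// ler_piMr//.
by case: (_ \in _); rewrite ?normr1 ?normr0.
Qed.

Lemma lval_measurable L : measurable_fun setT (fun z : R * Omega => lval L z.1 z.2).
Proof.
rewrite /lval; elim: L => [|u L IH]; first by under eq_fun do rewrite big_nil; exact: measurable_cst.
under eq_fun do rewrite big_cons.
apply: measurable_funD => //; apply: measurable_funM.
  by apply: (measurableT_comp (co_measurable u)).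
by apply: (measurableT_comp (measurable_indic _)) => //; exact: measurable_itv.
Qed.

Lemma lint_cat s t L1 L2 w : lint B s t (L1 ++ L2) w = lint B s t L1 w + lint B s t L2 w.
Proof. by rewrite /lint big_cat. Qed.

Lemma lval_cat L1 L2 r w : lval (L1 ++ L2) r w = lval L1 r w + lval L2 r w.
Proof. by rewrite /lval big_cat. Qed.

Lemma co_opp_measurable (u : elem) : measurable_fun setT (fun w => - co u w).
Proof. by apply: measurable_funN; exact: co_measurable. Qed.

Lemma co_opp_bounded (u : elem) : exists M, forall w, `|- co u w| <= M.
Proof. by have [M h] := co_bounded u; exists M => w; rewrite normrN. Qed.

Lemma co_opp_wrt (u : elem) : lo u < hi u -> measurable_wrt (F (lo u)) (fun w => - co u w).
Proof.
move=> lh; apply: (measurable_wrt_comp (h := -%R)); first exact: oppr_measurable.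
exact: co_wrt.
Qed.

Definition elem_opp u : elem :=
  Elem (lo_ge0 u) (lo_le_hi u) (hi_leT u) (co_opp_measurable u) (co_opp_bounded u) (@co_opp_wrt u).

Lemma lint_opp s t L w : lint B s t (map elem_opp L) w = - lint B s t L w.
Proof. by rewrite /lint big_map -sumrN; apply: eq_bigr => u _; rewrite mulNr. Qed.

Lemma lval_opp L r w : lval (map elem_opp L) r w = - lval L r w.
Proof. by rewrite /lval big_map -sumrN; apply: eq_bigr => u _; rewrite mulNr. Qed.

(** For [x >= 0], [B (clamp 0 t x) - B (clamp 0 s x)] differs from [B (clamp s t x)] by [B s], which
    cancels between the two ends of each interval. *)
Lemma lintB s t L w : 0 <= s -> s <= t ->
  lint B 0 t L w - lint B 0 s L w = lint B s t L w.
Proof.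
move=> s0 st; rewrite /lint -sumrB; apply: eq_bigr => u _; rewrite -mulrBr; congr (_ * _).
have E x : 0 <= x -> B (clamp 0 t x) w - B (clamp 0 s x) w = B (clamp s t x) w - B s w.
  move=> x0; rewrite /clamp; have t0 := le_trans s0 st.
  rewrite !(@max_r _ _ 0) ?le_min ?t0 ?s0//.
  have [sx|/ltW xs] := leP s x; last first.
    rewrite (min_r (le_trans xs st)) max_l//; lra.
  by rewrite max_r// le_min st.
have := E _ (lo_ge0 u); have := E _ (le_trans (lo_ge0 u) (lo_le_hi u)); lra.
Qed.

(* [J] is the Ito integral process of [H]: both are approximated by a common
   elementary process, simultaneously at any two times. *)
Definition ito_class H J :=
  [/\ measurable_fun setT (fun z : R * Omega => H z.1 z.2),
      exists K, forall r w, `|H r w| <= K,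
      forall t, 0 <= t -> t <= T -> L2 P (J t) &
      forall s t e, 0 <= s -> s <= T -> 0 <= t -> t <= T -> 0 < e ->
      exists L, [/\
        Ex P (fun w => \int[mu]_(r in `]0, T]) ((lval L r w - H r w) ^+ 2)) <= e,
        Ex P (fun w => (lint B 0 s L w - J s w) ^+ 2) <= e &
        Ex P (fun w => (lint B 0 t L w - J t w) ^+ 2) <= e]].

Lemma lint0_L2 t L : 0 <= t -> t <= T -> L2 P (lint B 0 t L).
Proof. by move=> t0 tT; exact: (lint_L2 filF bmB (lexx 0) t0 tT). Qed.

Lemma ito_class_lint L : ito_class (lval L) (fun t => lint B 0 t L).
Proof.
split; [exact: lval_measurable|exact: lval_bounded|by move=> t *; exact: lint0_L2|].
move=> s t e _ _ _ _ e0; exists L; split.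
- rewrite (@eq_Ex _ _ _ _ _ (fun=> 0)) ?Ex_cst ?ltW// => w.
  under eq_Rintegral do rewrite subrr expr0n/=.
  by rewrite Rintegral_cst ?mul0r//; exact: measurable_itv.
- by rewrite (@eq_Ex _ _ _ _ _ (fun=> 0)) ?Ex_cst ?ltW// => w; rewrite subrr expr0n.
- by rewrite (@eq_Ex _ _ _ _ _ (fun=> 0)) ?Ex_cst ?ltW// => w; rewrite subrr expr0n.
Qed.

Lemma Ex_time_sqr_L1 H s t : s <= t ->
  measurable_fun setT (fun z : R * Omega => H z.1 z.2) ->
  (exists K, forall r w, `|H r w| <= K) ->
  [/\ measurable_fun setT (fun z : R * Omega => H z.1 z.2 ^+ 2),
      exists K, forall r w, `|H r w ^+ 2| <= K,
      L1 P (fun w => \int[mu]_(r in `]s, t]) (H r w ^+ 2)) &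
      forall w, mu.-integrable `]s, t] (EFin \o (fun r => H r w ^+ 2))].
Proof.
move=> st mH [K hK].
have m2 : measurable_fun setT (fun z : R * Omega => H z.1 z.2 ^+ 2) by exact: measurable_funX.
have K2 r w : `|H r w ^+ 2| <= K ^+ 2.
  rewrite normrX lerXn2r ?nnegrE//; exact: le_trans (hK r w).
split=> //; first by exists (K ^+ 2).
- exact: (@time_integral_L1 _ _ _ P (fun r w => H r w ^+ 2) _ m2 K2).
- exact: (@bounded_time_integrable _ _ _ (fun r w => H r w ^+ 2) _ m2 K2).
Qed.

Lemma Ex_time_sqrB_le H1 H2 s t : s <= t ->
  measurable_fun setT (fun z : R * Omega => H1 z.1 z.2) ->
  (exists K, forall r w, `|H1 r w| <= K) ->
  measurable_fun setT (fun z : R * Omega => H2 z.1 z.2) ->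
  (exists K, forall r w, `|H2 r w| <= K) ->
  forall w, \int[mu]_(r in `]s, t]) ((H1 r w - H2 r w) ^+ 2) <=
    2 * \int[mu]_(r in `]s, t]) (H1 r w ^+ 2) + 2 * \int[mu]_(r in `]s, t]) (H2 r w ^+ 2).
Proof.
move=> st m1 b1 m2 b2 w.
have mD : @measurable _ (measurableTypeR R) `]s, t]%classic by exact: measurable_itv.
have [_ _ _ i1] := Ex_time_sqr_L1 st m1 b1.
have [_ _ _ i2] := Ex_time_sqr_L1 st m2 b2.
have m12 : measurable_fun setT (fun z : R * Omega => H1 z.1 z.2 - H2 z.1 z.2).
  exact: measurable_funB.
have b12 : exists K, forall r w, `|H1 r w - H2 r w| <= K.
  have [K1 h1] := b1; have [K2 h2] := b2; exists (K1 + K2) => r w'.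
  by rewrite (le_trans (ler_normB _ _))// lerD.
have [_ _ _ i12] := Ex_time_sqr_L1 st m12 b12.
have j1 := integrableZl mD 2 (i1 w); have j2 := integrableZl mD 2 (i2 w).
rewrite -(RintegralZl _ mD (i1 w)) -(RintegralZl _ mD (i2 w)) -RintegralD//.
apply: le_Rintegral => //; first exact: (integrableD mD j1 j2).
by move=> r _; have := sqr_ge0 (H1 r w + H2 r w); nra.
Qed.

Lemma ito_classB H1 H2 J1 J2 : ito_class H1 J1 -> ito_class H2 J2 ->
  ito_class (fun r w => H1 r w - H2 r w) (fun t w => J1 t w - J2 t w).
Proof.
move=> [m1 b1 l1 a1] [m2 b2 l2 a2]; split.
- exact: measurable_funB.
- have [K1 h1] := b1; have [K2 h2] := b2; exists (K1 + K2) => r w.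
  by rewrite (le_trans (ler_normB _ _))// lerD.
- by move=> t t0 tT; apply: L2B; [exact: l1|exact: l2].
(* A quarter of the tolerance each, since [(u - v)^2 <= 2 u^2 + 2 v^2]. *)
move=> s t e s0 sT t0 tT e0; have e4 : 0 < e / 4 by rewrite divr_gt0.
have [K1 [A1 B1 C1]] := a1 s t _ s0 sT t0 tT e4.
have [K2 [A2 B2 C2]] := a2 s t _ s0 sT t0 tT e4.
have key q : 0 <= q -> q <= T ->
    Ex P (fun w => (lint B 0 q K1 w - J1 q w) ^+ 2) <= e / 4 ->
    Ex P (fun w => (lint B 0 q K2 w - J2 q w) ^+ 2) <= e / 4 ->
    Ex P (fun w => (lint B 0 q (K1 ++ map elem_opp K2) w - (J1 q w - J2 q w)) ^+ 2) <= e.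
  move=> q0 qT h1 h2.
  have L1q : L2 P (fun w => lint B 0 q K1 w - J1 q w) by apply: L2B; [exact: lint0_L2|exact: l1].
  have L2q : L2 P (fun w => lint B 0 q K2 w - J2 q w) by apply: L2B; [exact: lint0_L2|exact: l2].
  apply: (@le_trans _ _ (Ex P (fun w => 2 * (lint B 0 q K1 w - J1 q w) ^+ 2 +
                                     2 * (lint B 0 q K2 w - J2 q w) ^+ 2))).
    apply: Ex_le.
    - by apply: (L2B _ _).2; [exact: lint0_L2|apply: L2B; [exact: l1|exact: l2]].
    - by apply: L1D; apply: L1Z; [have [] := L1q|have [] := L2q].
    - move=> w; rewrite lint_cat lint_opp.
      have := sqr_ge0 ((lint B 0 q K1 w - J1 q w) + (lint B 0 q K2 w - J2 q w)); nra.
  rewrite ExD ?ExZ; [lra| | | |]; try (by case: L1q); try (by case: L2q).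
  - by apply: L1Z; case: L1q.
  - by apply: L1Z; case: L2q.
exists (K1 ++ map elem_opp K2); split; [|exact: key|exact: key].
have mE (L : seq elem) (H : R -> Omega -> R) :
  measurable_fun setT (fun z : R * Omega => H z.1 z.2) ->
  measurable_fun setT (fun z : R * Omega => lval L z.1 z.2 - H z.1 z.2).
  by move=> mH; apply: measurable_funB => //; exact: lval_measurable.
have bE (L : seq elem) (H : R -> Omega -> R) : (exists K, forall r w, `|H r w| <= K) ->
  exists K, forall r w, `|lval L r w - H r w| <= K.
  move=> [K h]; have [K' h'] := lval_bounded L; exists (K' + K) => r w.
  by rewrite (le_trans (ler_normB _ _))// lerD.
have [_ _ i1 _] := Ex_time_sqr_L1 T0 (mE K1 _ m1) (bE K1 _ b1).
have [_ _ i2 _] := Ex_time_sqr_L1 T0 (mE K2 _ m2) (bE K2 _ b2).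
apply: (@le_trans _ _ (Ex P (fun w =>
   2 * \int[mu]_(r in `]0, T]) ((lval K1 r w - H1 r w) ^+ 2) +
   2 * \int[mu]_(r in `]0, T]) ((lval K2 r w - H2 r w) ^+ 2)))); last first.
  rewrite ExD ?ExZ; [lra| | | |] => //; exact: L1Z.
have m12 : measurable_fun setT (fun z : R * Omega => H1 z.1 z.2 - H2 z.1 z.2).
  exact: measurable_funB.
have b12 : exists K, forall r w, `|H1 r w - H2 r w| <= K.
  have [M1 h1] := b1; have [M2 h2] := b2; exists (M1 + M2) => r w'.
  by rewrite (le_trans (ler_normB _ _))// lerD.
have [_ _ i12 _] := Ex_time_sqr_L1 T0 (mE (K1 ++ map elem_opp K2) _ m12)
  (bE (K1 ++ map elem_opp K2) _ b12).
apply: Ex_le => //; first by apply: L1D; exact: L1Z.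
move=> w; apply: le_trans (Ex_time_sqrB_le T0 (mE K1 _ m1) (bE K1 _ b1) (mE K2 _ m2) (bE K2 _ b2) w).
rewrite le_eqVlt; apply/orP; left; apply/eqP; apply: eq_Rintegral => r _.
by rewrite lval_cat lval_opp; ring.
Qed.

End ItoClass.

(** * Moments of the increments of stochastic integrals *)

Section ItoClassMoments.
Context {R : realType} {T : R} {d : measure_display} {Omega : measurableType d}.
Variables (P : probability Omega R) (F : R -> set (set Omega)).
Variable B : R -> Omega -> R.
Hypotheses (filF : filtration T F) (bmB : brownian_motion T P F B).
Hypothesis T0 : 0 <= T.
Notation mu := (@lebesgue_measure R).
Notation elem := (@elem R T d Omega F).
Notation ito_class := (@ito_class R T d Omega P F B).
Implicit Types (H J : R -> Omega -> R) (L : seq elem).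

Lemma lval_time_sqr_L1 L H : measurable_fun setT (fun z : R * Omega => H z.1 z.2) ->
  (exists K, forall r w, `|H r w| <= K) ->
  measurable_fun setT (fun z : R * Omega => lval L z.1 z.2 - H z.1 z.2) /\
  exists K, forall r w, `|lval L r w - H r w| <= K.
Proof.
move=> mH [K h]; split.
  by apply: measurable_funB => //; exact: lval_measurable.
have [K' h'] := lval_bounded L; exists (K' + K) => r w.
by rewrite (le_trans (ler_normB _ _))// lerD.
Qed.

Section TwoTimes.
Variables (H J : R -> Omega -> R) (s t : R).
Hypothesis HJ : ito_class H J.
Hypotheses (s0 : 0 <= s) (st : s <= t) (tT : t <= T).

Let t0 : 0 <= t. Proof. exact: le_trans st. Qed.
Let sT : s <= T. Proof. exact: le_trans tT. Qed.

Lemma ito_class_incr_L2 : L2 P (fun w => J t w - J s w).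
Proof. by case: HJ => _ _ JL _; apply: L2B; apply: JL. Qed.

(** Both endpoint errors come from the same [L], so they combine into the error of the increment at
    the cost of a factor 4. *)
Lemma ito_class_incr_approx e : 0 < e -> exists L : seq elem,
  Ex P (fun w => \int[mu]_(r in `]0, T]) ((lval L r w - H r w) ^+ 2)) <= e /\
  Ex P (fun w => (J t w - J s w - lint B s t L w) ^+ 2) <= 4 * e.
Proof.
move=> e0; have [_ _ JL /(_ s t e s0 sT t0 tT e0)[L [A1 A2 A3]]] := HJ.
exists L; split=> //.
have D2 q : 0 <= q -> q <= T -> L2 P (fun w => lint B 0 q L w - J q w).
  by move=> q0 qT; apply: L2B; [exact: (lint0_L2 filF bmB)|exact: JL].
have [_ Ds] := D2 s s0 sT; have [_ Dt] := D2 t t0 tT.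
apply: (@le_trans _ _ (Ex P (fun w => 2 * (lint B 0 s L w - J s w) ^+ 2 +
                                   2 * (lint B 0 t L w - J t w) ^+ 2))).
  apply: Ex_le.
  - by apply: (L2B ito_class_incr_L2 _).2; exact: (lint_L2 filF bmB).
  - by apply: L1D; exact: L1Z.
  - move=> w; rewrite -(lintB B L w s0 st).
    have := sqr_ge0 ((lint B 0 t L w - J t w) + (lint B 0 s L w - J s w)); nra.
by rewrite ExD ?ExZ//; [lra|exact: L1Z|exact: L1Z].
Qed.

Variables (xi : Omega -> R) (M : R).
Hypotheses (mxi : measurable_fun setT xi) (xiM : forall w, `|xi w| <= M).
Hypothesis Fxi : measurable_wrt (F s) xi.

Let M0 : 0 <= M. Proof. exact: le_trans (normr_ge0 _) (xiM point). Qed.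
Let xib : exists M, forall w, `|xi w| <= M. Proof. by exists M. Qed.

Lemma ito_class_incr_mean0 : Ex P (fun w => xi w * (J t w - J s w)) = 0.
Proof.
have DL := ito_class_incr_L2.
suff : `|Ex P (fun w => xi w * (J t w - J s w))| <= 0 by rewrite normr_le0 => /eqP.
(* Approximating within [e ^ 2] makes the mean square error [4 e ^ 2]; [Ex_norm_le_sqr] then gives
   an L1 error of [e + 4 e], multiplied by the bound [M] on [xi]. *)
apply: (@le_eps_mul _ _ _ (5 * M)) => e e0; rewrite add0r.
have [L [_ hL]] := ito_class_incr_approx (exprn_gt0 2 e0).
have LL : L2 P (lint B s t L) by exact: (lint_L2 filF bmB).
have EL : L2 P (fun w => J t w - J s w - lint B s t L w) by exact: L2B.
have -> : Ex P (fun w => xi w * (J t w - J s w)) =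
    Ex P (fun w => xi w * (J t w - J s w - lint B s t L w)).
  rewrite -[LHS]subr0 -(Ex_lint filF bmB s0 st tT mxi xib Fxi L) -ExB.
  - by apply: eq_Ex => w; ring.
  - by apply: (L1Mbounded mxi xiM); exact: L2_L1.
  - by apply: (L1Mbounded mxi xiM); exact: L2_L1.
apply: (le_trans (Ex_norm _)); first by apply: (L1Mbounded mxi xiM); exact: L2_L1.
apply: (@le_trans _ _ (Ex P (fun w => M * `|J t w - J s w - lint B s t L w|))).
  apply: Ex_le.
  - by apply: L1_norm; apply: (L1Mbounded mxi xiM); exact: L2_L1.
  - by apply/L1Z/L1_norm/L2_L1.
  - by move=> w; rewrite normrM ler_wpM2r.
rewrite ExZ; last exact/L1_norm/L2_L1.
rewrite [5 * M]mulrC -[leRHS]mulrA ler_wpM2l//.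
apply: le_trans (Ex_norm_le_sqr EL e0) _.
have : e^-1 * Ex P (fun w => (J t w - J s w - lint B s t L w) ^+ 2) <= e^-1 * (4 * e ^+ 2).
  by rewrite ler_wpM2l// invr_ge0 ltW.
have -> : e^-1 * (4 * e ^+ 2) = 4 * e by field; rewrite gt_eqF.
lra.
Qed.

(* The constant 4 (instead of 1 with equality) spares passing to the limit in L2. *)
Lemma ito_class_incr_sqr : (forall w, 0 <= xi w) ->
  Ex P (fun w => xi w * (J t w - J s w) ^+ 2) <=
  4 * Ex P (fun w => xi w * \int[mu]_(r in `]s, t]) (H r w ^+ 2)).
Proof.
move=> xi0; have DL := ito_class_incr_L2; have [mH bH _ _] := HJ.
(* Replacing the increment of [J] by the integral of [L] costs [2 M * 4 e], and replacing [lval L]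
   by [H] after the isometry costs [2 * 2 M e]. *)
apply: (@le_eps_mul _ _ _ (12 * M)) => e e0.
have [L [hI hL]] := ito_class_incr_approx e0.
have LL : L2 P (lint B s t L) by exact: (lint_L2 filF bmB).
have EL : L2 P (fun w => J t w - J s w - lint B s t L w) by exact: L2B.
have [iL1 isoL] := Ex_lint_sqr filF bmB s0 st tT mxi xib Fxi L.
apply: (@le_trans _ _ (Ex P (fun w => 2 * (xi w * lint B s t L w ^+ 2) +
   2 * M * (J t w - J s w - lint B s t L w) ^+ 2))).
  apply: Ex_le.
  - by apply: (L1Mbounded mxi xiM); case: DL.
  - by apply: L1D; apply: L1Z => //; case: EL.
  - move=> w; set a := lint B s t L w; set D := J t w - J s w.
    have xM : xi w <= M by exact: le_trans (ler_norm _) (xiM w).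
    have h : xi w * (D - a) ^+ 2 <= M * (D - a) ^+ 2 by rewrite ler_wpM2r// sqr_ge0.
    have h2 : xi w * D ^+ 2 <= xi w * (2 * a ^+ 2 + 2 * (D - a) ^+ 2).
      by rewrite ler_wpM2l//; have := sqr_ge0 (D - 2 * a); nra.
    lra.
rewrite ExD; [|exact: L1Z|by apply: L1Z; case: EL].
rewrite ExZ// ExZ; last by case: EL.
have [mE bE] := lval_time_sqr_L1 L mH bH.
have [_ _ ET _] := Ex_time_sqr_L1 P T0 mE bE.
have [_ _ Est iE] := Ex_time_sqr_L1 P st mE bE.
have [_ _ Hst iH] := Ex_time_sqr_L1 P st mH bH.
have [_ _ Vst iV] := Ex_time_sqr_L1 P st (lval_measurable L) (lval_bounded L).
have [_ _ _ iET] := Ex_time_sqr_L1 P T0 mE bE.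
have iso2 : Ex P (fun w => xi w * \int[mu]_(r in `]s, t]) (lval L r w ^+ 2)) <=
   2 * Ex P (fun w => xi w * \int[mu]_(r in `]s, t]) (H r w ^+ 2)) + 2 * M * e.
  apply: (@le_trans _ _ (Ex P (fun w => 2 * (xi w * \int[mu]_(r in `]s, t]) (H r w ^+ 2)) +
     2 * M * \int[mu]_(r in `]0, T]) ((lval L r w - H r w) ^+ 2)))); last first.
    rewrite ExD ?ExZ//; [|exact: (L1Mbounded mxi xiM)|by apply: L1Z;
      exact: (L1Mbounded mxi xiM)|exact: L1Z].
    by rewrite lerD2l ler_wpM2l// mulr_ge0.
  apply: Ex_le.
  - exact: (L1Mbounded mxi xiM).
  - by apply: L1D; apply: L1Z => //; exact: (L1Mbounded mxi xiM).
  - move=> w.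
    have mN : measurable_fun setT (fun z : R * Omega => - H z.1 z.2) by exact: measurable_funN.
    have bN : exists K, forall r w, `|- H r w| <= K.
      by have [K h] := bH; exists K => r w'; rewrite normrN.
    have h1 : \int[mu]_(r in `]s, t]) (lval L r w ^+ 2) <=
        2 * \int[mu]_(r in `]s, t]) ((lval L r w - H r w) ^+ 2) +
        2 * \int[mu]_(r in `]s, t]) (H r w ^+ 2).
      have := Ex_time_sqrB_le P st mE bE mN bN w.
      have -> : \int[mu]_(r in `]s, t]) ((lval L r w - H r w - - H r w) ^+ 2) =
          \int[mu]_(r in `]s, t]) (lval L r w ^+ 2).
        by apply: eq_Rintegral => r _; rewrite opprK subrK.
      have -> // : \int[mu]_(r in `]s, t]) ((- H r w) ^+ 2) = \int[mu]_(r in `]s, t]) (H r w ^+ 2).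
      by apply: eq_Rintegral => r _; rewrite sqrrN.
    have h2 : \int[mu]_(r in `]s, t]) ((lval L r w - H r w) ^+ 2) <=
        \int[mu]_(r in `]0, T]) ((lval L r w - H r w) ^+ 2).
      have i0t : mu.-integrable (`]0, t] : set R) (EFin \o (fun r => (lval L r w - H r w) ^+ 2)).
        exact: integrable_itv_sub (lexx 0) tT (iET w).
      rewrite (Rintegral_itv_cat t0 tT (iET w)) (Rintegral_itv_cat s0 st i0t).
      have p1 : 0 <= \int[mu]_(r in `]0, s]) ((lval L r w - H r w) ^+ 2).
        by apply: Rintegral_ge0 => r _; exact: sqr_ge0.
      have p2 : 0 <= \int[mu]_(r in `]t, T]) ((lval L r w - H r w) ^+ 2).
        by apply: Rintegral_ge0 => r _; exact: sqr_ge0.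
      by rewrite -[leLHS]add0r -[leLHS]addr0; apply: lerD => //; apply: lerD.
    have e2 : 0 <= \int[mu]_(r in `]s, t]) ((lval L r w - H r w) ^+ 2).
      by apply: Rintegral_ge0 => r _; exact: sqr_ge0.
    have xM : xi w <= M by exact: le_trans (ler_norm _) (xiM w).
    have h3 := ler_wpM2l (xi0 w) h1; have h4 := ler_pM (xi0 w) e2 xM h2.
    apply: (le_trans h3); rewrite mulrDr addrC; apply: lerD; first by rewrite mulrCA.
    by rewrite mulrCA -[leRHS]mulrA ler_wpM2l.
rewrite isoL.
have : 2 * M * Ex P (fun w => (J t w - J s w - lint B s t L w) ^+ 2) <= 2 * M * (4 * e).
  by rewrite ler_wpM2l// mulr_ge0.
lra.
Qed.

End TwoTimes.

(** Each term of the sum is a bounded coefficient times a Gaussian increment over a time at most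
    [t - s], whose third absolute moment is of order [(t - s)^(3/2)]. The constant depends on [L],
    which is fixed before the partition. *)
Lemma lint_cubic_min_le L : exists2 C : R, 0 <= C &
  forall s t, 0 <= s -> s <= t -> t <= T ->
    Ex P (fun w => cubic_min (lint B s t L w)) <= C * Num.sqrt (t - s) ^+ 3.
Proof.
have cL1 (X : Omega -> R) : L2 P X -> L1 P (fun w => cubic_min (X w)).
  move=> [mX X2]; apply: (L1_le _ _ X2).
    by apply: measurableT_comp => //; exact: measurable_cubic_min.
  by move=> w; rewrite ger0_norm ?cubic_min_ge0// cubic_min_le_sqr.
elim: L => [|u L [C C0 hC]].
  exists 0 => // s t s0 st tT; rewrite mul0r (@eq_Ex _ _ _ _ _ (fun=> 0)) ?Ex_cst// => w.
  by rewrite /lint big_nil /cubic_min normr0 !expr0n/= minxx.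
have [M hM] := co_bounded u; have M0 : 0 <= M by exact: le_trans (normr_ge0 _) (hM point).
exists (8 * (M ^+ 3 * 60) + 8 * C); first by rewrite addr_ge0// mulr_ge0// mulr_ge0// exprn_ge0.
move=> s t s0 st tT; have LL : L2 P (lint B s t L) by exact: (lint_L2 filF bmB).
have c0 : 0 <= clamp s t (lo u) by exact: le_trans (clamp_ge _ _ _).
have cc : clamp s t (lo u) <= clamp s t (hi u) by exact/clamp_mono/lo_le_hi.
have cT : clamp s t (hi u) <= T by exact: le_trans (clamp_le st _) tT.
have [X3 X3le] := brownian_increment_norm3_le_le filF bmB c0 cc cT.
have XL := brownian_increment_L2_le filF bmB c0 cc cT.
pose X w := co u w * (B (clamp s t (hi u)) w - B (clamp s t (lo u)) w).
have XL2 : L2 P X by exact: (L2Mbounded (co_measurable u) hM).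
apply: (@le_trans _ _ (Ex P (fun w => 8 * M ^+ 3 *
   `|B (clamp s t (hi u)) w - B (clamp s t (lo u)) w| ^+ 3 + 8 * cubic_min (lint B s t L w)))).
  apply: Ex_le.
  - apply: cL1; have := L2D XL2 LL; congr L2; apply/funext => w.
    by rewrite /lint big_cons.
  - by apply: L1D; apply: L1Z => //; exact: cL1.
  - move=> w; rewrite /lint big_cons -/(lint B s t L w).
    apply: le_trans (cubic_minD _ _) _; rewrite lerD2r -mulrA ler_wpM2l//.
    apply: le_trans (cubic_min_le_cube _) _; rewrite normrM exprMn ler_wpM2r ?exprn_ge0//.
    by rewrite lerXn2r ?nnegrE.
rewrite ExD ?ExZ//; [|exact: cL1|exact: L1Z|by apply: L1Z; exact: cL1].
rewrite [leRHS]mulrDl; apply: lerD; last by rewrite -[leRHS]mulrA ler_wpM2l// hC.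
rewrite [8 * (_ * 60)]mulrA -[leRHS]mulrA ler_wpM2l ?mulr_ge0 ?exprn_ge0//.
apply: (le_trans X3le); rewrite ler_wpM2l// lerXn2r ?nnegrE ?sqrtr_ge0//.
apply: ler_wsqrtr.
by have := clamp_le st (hi u); have := clamp_ge s t (lo u); lra.
Qed.

(* Lindeberg: split [J] into the elementary integral of [L], whose increments
   over time [h] have third moments [O(h^(3/2))], and a remainder that is small
   in L2 uniformly in the partition. *)
Lemma ito_class_cubic_min H J t e : ito_class H J -> 0 <= t -> t <= T -> 0 < e ->
  exists N, forall n, (N <= n)%N ->
    \sum_(i < n.+1) Ex P (fun w => cubic_min (J (i.+1%:R * (t / n.+1%:R))
      w - J (i%:R * (t / n.+1%:R)) w)) <= e.
Proof.
have aux1 (x y : R) : 0 < e -> 2 * x / e <= y -> x <= e / 2 * y.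
  by move=> e0; rewrite ler_pdivrMr//; lra.
have aux2 (x y : R) : 0 < e -> x <= e / 32 -> y <= e / 2 -> y + 16 * x <= e by lra.
move=> HJ t0 tT e0; have [mH bH JL _] := HJ.
(* The L2 remainder enters with the factor [16 = 4 * 4], from [cubic_minD_sqr] and
   [ito_class_incr_sqr], and receives half of [e]. *)
have e32 : 0 < e / 32 by rewrite divr_gt0.
have [L [hI _]] := ito_class_incr_approx HJ (lexx 0) (lexx 0) T0 e32.
have [C C0 hC] := lint_cubic_min_le L.
have HJL := ito_classB filF bmB T0 HJ (ito_class_lint filF bmB L).
have [mE bE] := lval_time_sqr_L1 L mH bH.
pose G r w := (lval L r w - H r w) ^+ 2.
have [mG [K hK] GL _] := Ex_time_sqr_L1 P T0 mE bE.
pose g r := Ex P (G r).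
have mg : measurable_fun setT g by exact: measurable_Ex_time mG hK.
have gK r : `|g r| <= K by exact: norm_Ex_time_le mG hK r.
have gi a b : a <= b -> mu.-integrable (`]a, b] : set R) (EFin \o g).
  move=> ab; have := @bounded_time_integrable _ _ Omega (fun r _ => g r) K.
  apply=> //; last exact: point.
  by apply: (measurableT_comp mg).
have g0 r : 0 <= g r by apply: Ex_ge0 => w; exact: sqr_ge0.
pose a := 8 * C * Num.sqrt t ^+ 3.
have a0 : 0 <= a by rewrite !mulr_ge0// ?exprn_ge0// sqrtr_ge0.
(* Summing [n.+1] terms of order [(t / n.+1)^(3/2)] gives [a / sqrt n.+1], which this choice brings
   below [e / 2]. *)
exists (Num.truncn ((2 * a / e) ^+ 2)) => n Nn.
set h := t / n.+1%:R.
have h0 : 0 <= h by rewrite divr_ge0.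
have hn : n.+1%:R * h = t by rewrite mulrC divfK.
have cell (i : 'I_n.+1) : Ex P (fun w => cubic_min (J (i.+1%:R * h) w - J (i%:R * h) w)) <=
    8 * C * Num.sqrt h ^+ 3 + 16 * \int[mu]_(r in `](i%:R * h), (i.+1%:R * h)]) g r.
  have i0 : 0 <= i%:R * h by rewrite mulr_ge0.
  have ii : i%:R * h <= i.+1%:R * h by rewrite ler_wpM2r// ler_nat.
  have iT : i.+1%:R * h <= T by rewrite (le_trans _ tT)// -hn ler_wpM2r// ler_nat.
  pose X := lint B (i%:R * h) (i.+1%:R * h) L.
  pose Y w := J (i.+1%:R * h) w - J (i%:R * h) w - X w.
  have XL : L2 P X by exact: (lint_L2 filF bmB).
  have DL := ito_class_incr_L2 HJ i0 ii iT.
  have YL : L2 P Y by exact: L2B.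
  have cL1 (Z : Omega -> R) : L2 P Z -> L1 P (fun w => cubic_min (Z w)).
    move=> [mZ Z2]; apply: (L1_le _ _ Z2).
      by apply: measurableT_comp => //; exact: measurable_cubic_min.
    by move=> w; rewrite ger0_norm ?cubic_min_ge0// cubic_min_le_sqr.
  apply: (@le_trans _ _ (Ex P (fun w => 8 * cubic_min (X w) + 4 * Y w ^+ 2))).
    apply: Ex_le; [exact: cL1|by apply: L1D; apply: L1Z; [exact: cL1|case: YL]|].
    move=> w; have := cubic_minD_sqr (X w) (Y w); rewrite /Y addrC subrK; exact.
  rewrite ExD ?ExZ; [|by case: YL|exact: cL1|by apply: L1Z; exact: cL1|by apply: L1Z; case: YL].
  apply: lerD.
    rewrite -mulrA ler_wpM2l//; apply: (le_trans (hC _ _ i0 ii iT)).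
    by rewrite -mulrBl -natrB// subSnn mul1r.
  have m1 : measurable_fun setT (fun _ : Omega => 1 : R) by [].
  have b1 w : `|(fun _ : Omega => 1 : R) w| <= 1 by rewrite normr1.
  have F1 : measurable_wrt (F (i%:R * h)) (fun _ : Omega => 1 : R).
    by apply: measurable_wrt_cst; apply: (filtration_sigma_algebra filF) => //; exact: le_trans iT.
  have := ito_class_incr_sqr HJL i0 ii iT m1 b1 F1 (fun _ => ler01).
  have -> : Ex P (fun w => 1 * (J (i.+1%:R * h) w - lint B 0 (i.+1%:R * h) L w -
      (J (i%:R * h) w - lint B 0 (i%:R * h) L w)) ^+ 2) = Ex P (fun w => Y w ^+ 2).
    apply: eq_Ex => w; rewrite mul1r; congr (_ ^+ 2).
    by rewrite /Y /X -(lintB B L w i0 ii); ring.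
  have -> : Ex P (fun w => 1 * \int[mu]_(r in `](i%:R * h), (i.+1%:R * h)]) ((H r w - lval L r w)
    ^+ 2)) =
      \int[mu]_(r in `](i%:R * h), (i.+1%:R * h)]) g r.
    rewrite -(Ex_time_integral P mG hK ii); apply: eq_Ex => w; rewrite mul1r.
    by apply: eq_Rintegral => r _; ring.
  by move=> hY; apply: le_trans (ler_wpM2l _ hY) _; rewrite // mulrA -natrM.
apply: (le_trans (ler_sum _ (fun i _ => cell i))).
rewrite big_split/= sumr_const card_ord -mulr_sumr Rintegral_grid//; last first.
  by rewrite hn; exact: gi.
rewrite hn.
have gt : \int[mu]_(r in `]0, t]) g r <= e / 32.
  apply: le_trans hI; rewrite (Ex_time_integral P mG hK T0).
  rewrite (Rintegral_itv_cat t0 tT (gi _ _ T0)) lerDl.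
  by apply: Rintegral_ge0 => r _.
have sh : Num.sqrt h ^+ 3 *+ n.+1 = Num.sqrt t ^+ 3 / Num.sqrt n.+1%:R.
  have sn : Num.sqrt (n.+1%:R : R) != 0 by rewrite gt_eqF// sqrtr_gt0.
  have -> : Num.sqrt h = Num.sqrt t / Num.sqrt n.+1%:R by rewrite /h sqrtrM// sqrtrV.
  rewrite -mulr_natr -[X in _ * X](@sqr_sqrtr _ (n.+1%:R : R))//.
  by field.
have : 8 * C * Num.sqrt h ^+ 3 *+ n.+1 <= e / 2.
  rewrite -mulrnAr sh mulrA -/a ler_pdivrMr ?sqrtr_gt0//.
  have : 2 * a / e <= Num.sqrt n.+1%:R.
    rewrite -[leLHS](@ger0_norm _ (2 * a / e)) ?divr_ge0 ?mulr_ge0 ?(ltW e0)//.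
    rewrite -sqrtr_sqr; apply: ler_wsqrtr; apply/ltW.
    by apply: (lt_le_trans (truncnS_gt _)); rewrite ler_nat.
  exact: aux1.
by move=> he; exact: aux2.
Qed.

End ItoClassMoments.

(** * Smooth approximations of the absolute value *)

Section SmoothAbs.
Context {R : realType}.
Variable a : R.
Hypothesis a0 : 0 < a.
Implicit Types x y : R.

Definition smooth_abs y := Num.sqrt (y ^+ 2 + a ^+ 2).

Lemma smooth_abs_sqr y : smooth_abs y ^+ 2 = y ^+ 2 + a ^+ 2.
Proof. by rewrite sqr_sqrtr// addr_ge0 ?sqr_ge0. Qed.

Lemma smooth_abs_ge0 y : 0 <= smooth_abs y. Proof. exact: sqrtr_ge0. Qed.

Lemma ler_sqr_nneg x y : 0 <= y -> x ^+ 2 <= y ^+ 2 -> x <= y.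
Proof.
move=> y0 xy; have [x0|/ltW x0] := leP 0 x; last exact: le_trans y0.
by move: xy; rewrite ler_sqr ?nnegrE.
Qed.

Lemma smooth_abs_gea y : a <= smooth_abs y.
Proof. by apply: ler_sqr_nneg; [exact: smooth_abs_ge0|rewrite smooth_abs_sqr lerDr sqr_ge0]. Qed.

Lemma smooth_abs_gt0 y : 0 < smooth_abs y.
Proof. exact: lt_le_trans (smooth_abs_gea y). Qed.

Lemma smooth_abs_ge_norm y : `|y| <= smooth_abs y.
Proof.
apply: ler_sqr_nneg; first exact: smooth_abs_ge0.
by rewrite smooth_abs_sqr real_normK ?num_real// lerDl sqr_ge0.
Qed.

Lemma smooth_abs_le y : smooth_abs y <= `|y| + a.
Proof.
apply: ler_sqr_nneg; first by rewrite addr_ge0// ltW.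
rewrite smooth_abs_sqr sqrrD real_normK ?num_real//.
by have := mulr_ge0 (normr_ge0 y) (ltW a0); lra.
Qed.

(** AM-GM: with [s = smooth_abs y >= a], the right-hand side with last denominator [2 s] equals
    [(s^2 + smooth_abs (y + x)^2) / (2 s)]. *)
Let lin y x : smooth_abs (y + x) <= smooth_abs y + y / smooth_abs y * x + x ^+ 2 / (2 * a).
Proof.
set s := smooth_abs y; have s0 : 0 < s by exact: smooth_abs_gt0.
have as_ : a <= s by exact: smooth_abs_gea.
apply: (@le_trans _ _ (s + y / s * x + x ^+ 2 / (2 * s))); last first.
  rewrite lerD2l ler_wpM2l ?sqr_ge0// lef_pV2 ?posrE ?mulr_gt0//.
  by rewrite ler_pM2l.
have sn : s != 0 by rewrite gt_eqF.
have E : s + y / s * x + x ^+ 2 / (2 * s) = (s ^+ 2 + smooth_abs (y + x) ^+ 2) / (2 * s).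
  rewrite smooth_abs_sqr (_ : a ^+ 2 = s ^+ 2 - y ^+ 2); last by rewrite smooth_abs_sqr; ring.
  by field.
rewrite E ler_pdivlMr ?mulr_gt0//.
have := sqr_ge0 (s - smooth_abs (y + x)); nra.
Qed.

(** The coefficient of [x^2] is half the second derivative. For [|x| > s] the quadratic bound
    suffices, as then [x^2 / (2 a) <= |x|^3 / a^2]. Otherwise the Taylor polynomial [p] is
    nonnegative and [f^2 - p^2 <= |x|^3 / a]; dividing by [f + p >= a] gives the second factor
    [1 / a]. *)
Let cub y x : smooth_abs (y + x) <= smooth_abs y + y / smooth_abs y * x
  + a ^+ 2 / (2 * smooth_abs y ^+ 3) * x ^+ 2 + `|x| ^+ 3 / a ^+ 2.
Proof.
set s := smooth_abs y; have s0 : 0 < s by exact: smooth_abs_gt0.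
have as_ : a <= s by exact: smooth_abs_gea.
have ys : `|y| <= s by exact: smooth_abs_ge_norm.
have sn : s != 0 by rewrite gt_eqF.
have an : a != 0 by rewrite gt_eqF.
have s2 : s ^+ 2 = y ^+ 2 + a ^+ 2 by exact: smooth_abs_sqr.
have K0 : 0 <= a ^+ 2 / (2 * s ^+ 3) * x ^+ 2.
  by rewrite mulr_ge0 ?sqr_ge0// divr_ge0 ?sqr_ge0// mulr_ge0// exprn_ge0// ltW.
have [xs|sx] := leP `|x| s; last first.
  apply: (le_trans (lin y x)); rewrite -/s -[leRHS]addrA lerD2l -[leLHS]add0r.
  apply: lerD => //; rewrite -(real_normK (num_real x)).
  rewrite ler_pdivrMr ?mulr_gt0// mulrAC ler_pdivlMr ?exprn_gt0//.
  have ax : a <= `|x| by exact: le_trans (ltW sx).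
  have -> : `|x| ^+ 3 * (2 * a) = `|x| ^+ 2 * (`|x| * (2 * a)) by ring.
  by rewrite ler_wpM2l ?sqr_ge0//; have := ler_wpM2l (ltW a0) ax; have := sqr_ge0 a; nra.
set p := s + y / s * x + a ^+ 2 / (2 * s ^+ 3) * x ^+ 2.
have ysx : `|y / s * x| <= `|x|.
  by rewrite !normrM normfV (gtr0_norm s0) ler_piMl// ler_pdivrMr// mul1r.
have p0 : 0 <= p.
  rewrite /p addr_ge0//; move: ysx; rewrite ler_norml => /andP[h _]; lra.
set f := smooth_abs (y + x); have fa : a <= f by exact: smooth_abs_gea.
have f2 : f ^+ 2 <= p ^+ 2 + `|x| ^+ 3 / a.
  have -> : f ^+ 2 = p ^+ 2 - y / s * (a ^+ 2 / s ^+ 2) * (x ^+ 3 / s) - (a ^+ 2 / (2 * s ^+ 3)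
    * x ^+ 2) ^+ 2.
    rewrite /f smooth_abs_sqr /p.
    have -> : a ^+ 2 = s ^+ 2 - y ^+ 2 by rewrite s2 addrAC subrr add0r.
    by field.
  have h1 : `|y / s * (a ^+ 2 / s ^+ 2) * (x ^+ 3 / s)| <= `|x| ^+ 3 / a.
    have ->: `|x| ^+ 3 / a = 1 * 1 * (`|x| ^+ 3 / a) by rewrite !mul1r.
    rewrite !(normrX, normfV, normrM) (gtr0_norm s0) (gtr0_norm a0).
    apply: ler_pM => //.
    - by rewrite mulr_ge0 ?divr_ge0 ?exprn_ge0 ?(ltW s0) ?(ltW a0).
    - by rewrite divr_ge0 ?exprn_ge0 ?(ltW s0).
    - apply: ler_pM; rewrite ?divr_ge0 ?exprn_ge0 ?(ltW s0) ?(ltW a0)//.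
        by rewrite ler_pdivrMr// mul1r.
      by rewrite ler_pdivrMr ?exprn_gt0// mul1r lerXn2r ?nnegrE ?(ltW s0) ?(ltW a0).
    - by rewrite ler_wpM2l ?exprn_ge0// lef_pV2 ?posrE.
  move: h1; rewrite ler_norml => /andP[h1 _].
  have := sqr_ge0 (a ^+ 2 / (2 * s ^+ 3) * x ^+ 2); lra.
rewrite -lerBlDl ler_pdivlMr ?exprn_gt0//.
have x3 : 0 <= `|x| ^+ 3 by rewrite exprn_ge0.
have [fp|pf] := leP f p.
  by apply: (@le_trans _ _ 0) => //; rewrite mulr_le0_ge0 ?sqr_ge0// subr_le0.
have f3 : (f - p) * a * a <= `|x| ^+ 3.
  rewrite -ler_pdivlMr//; apply: le_trans (_ : (f - p) * (f + p) <= _).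
    by rewrite ler_wpM2l ?subr_ge0 ?(ltW pf)//; lra.
  by rewrite -subr_sqr lerBlDl.
by rewrite expr2 mulrA.
Qed.

Lemma smooth_abs_taylor y x : smooth_abs (y + x) <= smooth_abs y + y / smooth_abs y * x
  + a ^+ 2 / (2 * smooth_abs y ^+ 3) * x ^+ 2 + ((a ^+ 2)^-1 + (2 * a)^-1) * cubic_min x.
Proof.
have s0 := smooth_abs_gt0 y.
have K0 : 0 <= a ^+ 2 / (2 * smooth_abs y ^+ 3) * x ^+ 2.
  by rewrite mulr_ge0 ?sqr_ge0// divr_ge0 ?sqr_ge0// mulr_ge0// exprn_ge0// ltW.
have i1 : 0 <= (a ^+ 2)^-1 by rewrite invr_ge0 sqr_ge0.
have i2 : 0 <= (2 * a)^-1 by rewrite invr_ge0 mulr_ge0// ltW.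
rewrite /cubic_min; have [_|_] := leP (`|x| ^+ 3) (x ^+ 2).
  apply: (le_trans (cub y x)); rewrite lerD2l mulrC ler_wpM2r ?exprn_ge0//.
  by rewrite lerDl.
apply: (le_trans (lin y x)); rewrite -[leRHS]addrA lerD2l mulrC.
by rewrite -[leLHS]add0r lerD// ler_wpM2r ?sqr_ge0// lerDr.
Qed.

Lemma measurable_smooth_abs : measurable_fun setT smooth_abs.
Proof.
apply: continuous_measurable_fun => y.
apply: (continuous_comp (f := fun y : R => y ^+ 2 + a ^+ 2)); last exact: sqrt_continuous.
by apply: cvgD; [exact: exprn_continuous|exact: cvg_cst].
Qed.

End SmoothAbs.

(* The left-hand side is [|y| f''(y)] for [f = smooth_abs a]; the right-hand
   side telescopes along [a, a/2, a/4, ...]. *)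
Lemma smooth_abs_curvature (R : realType) (a y : R) : 0 < a ->
  a ^+ 2 / (2 * smooth_abs a y ^+ 3) * `|y| <=
  4 / 3 * (`|y| / smooth_abs (a / 2) y - `|y| / smooth_abs a y).
Proof.
move=> a0; have a20 : 0 < a / 2 by rewrite divr_gt0.
have s0 := smooth_abs_gt0 a0 y; have u0 := smooth_abs_gt0 a20 y.
have s2 := smooth_abs_sqr a y; have u2 := smooth_abs_sqr (a / 2) y.
set s := smooth_abs a y in s0 s2 *; set u := smooth_abs (a / 2) y in u0 u2 *.
have us : u <= s.
  by apply: ler_sqr_nneg; [exact: ltW|rewrite s2 u2 lerD2l; have := sqr_ge0 a; nra].
have sn : s != 0 by rewrite gt_eqF.
have un : u != 0 by rewrite gt_eqF.
have sun : s + u != 0 by rewrite gt_eqF// addr_gt0.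
rewrite [leRHS](_ : _ = 4 / 3 * (u^-1 - s^-1) * `|y|); last by ring.
rewrite ler_wpM2r//.
(* Halving [a] gives [s^2 - u^2 = 3 a^2 / 4], whence 4/3; afterwards [u <= s] compares [u s (s + u)]
   with [2 s^3]. *)
have -> : 4 / 3 * (u^-1 - s^-1) = a ^+ 2 / (u * s * (s + u)).
  have -> : a ^+ 2 = 4 / 3 * (s ^+ 2 - u ^+ 2) by rewrite s2 u2; field.
  by field; rewrite ?sun ?sn ?un.
rewrite ler_wpM2l ?sqr_ge0// lef_pV2 ?posrE ?mulr_gt0 ?exprn_gt0 ?addr_gt0//.
rewrite (_ : 2 * s ^+ 3 = s * s * (s + s)); last by ring.
by apply: ler_pM; rewrite ?mulr_ge0 ?addr_ge0 ?(ltW s0) ?(ltW u0)// ?ler_wpM2r ?(ltW s0)// lerD2l.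
Qed.

(** Here [psi] is [f'] and [K] is half of [f'']. The curvature bounds of [n] consecutive scales
    telescope to at most 4/3 in total, so their average is at most [4 / (3 n)], below [delta] for
    large [n]. *)
Lemma yamada_watanabe_functions (R : realType) (delta eps : R) : 0 < delta -> 0 < eps ->
  exists (f psi K : R -> R) (k0 k1 : R),
    [/\ [/\ measurable_fun setT f, measurable_fun setT psi & measurable_fun setT K],
        [/\ forall y, `|psi y| <= 1, forall y, 0 <= K y <= k0 &
            forall y, K y * `|y| <= delta],
        forall y, `|y| <= f y <= `|y| + eps,
        0 <= k1 &
        forall y x, f (y + x) <= f y + psi y * x + K y * x ^+ 2 + k1 * cubic_min x].
Proof.
move=> d0 e0; pose n := (Num.truncn (4 / 3 / delta)).+1.
have n0 : 0 < n%:R :> R by rewrite ltr0n.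
have n1 : n%:R != 0 :> R by rewrite gt_eqF.
pose a (k : nat) : R := eps / 2 ^+ k.
have ak0 k : 0 < a k by rewrite divr_gt0// exprn_gt0.
have ake k : a k <= eps by rewrite ler_pdivrMr ?exprn_gt0// ler_peMr ?(ltW e0)// exprn_ege1// ler1n.
have aS k : a k.+1 = a k / 2 by rewrite /a exprSr invfM mulrA.
pose avg (h : R -> R -> R) y := n%:R^-1 * \sum_(k < n) h (a k) y.
have avg_measurable h : (forall k, measurable_fun setT (h (a k))) -> measurable_fun setT (avg h).
  move=> mh; apply: measurable_funM => //.
  by apply: measurable_sum => k; exact: mh.
have avg_le (h1 h2 : R -> R -> R) y : (forall k, h1 (a k) y <= h2 (a k) y) -> avg h1 y <= avg h2 y.
  by move=> h; rewrite /avg ler_wpM2l ?invr_ge0 ?(ltW n0)//; exact: ler_sum.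
have avg_cst c y : avg (fun _ _ => c) y = c.
  by rewrite /avg sumr_const card_ord -(mulr_natl c n) mulrA mulVf// mul1r.
pose psi0 (a : R) y := y / smooth_abs a y.
pose K0 (a : R) y := a ^+ 2 / (2 * smooth_abs a y ^+ 3).
pose c0 (a : R) (y : R) := (a ^+ 2)^-1 + (2 * a)^-1.
have s0 k y := smooth_abs_gt0 (ak0 k) y.
have psi1 k y : `|psi0 (a k) y| <= 1.
  rewrite /psi0 normrM normfV (gtr0_norm (s0 k y)) ler_pdivrMr// mul1r.
  exact: smooth_abs_ge_norm.
have K00 k y : 0 <= K0 (a k) y.
  by rewrite divr_ge0 ?sqr_ge0// mulr_ge0// exprn_ge0// smooth_abs_ge0.
have mV k : measurable_fun setT (fun y => (smooth_abs (a k) y)^-1).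
  apply: continuous_measurable_fun => y; apply: cvgV; first by rewrite gt_eqF.
  apply: (continuous_comp (f := fun y : R => y ^+ 2 + a k ^+ 2)); last exact: sqrt_continuous.
  by apply: cvgD; [exact: exprn_continuous|exact: cvg_cst].
(* The constants are averages of functions that ignore [y], so that [avg_le] proves their bounds
   too; [1 / (2 a)] dominates [a^2 / (2 s^3)] because [s >= a]. *)
exists (avg smooth_abs), (avg psi0), (avg K0), (avg (fun a _ => (2 * a)^-1) 0), (avg c0 0).
split.
- split; apply: avg_measurable => k.
  + exact: measurable_smooth_abs.
  + by apply: measurable_funM => //; exact: mV.
  + have -> : K0 (a k) = (fun y => (a k ^+ 2 / 2) * (smooth_abs (a k) y)^-1 ^+ 3).
      by apply/funext => y; rewrite /K0 invfM exprVn mulrA.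
    by apply: measurable_funM => //; apply: measurable_funX; exact: mV.
- split=> y.
  + rewrite ler_norml -(avg_cst (-1) y) -[X in _ && (_ <= X)](avg_cst 1 y).
    by apply/andP; split; apply: avg_le => k; have := psi1 k y; rewrite ler_norml => /andP[].
  + apply/andP; split; first by rewrite -(avg_cst 0 y); exact: avg_le.
    rewrite (_ : avg (fun a _ => (2 * a)^-1) 0 = avg (fun a _ => (2 * a)^-1) y)//.
    apply: avg_le => k; rewrite /K0 invfM mulrA [leRHS]invfM.
    have ga := smooth_abs_gea (a k) y.
    rewrite mulrAC mulrC ler_wpM2l ?invr_ge0// ler_pdivrMr ?exprn_gt0//.
    rewrite mulrC ler_pdivlMr// -exprSr.
    by rewrite lerXn2r ?nnegrE ?smooth_abs_ge0// ltW.
  + rewrite /avg -mulrA mulr_suml mulrC ler_pdivrMr//.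
    apply: (@le_trans _ _ (\sum_(k < n) (4 / 3 * (`|y| / smooth_abs (a k.+1)
      y - `|y| / smooth_abs (a k) y)))).
      by apply: ler_sum => k _; rewrite /K0 aS; exact: smooth_abs_curvature.
    rewrite -mulr_sumr.
    rewrite -(big_mkord xpredT (fun k => `|y| / smooth_abs (a k.+1) y - `|y| / smooth_abs (a k) y)).
    rewrite telescope_sumr//.
    have q1 : `|y| / smooth_abs (a n) y <= 1.
      by rewrite ler_pdivrMr ?s0// mul1r; exact: smooth_abs_ge_norm.
    have q2 : 0 <= `|y| / smooth_abs (a 0%N) y by rewrite divr_ge0// smooth_abs_ge0.
    have : 4 / 3 / delta <= n%:R by apply/ltW; exact: truncnS_gt.
    by rewrite ler_pdivrMr//; lra.
- move=> y; apply/andP; split.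
    by rewrite -[leLHS](avg_cst _ y); apply: avg_le => k; exact: smooth_abs_ge_norm.
  rewrite -[leRHS](avg_cst _ y); apply: avg_le => k.
  by apply: (le_trans (smooth_abs_le (ak0 k) y)); rewrite lerD2l.
- rewrite -[leLHS](avg_cst 0 0); apply: avg_le => k.
  by rewrite addr_ge0// invr_ge0 ?sqr_ge0// mulr_ge0// ltW.
- move=> y x.
  have -> : avg smooth_abs y + avg psi0 y * x + avg K0 y * x ^+ 2 + avg c0 0 * cubic_min x =
    avg (fun a _ => smooth_abs a y + psi0 a y * x + K0 a y * x ^+ 2 + c0 a 0 * cubic_min x) (y + x).
    by rewrite /avg !big_split/= -!mulr_suml /c0 !big_split/=; ring.
  by apply: avg_le => k; exact: smooth_abs_taylor.
Qed.

(** * Osgood's lemma *)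

Section Osgood.
Context {R : realType}.
Notation mu := (@lebesgue_measure R).

Let muD (s t : R) : s <= t -> mu `]s, t]%classic = (t - s)%:E.
Proof.
move=> st; rewrite lebesgue_measure_itv/= lte_fin; case: ltP => //= ts.
by rewrite (@le_anti _ _ t s) ?subrr// ts st.
Qed.

Let muDy (s t : R) : s <= t -> (mu `]s, t]%classic < +oo)%E.
Proof. by move=> st; rewrite muD// ltry. Qed.

Lemma bounded_itv_integrable (h : R -> R) (K s t : R) : s <= t ->
  measurable_fun setT h -> (forall r, `|h r| <= K) ->
  mu.-integrable (`]s, t] : set R) (EFin \o h).
Proof.
move=> st mh hK; apply: measurable_bounded_integrable => //.
- exact: muDy.
- by apply: measurable_funTS; exact: mh.
- exists K; split; first by rewrite num_real.
  by move=> x Kx r _ /=; exact: (le_trans (hK _) (ltW Kx)).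
Qed.

Lemma Rintegral_itv_le_cst (h : R -> R) (K s t : R) : s <= t ->
  mu.-integrable (`]s, t] : set R) (EFin \o h) ->
  (forall r, s < r -> r <= t -> h r <= K) ->
  \int[mu]_(r in `]s, t]) h r <= K * (t - s).
Proof.
move=> st ih hK.
have mD : @measurable _ (measurableTypeR R) `]s, t]%classic by exact: measurable_itv.
apply: (@le_trans _ _ (\int[mu]_(r in `]s, t]) K)).
  apply: le_Rintegral => //; first by apply: (@bounded_itv_integrable (fun=> K) `|K|).
  by move=> r /=; rewrite in_itv/= => /andP[sr rt]; exact: hK.
by rewrite Rintegral_cst// (_ : fine _ = t - s)//; exact: (congr1 fine (muD st)).
Qed.

(* Let [G t] be the integral of [theta o g] over [[0, t]], so that [G' <= theta G].
   Between the times at which [G] takes the values [z] and [2 z] at least the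
   time [z / theta (2 z)] elapses; these times add up, over dyadic levels, to a
   multiple of the diverging integral of [1 / kappa]. *)
Lemma osgood (T M D : R) (kappa theta g : R -> R) : 0 <= T -> 0 <= D ->
  (forall u v, 0 <= u -> u <= v -> kappa u <= kappa v) ->
  (forall u, 0 < u -> 0 < kappa u) ->
  (forall u, 0 < u -> u <= 1 -> theta u <= D * kappa u) ->
  (forall u v, 0 <= u -> u <= v -> theta u <= theta v) ->
  (forall u, 0 < u -> 0 < theta u) ->
  (forall u, 0 <= u -> theta (2 * u) <= 2 * theta u) ->
  diverges_at_0 (fun u => (kappa u)^-1) ->
  measurable_fun setT g -> (forall r, 0 <= g r <= M) ->
  (forall t, 0 <= t -> t <= T -> g t <= \int[mu]_(r in `]0, t]) theta (g r)) ->
  forall t, 0 <= t -> t <= T -> g t = 0.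
Proof.
move=> T0 D0 kappa_nd kappa_gt0 theta_kappa theta_nd theta_gt0 theta2 kappa_div mg gM gG t1 t10 t1T.
have g0 r : 0 <= g r by have /andP[] := gM r.
have M0 : 0 <= M by have /andP[] := gM 0; exact: le_trans.
(* Doubling at 0 reads [theta 0 <= 2 * theta 0]. *)
have theta00 : 0 <= theta 0.
  by have := theta2 0 (lexx 0); rewrite mulr0; lra.
have theta_ge0 u : 0 <= u -> 0 <= theta u by move=> u0; exact: le_trans (theta_nd _ _ (lexx 0) u0).
pose h r := theta (g r).
have h0 r : 0 <= h r by exact: theta_ge0.
have hK r : `|h r| <= theta M.
  by rewrite ger0_norm//; apply: theta_nd => //; have /andP[] := gM r.
have mh : measurable_fun setT h.
  (* [theta] is monotone on the nonnegative reals; precomposing with [Num.max 0] makes it monotone,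
     hence measurable, on the line. *)
  have -> : h = (fun u => theta (Num.max 0 u)) \o g.
    by apply/funext => r; rewrite /h/= max_r.
  have mth : measurable_fun setT (fun u : R => theta (Num.max 0 u)).
    apply: nondecreasing_measurable => // u v uv; apply: theta_nd; first by rewrite le_max lexx.
    by rewrite ge_max le_max lexx/= le_max uv orbT.
  exact: (measurableT_comp mth mg).
pose G t := \int[mu]_(r in `]0, t]) h r.
have hi s t : s <= t -> mu.-integrable (`]s, t] : set R) (EFin \o h).
  by move=> st; exact: bounded_itv_integrable.
have GB s t : 0 <= s -> s <= t -> G t = G s + \int[mu]_(r in `]s, t]) h r.
  by move=> s0 st; apply: Rintegral_itv_cat => //; apply: hi; exact: le_trans st.
have G_nd s t : 0 <= s -> s <= t -> G s <= G t.
  by move=> s0 st; rewrite (GB s t)// lerDl; exact: Rintegral_ge0.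
have Gneg s : s <= 0 -> G s = 0.
  by move=> s0; rewrite /G set_itv_ge ?Rintegral_set0// bnd_simp -leNgt.
have GL s t : s <= t -> G t - G s <= theta M * (t - s).
  move=> st; have [s0|/ltW s0] := leP 0 s.
    rewrite (GB s t)// addrAC subrr add0r; apply: Rintegral_itv_le_cst => //; first exact: hi.
    by move=> r _ _; exact: le_trans (ler_norm _) (hK r).
  rewrite (Gneg s)// subr0; have [t0|/ltW t0] := leP 0 t; last first.
    by rewrite Gneg// mulr_ge0 ?subr_ge0// theta_ge0.
  apply: (@le_trans _ _ (theta M * (t - 0))).
    apply: Rintegral_itv_le_cst => //; first exact: hi.
    by move=> r _ _; exact: le_trans (ler_norm _) (hK r).
  by rewrite ler_wpM2l ?theta_ge0//; lra.
have G_nd' s t : s <= t -> G s <= G t.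
  move=> st; have [s0|/ltW s0] := leP 0 s; first exact: G_nd.
  by rewrite Gneg//; apply: Rintegral_ge0.
have Gcont : continuous G.
  move=> y; apply/cvgrPdist_le => e e0; near=> z.
  have yz : `|y - z| <= e / (theta M + 1).
    by near: z; apply: cvgr_dist_le; [exact: cvg_id|rewrite divr_gt0// ltr_wpDl// theta_ge0].
  have tM : 0 < theta M + 1 by rewrite ltr_wpDl// theta_ge0.
  have : `|G y - G z| <= theta M * `|y - z|.
    have [yz'|/ltW zy] := leP y z.
      by rewrite distrC ger0_norm ?subr_ge0 ?G_nd'// distrC ger0_norm ?subr_ge0// GL.
    by rewrite ger0_norm ?subr_ge0 ?G_nd'// ger0_norm ?subr_ge0// GL.
  move=> /le_trans; apply; apply: (@le_trans _ _ ((theta M + 1) * `|y - z|)).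
    by rewrite ler_wpM2r// lerDl.
  by rewrite mulrC -ler_pdivlMr.
apply/eqP; rewrite eq_le g0 andbT leNgt; apply/negP => gt1.
have G1 : 0 < G t1 by exact: lt_le_trans (gG _ t10 t1T).
have [e0 /= e00 he0] := kappa_div.
(* Below 1 [theta] is dominated by [kappa], below [e0] the integral diverges, and levels up to
   [G t1] are attained by [G] on [[0, t1]]. *)
pose e := Num.min 1 (Num.min (e0 / 2) (G t1)).
have e_gt0 : 0 < e by rewrite !lt_min divr_gt0// G1 ltr01.
have e1 : e <= 1 by rewrite ge_min lexx.
have : (\int[mu]_(u in `]0%R, e]) ((kappa u)^-1)%:E = +oo)%E.
  apply: he0 => //=; rewrite sub0r normrN gtr0_norm//.
  by rewrite !gt_min; apply/orP; right; apply/orP; left; lra.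
pose c n := e / 2 ^+ n.
have c0 n : 0 < c n by rewrite divr_gt0// exprn_gt0.
have cS n : c n = 2 * c n.+1 by rewrite /c exprS; field; rewrite expf_neq0.
have ce n : c n <= e by rewrite ler_pdivrMr ?exprn_gt0// ler_peMr ?(ltW e_gt0)// exprn_ege1// ler1n.
have /choice[tau tauP] : forall n, exists t, [/\ 0 <= t, t <= t1 & G t = c n].
  move=> n; have [||t] := @IVT _ G 0 t1 (c n) t10; last first.
  - by rewrite in_itv/= => /andP[t0 tt1] Gt; exists t.
  - rewrite (Gneg 0)// min_l ?max_r ?(ltW G1)// (ltW (c0 n))/=.
    by rewrite (le_trans (ce n))// !ge_min lexx !orbT.
  - exact: continuous_subspaceT.
have tauS n : tau n.+1 <= tau n.
  rewrite leNgt; apply/negP => /ltW tt.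
  have [_ _ g1] := tauP n; have [_ _ g2] := tauP n.+1.
  by have := G_nd' _ _ tt; rewrite g1 g2 (cS n); have := c0 n.+1; lra.
(* While [G] climbs from [c n.+1] to [c n], a rise of [c n.+1], its integrand is at most
   [theta (c n)] because [g <= G <= c n]. *)
have step n : c n.+1 <= theta (c n) * (tau n - tau n.+1).
  have [a0 _ g1] := tauP n; have [b0 _ g2] := tauP n.+1.
  have -> : c n.+1 = \int[mu]_(r in `]tau n.+1, tau n]) h r.
    by have := GB _ _ b0 (tauS n); rewrite g1 g2 (cS n); lra.
  apply: Rintegral_itv_le_cst => //; first exact: hi.
  move=> r r1 r2; have r0 : 0 <= r by rewrite (le_trans b0)// ltW.
  apply: theta_nd => //; apply: (@le_trans _ _ (G r)).
    by apply: gG => //; rewrite (le_trans r2)//; have [_ h1 _] := tauP n; exact: le_trans t1T.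
  by rewrite -g1; exact: G_nd'.
pose q u := (kappa u)^-1.
have mq n : measurable_fun (`]c n, e] : set R) (EFin \o q).
  apply/measurable_EFinP.
  apply: (@eq_measurable_fun _ _ _ _ _ (fun u => (kappa (Num.max (c n) u))^-1)).
    by move=> u; rewrite inE/= in_itv/= => /andP[/ltW cu _]; rewrite max_r.
  apply: measurable_funTS; apply: nonincreasing_measurable => // u v uv.
  have mc w : 0 < Num.max (c n) w by rewrite lt_max c0.
  rewrite lef_pV2 ?posrE ?kappa_gt0//; apply: kappa_nd; first exact: ltW.
  by rewrite ge_max le_max lexx/= le_max uv orbT.
have q0 u : 0 < u -> 0 <= q u by move=> u0; rewrite invr_ge0 ltW// kappa_gt0.
(* On one level the integral is at most [c n.+1 / kappa (c n.+1)], which by [step], doubling and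
   [theta <= D * kappa] is at most [2 D] times the time spent there. *)
have qle n : (\int[mu]_(u in `]c n, e]) (q u)%:E <= (2 * D * (tau 0%N - tau n))%:E)%E.
  elim: n => [|n IH].
    by rewrite {1}/c expr0 divr1 set_itv_ge ?integral_set0 ?subrr ?mulr0// bnd_simp ltxx.
  have cc : c n.+1 <= c n by rewrite (cS n); have := c0 n.+1; lra.
  have eqU : `]c n.+1, e]%classic = `]c n.+1, c n] `|` `]c n, e] :> set R.
    by rewrite -itv_bndbnd_setU// bnd_simp.
  rewrite eqU ge0_integral_setU//; last 3 first.
  - by rewrite -eqU; exact: mq.
  - move=> u; rewrite -eqU/= in_itv/= => /andP[cu _]; rewrite lee_fin q0//.
    exact: lt_trans cu.
  - apply/disj_setPS => u /= []; rewrite !in_itv/= => /andP[_ uc] /andP[cu _].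
    by have := lt_le_trans cu uc; rewrite ltxx.
  have -> : 2 * D * (tau 0%N - tau n.+1) = 2 * D * (tau n - tau n.+1) + 2 * D * (tau 0%N - tau n)
    by ring.
  rewrite EFinD; apply: leeD => //.
  apply: (@le_trans _ _ (\int[mu]_(u in `]c n.+1, c n]) (q (c n.+1))%:E)%E).
    apply: ge0_le_integral => //.
    - by move=> u /=; rewrite in_itv/= => /andP[cu _]; rewrite lee_fin q0// (lt_trans _ cu).
    - apply: measurable_funS (mq n.+1) => // u /=; rewrite !in_itv/= => /andP[-> uc]/=.
      exact: le_trans (ce n).
    - move=> u /=; rewrite in_itv/= => /andP[cu _]; rewrite lee_fin.
      have u0 : 0 < u by exact: lt_trans cu.
      by rewrite lef_pV2 ?posrE ?kappa_gt0// kappa_nd// ltW.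
  rewrite integral_cst// [X in (_ * X)%E](muD cc) -EFinM lee_fin mulrC.
  rewrite ler_pdivrMr ?kappa_gt0//.
  have tt : 0 <= tau n - tau n.+1 by rewrite subr_ge0.
  have h1 := step n; have := theta2 _ (ltW (c0 n.+1)); rewrite -(cS n) => h2.
  have h3 := theta_kappa _ (c0 n.+1) (le_trans (ce n.+1) e1).
  have h4 : theta (c n) <= 2 * (D * kappa (c n.+1)) by lra.
  have := ler_wpM2r tt h4; have := cS n; lra.
have -> : `]0, e]%classic = \bigcup_n `]c n, e]%classic :> set R.
  apply/seteqP; split=> u /=.
    rewrite in_itv/= => /andP[u0 ue]; exists (Num.truncn (e / u)).+1 => //=.
    rewrite in_itv/= ue andbT ltr_pdivrMr ?exprn_gt0// mulrC -ltr_pdivrMr//.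
    apply: (lt_trans (truncnS_gt _)); rewrite -natrX ltr_nat; exact: ltn_expl.
  by move=> [n _]; rewrite /= !in_itv/= => /andP[cu ->]; rewrite (lt_trans _ cu).
move=> hoo.
have cv : (\int[mu]_(u in `]c n, e]) (q u)%:E)%E @[n --> \oo] -->
    (\int[mu]_(u in \bigcup_n `]c n, e]%classic) (q u)%:E)%E.
  apply: ge0_nondecreasing_set_cvg_integral => //.
  - apply/nondecreasing_seqP => n; apply/subsetPset => u /=; rewrite !in_itv/= => /andP[cu ->].
    by rewrite andbT (le_lt_trans _ cu)// (cS n); have := c0 n.+1; lra.
  - by move=> n u /=; rewrite in_itv/= => /andP[cu _]; rewrite lee_fin q0// (lt_trans _ cu).
rewrite hoo in cv.
have : (+oo <= (2 * D * T)%:E)%E; last by rewrite leye_eq.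
apply: (cvge_le _ cv) => //; apply: nearW => n; apply: (le_trans (qle n)).
rewrite lee_fin ler_wpM2l ?mulr_ge0//.
have [_ h1 _] := tauP 0%N; have [h2 _ _] := tauP n.
by rewrite lerBlDr (le_trans h1)// (le_trans t1T)// lerDl.
Unshelve. all: by end_near. Qed.

End Osgood.

(** * The Yamada-Watanabe inequality *)

Section YamadaWatanabe.
Context {R : realType} {T : R} {d : measure_display} {Omega : measurableType d}.
Variables (P : probability Omega R) (F : R -> set (set Omega)).
Variable B : R -> Omega -> R.
Hypotheses (filF : filtration T F) (bmB : brownian_motion T P F B).
Hypothesis T0 : 0 <= T.
Notation mu := (@lebesgue_measure R).
Notation ito_class := (@ito_class R T d Omega P F B).

Lemma ito_class_incr_sqr_le H J s t K : ito_class H J -> 0 <= s -> s <= t -> t <= T ->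
  (forall r w, H r w ^+ 2 <= K) ->
  Ex P (fun w => (J t w - J s w) ^+ 2) <= 4 * (K * (t - s)).
Proof.
move=> HJ s0 st tT HK; have [mH bH _ _] := HJ.
have m1 : measurable_fun setT (fun _ : Omega => 1 : R) by [].
have b1 w : `|(fun _ : Omega => 1 : R) w| <= 1 by rewrite normr1.
have F1 : measurable_wrt (F s) (fun _ : Omega => 1 : R).
  by apply: measurable_wrt_cst; apply: (filtration_sigma_algebra filF) => //; exact: le_trans tT.
have := ito_class_incr_sqr filF bmB T0 HJ s0 st tT m1 b1 F1 (fun _ => ler01).
have -> : Ex P (fun w => 1 * (J t w - J s w) ^+ 2) = Ex P (fun w => (J t w - J s w) ^+ 2).
  by apply: eq_Ex => w; rewrite mul1r.
move=> /le_trans; apply; rewrite ler_wpM2l//.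
have [_ _ L1H iH] := Ex_time_sqr_L1 P st mH bH.
rewrite -[leRHS](Ex_cst P); apply: Ex_le; [|exact: L1_cst|].
  by under eq_fun do rewrite mul1r.
move=> w; rewrite mul1r; apply: Rintegral_itv_le_cst => // r _ _; exact: HK.
Qed.

(** Abstract setting: [Y] is the sum of the stochastic integral [J] of [H] and a part whose
    increments are dominated by time integrals of the bounded [q]. The law-dependent drift enters
    only through [q]. *)
Variables (Y J H q : R -> Omega -> R) (Q c : R).
Hypotheses (Yad : forall t, 0 <= t -> t <= T -> measurable_wrt (F t) (Y t))
  (YL : forall t, 0 <= t -> t <= T -> L1 P (Y t))
  (mY : measurable_fun setT (fun z : R * Omega => Y z.1 z.2))
  (HJ : ito_class H J)
  (c0 : 0 <= c)
  (HY : forall r w, 0 <= r -> r <= T -> H r w ^+ 2 <= c * `|Y r w|)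
  (mq : measurable_fun setT (fun z : R * Omega => q z.1 z.2))
  (qQ : forall r w, 0 <= q r w <= Q)
  (Yq : forall s t, 0 <= s -> s <= t -> t <= T -> {ae P, forall w,
     `|Y t w - Y s w - (J t w - J s w)| <= \int[mu]_(r in `]s, t]) q r w}).

Let qQ' r w : `|q r w| <= Q.
Proof. by have /andP[q0 qq] := qQ r w; rewrite ger0_norm. Qed.

Let Q0 : 0 <= Q.
Proof. by have /andP[q0 qq] := qQ 0 point; exact: le_trans qq. Qed.

Let mYt t : measurable_fun setT (Y t).
Proof. exact: jointly_measurable_space mY t. Qed.

Section Cell.
Variables s t : R.
Hypotheses (s0 : 0 <= s) (st : s < t) (tT : t <= T).

Let st' : s <= t. Proof. exact: ltW. Qed.
Let t0 : 0 <= t. Proof. exact: le_trans st'. Qed.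
Let sT : s <= T. Proof. exact: le_trans tT. Qed.
Let A w := Y t w - Y s w - (J t w - J s w).

Let JL2 := ito_class_incr_L2 HJ s0 st' tT.

Let AqL : L1 P (fun w => \int[mu]_(r in `]s, t]) q r w).
Proof. exact: (time_integral_L1 P mq qQ' st'). Qed.

Let A_L1 : L1 P A.
Proof. by apply: L1B; [apply: L1B; exact: YL|exact: L2_L1]. Qed.

Let intq_le w : \int[mu]_(r in `]s, t]) q r w <= Q * (t - s).
Proof. exact: le_trans (ler_norm _) (norm_time_integral_le mq qQ' st' w). Qed.

Let A_sqr_le : {ae P, forall w, A w ^+ 2 <= (Q * (t - s)) ^+ 2}.
Proof.
apply: filterS (Yq s0 st' tT) => w Aw.
rewrite -(real_normK (num_real (A w))) lerXn2r ?nnegrE ?mulr_ge0 ?subr_ge0//.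
exact: le_trans (intq_le w).
Qed.

(** The bound on [A] holds almost everywhere only, so it is applied under the integral rather than
    pointwise. *)
Lemma cell_drift_sqr_L1 : L1 P (fun w => A w ^+ 2).
Proof.
apply: L1P; first by apply: measurable_funX; exact: (L1_measurable A_L1).
apply: (@le_lt_trans _ _ (\int[P]_w ((Q * (t - s)) ^+ 2)%:E)%E).
  apply: ae_ge0_le_integral => //.
  - apply/measurable_EFinP/measurableT_comp => //.
    by apply: measurable_funX; exact: (L1_measurable A_L1).
  - by move=> w _; rewrite lee_fin sqr_ge0.
  - apply: filterS A_sqr_le => w Aw _; rewrite lee_fin ger0_norm ?sqr_ge0//.
rewrite -(ExE (L1_cst P _)); exact: ltry.
Qed.

Lemma cell_drift_le : Ex P (fun w => `|A w|) <= \int[mu]_(r in `]s, t]) Ex P (q r).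
Proof.
rewrite -(Ex_time_integral P mq qQ' st').
by apply: Ex_ae_le => //; [exact: L1_norm|exact: Yq].
Qed.

Lemma cell_drift_bound : \int[mu]_(r in `]s, t]) Ex P (q r) <= Q * (t - s).
Proof.
rewrite -(Ex_time_integral P mq qQ' st') -[leRHS](Ex_cst P).
by apply: Ex_le => //; exact: L1_cst.
Qed.

Lemma cell_drift_sqr_le : Ex P (fun w => A w ^+ 2) <= (Q * (t - s)) ^+ 2.
Proof.
rewrite -[leRHS](Ex_cst P); apply: Ex_ae_le A_sqr_le; last exact: L1_cst.
exact: cell_drift_sqr_L1.
Qed.

Variable H2 : R.
Hypothesis hH2 : forall r w, H r w ^+ 2 <= H2.

Let H20 : 0 <= H2. Proof. exact: le_trans (sqr_ge0 _) (hH2 0 point). Qed.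
Let mH := let: And4 h _ _ _ := HJ in h.
Let bH := let: And4 _ h _ _ := HJ in h.

Let JJ_le : Ex P (fun w => (J t w - J s w) ^+ 2) <= 4 * (H2 * (t - s)).
Proof. exact: (ito_class_incr_sqr_le HJ). Qed.

Lemma cell_increment_le : Ex P (fun w => `|Y t w - Y s w|) <=
  Q * (t - s) + (1 + 4 * H2) * Num.sqrt (t - s).
Proof.
have h0 : 0 < Num.sqrt (t - s) by rewrite sqrtr_gt0 subr_gt0.
apply: (@le_trans _ _ (Ex P (fun w => `|A w| + `|J t w - J s w|))).
  apply: Ex_le; [by apply: L1_norm; apply: L1B; exact: YL| |].
    by apply: L1D; apply: L1_norm => //; exact: L2_L1.
  move=> w; rewrite (le_trans _ (ler_normD _ _))// /A subrK//.
rewrite ExD; [|exact: L1_norm|by apply: L1_norm; exact: L2_L1].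
apply: lerD; first exact: le_trans cell_drift_le cell_drift_bound.
(* [sqrt (t - s)] is the order of the L2 bound on the increment of [J]. *)
apply: le_trans (Ex_norm_le_sqr JL2 h0) _.
rewrite mulrDl mul1r lerD2l mulrC ler_pdivrMr//.
rewrite [leRHS](_ : _ = 4 * (H2 * Num.sqrt (t - s) ^+ 2)); last by ring.
by rewrite sqr_sqrtr ?subr_ge0.
Qed.

End Cell.

Variables (H2 : R).
Hypothesis hH2 : forall r w, H r w ^+ 2 <= H2.

Section TestFunction.
Variables (f psi K : R -> R) (k0 k1 delta eps : R).
Hypotheses (mf : measurable_fun setT f) (mpsi : measurable_fun setT psi)
  (mK : measurable_fun setT K).
Hypotheses (psi1 : forall y, `|psi y| <= 1) (Kk0 : forall y, 0 <= K y <= k0)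
  (Kdelta : forall y, K y * `|y| <= delta)
  (fabs : forall y, `|y| <= f y <= `|y| + eps)
  (k10 : 0 <= k1)
  (taylor : forall y x, f (y + x) <= f y + psi y * x + K y * x ^+ 2 + k1 * cubic_min x).

Let k00 : 0 <= k0. Proof. by have /andP[h1 h2] := Kk0 0; exact: le_trans h2. Qed.

Let fYL t : 0 <= t -> t <= T -> L1 P (fun w => f (Y t w)).
Proof.
move=> t0 tT; apply: (@L1_le _ _ _ _ _ (fun w => `|Y t w| + eps)).
- exact: (measurableT_comp mf).
- by move=> w; have /andP[h1 h2] := fabs (Y t w); rewrite ger0_norm// (le_trans _ h1).
- by apply: L1D; [apply: L1_norm; exact: YL|exact: L1_cst].
Qed.

(** One step of the discretised Ito formula, with [D] the increment of [J] and [A] that of the drift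
    part. The term [psi * D] has mean zero, [|psi| <= 1] leaves [|A|], and [8 = 2 * 4] combines
    [(D + A)^2 <= 2 D^2 + 2 A^2] with the second moment bound. *)
Lemma test_function_cell s t : 0 <= s -> s < t -> t <= T ->
  Ex P (fun w => f (Y t w)) <= Ex P (fun w => f (Y s w))
   + \int[mu]_(r in `]s, t]) Ex P (q r)
   + 8 * (c * delta * (t - s) + k0 * (c * (Q * (t - s) + (1 + 4 * H2) * Num.sqrt (t - s))) * (t - s))
   + (2 * k0 + 4 * k1) * (Q * (t - s)) ^+ 2
   + 8 * k1 * Ex P (fun w => cubic_min (J t w - J s w)).
Proof.
move=> s0 st tT; have st' := ltW st; have t0 : 0 <= t by exact: le_trans st'.
have sT : s <= T by exact: le_trans tT.
have h0 : 0 <= t - s by rewrite subr_ge0.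
have JL2 := ito_class_incr_L2 HJ s0 st' tT.
pose A w := Y t w - Y s w - (J t w - J s w).
pose D w := J t w - J s w.
have AL : L1 P A by apply: L1B; [apply: L1B; exact: YL|exact: L2_L1].
have A2L : L1 P (fun w => A w ^+ 2) by exact: cell_drift_sqr_L1.
have mKY : measurable_fun setT (fun w => K (Y s w)) by exact: (measurableT_comp mK).
have bKY w : `|K (Y s w)| <= k0 by have /andP[h1 h2] := Kk0 (Y s w); rewrite ger0_norm.
have mpY : measurable_fun setT (fun w => psi (Y s w)) by exact: (measurableT_comp mpsi).
have bpY w : `|psi (Y s w)| <= 1 by exact: psi1.
have DL : L1 P D by exact: L2_L1.
have pDL : L1 P (fun w => psi (Y s w) * D w) by exact: (L1Mbounded mpY bpY).
have D2L : L1 P (fun w => K (Y s w) * D w ^+ 2) by apply: (L1Mbounded mKY bKY); case: JL2.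
have cDL : L1 P (fun w => cubic_min (D w)).
  have [mD D2] := JL2; apply: (L1_le _ _ D2).
    by apply: measurableT_comp => //; exact: measurable_cubic_min.
  by move=> w; rewrite ger0_norm ?cubic_min_ge0// cubic_min_le_sqr.
have bound w : f (Y t w) <= f (Y s w) + `|A w| + psi (Y s w) * D w + 2 * (K (Y s w) * D w ^+ 2)
    + (2 * k0 + 4 * k1) * A w ^+ 2 + 8 * k1 * cubic_min (D w).
  have e : Y t w = Y s w + (D w + A w) by rewrite /A /D; ring.
  rewrite {1}e; apply: le_trans (taylor _ _) _.
  have h1 : psi (Y s w) * A w <= `|A w|.
    rewrite (le_trans (ler_norm _))// normrM ler_piMl//.
  have /andP[K0 Kk] := Kk0 (Y s w).
  have h2 : K (Y s w) * (D w + A w) ^+ 2 <= 2 * (K (Y s w) * D w ^+ 2) + 2 * k0 * A w ^+ 2.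
    have g1 : K (Y s w) * (D w + A w) ^+ 2 <= K (Y s w) * (2 * D w ^+ 2 + 2 * A w ^+ 2).
      by rewrite ler_wpM2l//; have := sqr_ge0 (D w - A w); nra.
    have g2 : K (Y s w) * A w ^+ 2 <= k0 * A w ^+ 2 by rewrite ler_wpM2r// sqr_ge0.
    lra.
  have h3 := ler_wpM2l k10 (cubic_minD_sqr (D w) (A w)).
  lra.
pose X1 := fun w => f (Y s w) + `|A w|.
have i1 : L1 P (fun w => f (Y s w) + `|A w|) by apply: L1D; [exact: fYL|exact: L1_norm].
have i2 : L1 P (fun w => f (Y s w) + `|A w| + psi (Y s w) * D w) by exact: L1D.
have i3' : L1 P (fun w => 2 * (K (Y s w) * D w ^+ 2)) by exact: L1Z.
have i3 : L1 P (fun w => f (Y s w) + `|A w| + psi (Y s w) * D w + 2 * (K (Y s w) * D w ^+ 2)).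
  exact: L1D.
have i4' : L1 P (fun w => (2 * k0 + 4 * k1) * A w ^+ 2) by exact: L1Z.
have i4 : L1 P (fun w => f (Y s w) + `|A w| + psi (Y s w) * D w + 2 * (K (Y s w) * D w ^+ 2)
    + (2 * k0 + 4 * k1) * A w ^+ 2) by exact: L1D.
have i5' : L1 P (fun w => 8 * k1 * cubic_min (D w)) by exact: L1Z.
apply: (le_trans (Ex_le (fYL t0 tT) (L1D i4 i5') bound)).
rewrite (ExD i4 i5') (ExD i3 i4') (ExD i2 i3') (ExD i1 pDL) (ExD (fYL s0 sT) (L1_norm AL)).
rewrite (ExZ _ D2L) (ExZ _ A2L) (ExZ _ cDL).
have -> : Ex P (fun w => psi (Y s w) * D w) = 0.
  apply: (ito_class_incr_mean0 filF bmB HJ s0 st' tT mpY bpY).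
  by apply: measurable_wrt_comp => //; exact: Yad.
rewrite addr0 lerD2r; apply: lerD; last first.
  rewrite ler_wpM2l; [by []| |exact: cell_drift_sqr_le].
  by rewrite addr_ge0// mulr_ge0.
apply: lerD; first by rewrite lerD2l; exact: cell_drift_le.
have K0 w : 0 <= K (Y s w) by have /andP[] := Kk0 (Y s w).
have FK : measurable_wrt (F s) (fun w => K (Y s w)).
  by apply: measurable_wrt_comp => //; exact: Yad.
have sq := ito_class_incr_sqr filF bmB T0 HJ s0 st' tT mKY bKY FK K0.
have H20 : 0 <= H2 by exact: le_trans (sqr_ge0 _) (hH2 0 point).
(* The weight [K (Y s)] is small against [|Y s|] only, so [H r ^ 2] is bounded by [c |Y s| + G r].
   The cut at [H2] keeps [G] bounded for the exchange of integrals. *)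
pose G r w := Num.min (c * `|Y r w - Y s w|) H2.
have mG : measurable_fun setT (fun z : R * Omega => G z.1 z.2).
  apply: measurable_minr => //; apply: measurable_funM => //.
  apply: measurableT_comp => //; apply: measurable_funB => //.
  exact: (measurableT_comp (mYt s)).
have G0 r w : 0 <= G r w by rewrite le_min H20 mulr_ge0.
have GH r w : `|G r w| <= H2 by rewrite ger0_norm// ge_min lexx orbT.
have [mH bH _ _] := HJ.
have [_ _ L1H iH] := Ex_time_sqr_L1 P st' mH bH.
have GL := time_integral_L1 P mG GH st'.
have iG := bounded_time_integrable mG GH st'.
have key : Ex P (fun w => K (Y s w) * \int[mu]_(r in `]s, t]) (H r w ^+ 2)) <=
    c * delta * (t - s) + k0 * \int[mu]_(r in `]s, t]) Ex P (G r).
  rewrite -(Ex_time_integral P mG GH st') -(ExZ _ GL) -[X in X + _](Ex_cst P).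
  rewrite -ExD; [|exact: L1_cst|exact: L1Z].
  apply: Ex_le.
  - exact: (L1Mbounded mKY bKY).
  - by apply: L1D; [exact: L1_cst|exact: L1Z].
  move=> w; set IG := \int[mu]_(r in `]s, t]) G r w.
  have IG0 : 0 <= IG by apply: Rintegral_ge0 => r _.
  have hI : \int[mu]_(r in `]s, t]) (H r w ^+ 2) <= c * `|Y s w| * (t - s) + IG.
    have ic : mu.-integrable (`]s, t] : set R) (EFin \o (fun _ => c * `|Y s w|)).
      by apply: (@bounded_itv_integrable _ (fun _ => c * `|Y s w|) `|c * `|Y s w| |).
    have mD : @measurable _ (measurableTypeR R) `]s, t]%classic by exact: measurable_itv.
    apply: (@le_trans _ _ (\int[mu]_(r in `]s, t]) (c * `|Y s w| + G r w))).
      apply: le_Rintegral => //; first exact: (integrableD mD ic (iG w)).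
      move=> r /=; rewrite in_itv/= => /andP[sr rt].
      have r0 : 0 <= r by rewrite (le_trans s0)// ltW.
      have rT : r <= T by exact: le_trans tT.
      rewrite /G -lerBlDl le_min; apply/andP; split.
        apply: (@le_trans _ _ (c * `|Y r w| - c * `|Y s w|)); first by rewrite lerB// HY.
        by rewrite -mulrBr ler_wpM2l// lerB_dist.
      by rewrite lerBlDl (le_trans (hH2 r w))// lerDr mulr_ge0.
    rewrite (RintegralD mD ic (iG w)) lerD2r.
    by apply: Rintegral_itv_le_cst.
  have h1 := ler_wpM2l (K0 w) hI; apply: (le_trans h1); rewrite mulrDr; apply: lerD.
    have := Kdelta (Y s w) => hd.
    rewrite (_ : K (Y s w) * (c * `|Y s w| * (t - s)) = c * (t - s) * (K (Y s w) * `|Y s w|));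
      last by ring.
    rewrite (_ : c * delta * (t - s) = c * (t - s) * delta); last by ring.
    by rewrite ler_wpM2l// mulr_ge0.
  by rewrite ler_wpM2r//; have /andP[] := Kk0 (Y s w).
have gle : \int[mu]_(r in `]s, t]) Ex P (G r) <=
    c * (Q * (t - s) + (1 + 4 * H2) * Num.sqrt (t - s)) * (t - s).
  have mEG := measurable_Ex_time P mG GH.
  have bEG := norm_Ex_time_le P mG GH.
  apply: Rintegral_itv_le_cst => //; first exact: (bounded_itv_integrable st' mEG bEG).
  move=> r sr rt; have rT : r <= T by exact: le_trans tT.
  have r0 : 0 <= r by rewrite (le_trans s0)// ltW.
  apply: (@le_trans _ _ (Ex P (fun w => c * `|Y r w - Y s w|))).
    apply: Ex_le.
    - exact: (L1_bounded _ (jointly_measurable_space mG r) (GH r)).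
    - by apply/L1Z/L1_norm/L1B; exact: YL.
    - by move=> w; rewrite ge_min lexx.
  rewrite ExZ; last by apply/L1_norm/L1B; exact: YL.
  rewrite ler_wpM2l//; apply: (le_trans (cell_increment_le s0 sr rT hH2)).
  apply: lerD; first by rewrite ler_wpM2l// lerD2r.
  rewrite ler_wpM2l ?addr_ge0// ?mulr_ge0//.
  by apply: ler_wsqrtr; rewrite lerD2r.
have := ler_wpM2l k00 gle.
have aux (a b x y z : R) : a <= 4 * b -> b <= x + y -> y <= z -> 2 * a <= 8 * (x + z) by lra.
by move=> /(aux _ _ _ _ _ sq key); rewrite (mulrA k0 _ (t - s)).
Qed.

End TestFunction.

(** Over [n.+1] cells the terms in [h^(3/2)] and [h^2] add up to order [sqrt h]; only the curvature
    term [8 c eta t] survives refinement. *)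
Let sum_err (k0 k1 t eta : R) : 0 <= k0 -> 0 <= k1 -> 0 < t -> 0 < eta ->
  exists N, forall n, (N <= n)%N -> let h := t / n.+1%:R in
   (8 * (c * eta * h + k0 * (c * (Q * h + (1 + 4 * H2) * Num.sqrt h)) * h)
     + (2 * k0 + 4 * k1) * (Q * h) ^+ 2) *+ n.+1 <= 8 * c * eta * t + eta.
Proof.
move=> k00 k10 t0 eta0; have H20 : 0 <= H2 by exact: le_trans (sqr_ge0 _) (hH2 0 point).
pose a := 8 * k0 * c * (Q * Num.sqrt t + (1 + 4 * H2)) * t.
pose b := (2 * k0 + 4 * k1) * Q ^+ 2 * t * Num.sqrt t.
have st0 : 0 <= Num.sqrt t by exact: sqrtr_ge0.
have Qs : 0 <= Q * Num.sqrt t by exact: mulr_ge0.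
have a0 : 0 <= a by rewrite !mulr_ge0// ?(ltW t0)// addr_ge0// addr_ge0// mulr_ge0.
have b0 : 0 <= b by rewrite !mulr_ge0// ?(ltW t0)// ?sqr_ge0// addr_ge0// mulr_ge0.
exists (Num.truncn (((a + b) * Num.sqrt t / eta) ^+ 2)) => n Nn /=.
set h := t / n.+1%:R.
have hn : h * n.+1%:R = t by rewrite divfK.
(* This brings all the errors to the common order [sqrt h]. *)
have hs : h <= Num.sqrt t * Num.sqrt h.
  have h1 : Num.sqrt h <= Num.sqrt t by apply: ler_wsqrtr;
    rewrite ler_pdivrMr// ler_peMr ?(ltW t0)// ler1n.
  rewrite -[leLHS]sqr_sqrtr ?divr_ge0 ?(ltW t0)// expr2 ler_wpM2r// sqrtr_ge0.
rewrite -mulr_natr.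
have -> : (8 * (c * eta * h + k0 * (c * (Q * h + (1 + 4 * H2) * Num.sqrt h)) * h)
     + (2 * k0 + 4 * k1) * (Q * h) ^+ 2) * n.+1%:R =
   8 * c * eta * (h * n.+1%:R) + 8 * k0 * c * (h * n.+1%:R) * (Q * h + (1 + 4 * H2) * Num.sqrt h)
   + (2 * k0 + 4 * k1) * Q ^+ 2 * (h * n.+1%:R) * h by ring.
rewrite hn -addrA lerD2l.
apply: (@le_trans _ _ ((a + b) * Num.sqrt h)).
  rewrite [leRHS]mulrDl; apply: lerD.
    rewrite /a [leRHS](_ : _ = 8 * k0 * c * t * (Q * (Num.sqrt t * Num.sqrt h) + (1 + 4 * H2)
      * Num.sqrt h)); last by ring.
    by rewrite ler_wpM2l ?mulr_ge0 ?(ltW t0)// lerD2r ler_wpM2l.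
  rewrite /b -[leRHS]mulrA; apply: ler_wpM2l hs.
  have k01 : 0 <= 2 * k0 + 4 * k1 by rewrite addr_ge0// mulr_ge0.
  by rewrite mulr_ge0 ?(ltW t0)// mulr_ge0// sqr_ge0.
have hE : Num.sqrt h = Num.sqrt t / Num.sqrt n.+1%:R.
  by rewrite /h sqrtrM ?(ltW t0)// sqrtrV.
rewrite hE mulrA ler_pdivrMr ?sqrtr_gt0// [leRHS]mulrC -ler_pdivrMr//.
rewrite -[leLHS]ger0_norm ?divr_ge0 ?mulr_ge0 ?addr_ge0 ?(ltW eta0)//.
rewrite -sqrtr_sqr; apply: ler_wsqrtr; apply/ltW.
by apply: (lt_le_trans (truncnS_gt _)); rewrite ler_nat.
Qed.

Hypothesis Y00 : Ex P (fun w => `|Y 0 w|) = 0.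

Lemma Ex_norm_le_drift t : 0 <= t -> t <= T ->
  Ex P (fun w => `|Y t w|) <= \int[mu]_(r in `]0, t]) Ex P (q r).
Proof.
rewrite le_eqVlt => /predU1P[<- _|t0 tT].
  by rewrite Y00; apply: Rintegral_ge0 => r _; apply: Ex_ge0 => w; have /andP[] := qQ r w.
(* [8 c t] comes from the curvature term; the three further [eta] pay for [f] against the absolute
   value at time 0, for the errors of [sum_err], and for the Taylor remainders. *)
apply: (@le_eps_mul _ _ _ (8 * c * t + 3)) => eta eta0.
have [f [psi [K [k0 [k1 [[mf mpsi mK] [psi1 Kk0 Kd] fabs k10 taylor]]]]]] :=
  yamada_watanabe_functions eta0 eta0.
have k00 : 0 <= k0 by have /andP[h1 h2] := Kk0 0; exact: le_trans h2.
(* Adding 1 avoids a division by 0, as [k1] is only known to be nonnegative. *)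
have e0 : 0 < eta / (8 * k1 + 1) by rewrite divr_gt0// ltr_wpDl// mulr_ge0.
have [N1 hN1] := ito_class_cubic_min filF bmB T0 HJ (ltW t0) tT e0.
have [N2 hN2] := sum_err k00 k10 t0 eta0.
pose n := maxn N1 N2.
have {hN1} := hN1 n (leq_maxl _ _); have {hN2} := hN2 n (leq_maxr _ _).
set h := t / n.+1%:R => /= err cub.
have h0 : 0 < h by rewrite divr_gt0.
have hn : n.+1%:R * h = t by rewrite mulrC divfK.
have qE r : `|Ex P (q r)| <= Q := norm_Ex_time_le P mq qQ' r.
have mEq := measurable_Ex_time P mq qQ'.
pose C := 8 * (c * eta * h + k0 * (c * (Q * h + (1 + 4 * H2) * Num.sqrt h)) * h)
     + (2 * k0 + 4 * k1) * (Q * h) ^+ 2.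
pose I (i : nat) := \int[mu]_(r in `](i%:R * h), (i.+1%:R * h)]) Ex P (q r).
pose E (i : nat) := Ex P (fun w => cubic_min (J (i.+1%:R * h) w - J (i%:R * h) w)).
have aux2 (x1 x2 u0 s u ci c1 c2 es v : R) : x2 <= x1 + u + c1 + c2 + 8 * k1 * v ->
    x1 <= u0 + s + ci + 8 * k1 * es ->
    x2 <= u0 + (s + u) + (ci + (c1 + c2)) + 8 * k1 * (es + v) by lra.
have rec i : (i <= n.+1)%N -> Ex P (fun w => f (Y (i%:R * h) w)) <=
    Ex P (fun w => f (Y 0 w)) + \sum_(j < i) I j + C *+ i + 8 * k1 * \sum_(j < i) E j.
  elim: i => [_|i IH iN]; first by rewrite !big_ord0 mul0r mulr0n mulr0 !addr0.
  have i0 : 0 <= i%:R * h by rewrite mulr_ge0// ltW.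
  have ii : i%:R * h < i.+1%:R * h by rewrite ltr_pM2r// ltr_nat.
  have iT : i.+1%:R * h <= T by rewrite (le_trans _ tT)// -hn ler_pM2r// ler_nat.
  have cell := test_function_cell mf mpsi mK psi1 Kk0 Kd fabs k10 taylor i0 ii iT.
  have hh : i.+1%:R * h - i%:R * h = h by rewrite -mulrBl -natrB// subSnn mul1r.
  rewrite hh in cell; have {}IH := IH (ltnW iN).
  rewrite !big_ord_recr/= (mulrSr C); exact: (aux2 _ _ _ _ _ _ _ _ _ _ cell IH).
have {rec} := rec n.+1 (leqnn _); rewrite hn.
have -> : \sum_(j < n.+1) I j = \int[mu]_(r in `]0, t]) Ex P (q r).
  rewrite Rintegral_grid ?hn ?(ltW h0)//.
  exact: (bounded_itv_integrable (ltW t0) mEq qE).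
have fY0 : Ex P (fun w => f (Y 0 w)) <= eta.
  have Y0L : L1 P (fun w => `|Y 0 w|) by apply: L1_norm; exact: YL.
  apply: (@le_trans _ _ (Ex P (fun w => `|Y 0 w| + eta))); last first.
    by rewrite ExD ?Y00 ?Ex_cst ?add0r//; exact: L1_cst.
  have fb w : f (Y 0 w) <= `|Y 0 w| + eta by have /andP[] := fabs (Y 0 w).
  have L' : L1 P (fun w => `|Y 0 w| + eta) by apply: L1D => //; exact: L1_cst.
  apply: Ex_le => //; apply: (L1_le _ _ L'); first exact: (measurableT_comp mf).
  move=> w; rewrite ger0_norm//; have /andP[h1 _] := fabs (Y 0 w); exact: le_trans h1.
have fYt : Ex P (fun w => `|Y t w|) <= Ex P (fun w => f (Y t w)).
  have YtL : L1 P (fun w => `|Y t w|) by apply: L1_norm; apply: YL => //; exact: ltW.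
  have fa w : `|Y t w| <= f (Y t w) by have /andP[] := fabs (Y t w).
  have L' : L1 P (fun w => `|Y t w| + eta) by apply: L1D => //; exact: L1_cst.
  apply: Ex_le => //; apply: (L1_le _ _ L'); first exact: (measurableT_comp mf).
  by move=> w; have /andP[h1 h2] := fabs (Y t w); rewrite ger0_norm// (le_trans _ h1).
have cub8 : 8 * k1 * \sum_(j < n.+1) E j <= eta.
  apply: (@le_trans _ _ ((8 * k1 + 1) * \sum_(j < n.+1) E j)).
    rewrite ler_wpM2r ?lerDl//; apply: sumr_ge0 => j _.
    by apply: Ex_ge0 => w; exact: cubic_min_ge0.
  by rewrite mulrC -ler_pdivlMr// ltr_wpDl// mulr_ge0.
have aux (u v x y z p : R) : u <= v -> x <= eta -> z <= 8 * c * eta * t + eta -> p <= eta ->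
  v <= x + y + z + p -> u <= y + (8 * c * t + 3) * eta by lra.
exact: (aux _ _ _ _ _ _ fYt fY0 err cub8).
Qed.

End YamadaWatanabe.

(** * Solutions *)

Section ContinuousProcess.
Context {R : realType} {T : R} {d : measure_display} {Omega : measurableType d}.
Hypothesis T0 : 0 <= T.
Implicit Types X : R -> Omega -> R.

Lemma clampT_ge0 r : 0 <= clamp 0 T r. Proof. exact: clamp_ge. Qed.
Lemma clampT_le r : clamp 0 T r <= T. Proof. exact: clamp_le. Qed.

Lemma clampT_in r : clamp 0 T r \in `[0, T].
Proof. by rewrite in_itv/= clampT_ge0 clampT_le. Qed.

Lemma clampT_id r : 0 <= r -> r <= T -> clamp 0 T r = r.
Proof. by move=> r0 rT; rewrite /clamp min_r// max_r. Qed.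

Lemma clampT_dist x y : `|clamp 0 T x - clamp 0 T y| <= `|x - y|.
Proof.
wlog xy : x y / x <= y.
  by move=> h; have [/h//|/ltW/h] := leP x y; rewrite distrC [leRHS]distrC.
rewrite distrC [leRHS]distrC !ger0_norm ?subr_ge0//; last exact: clamp_mono.
rewrite /clamp !maxEle !minEle.
by case: (leP T x) => h1; case: (leP T y) => h2; rewrite ?T0;
  try case: (leP 0 x) => h4; try case: (leP 0 y) => h5; lra.
Qed.

Lemma continuous_clampT : continuous (clamp 0 T).
Proof.
move=> y; apply/cvgrPdist_le => e e0; near=> z.
apply: (le_trans (clampT_dist _ _)).
by near: z; apply: cvgr_dist_le; [exact: cvg_id|].
Unshelve. all: by end_near. Qed.

(** The clamp takes its values in [[0, T]], so continuity relative to that interval is enough. *)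
Lemma continuous_process_clampT X w : continuous_process T X ->
  continuous (fun r => X (clamp 0 T r) w).
Proof.
move=> cX r; have /subspace_continuousP h := cX w.
have cr : `[0, T]%classic (clamp 0 T r) by exact: clampT_in.
apply: (@cvg_comp _ _ _ (clamp 0 T) (X ^~ w) (nbhs r) (within `[0,
  T]%classic (nbhs (clamp 0 T r)))); last exact: h.
move=> A /= hA; have := continuous_clampT hA; rewrite /= !nbhs_simpl/=.
by apply: filterS => z /=; apply; exact: clampT_in.
Qed.

(** Left end of the cell of mesh [1 / n.+1] that contains the clamped time. *)
Let grid (n : nat) (r : R) : R := (Num.truncn (clamp 0 T r * n.+1%:R))%:R / n.+1%:R.

Let grid_dist n r : `|clamp 0 T r - grid n r| <= n.+1%:R^-1.
Proof.
have c0 : 0 <= clamp 0 T r * n.+1%:R by rewrite mulr_ge0// clampT_ge0.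
have /andP[h1 h2] := truncn_itv c0.
rewrite -(@ler_pM2r _ n.+1%:R)// mulVf ?pnatr_eq0//.
rewrite -[X in _ * X]ger0_norm// -normrM mulrBl /grid divfK ?pnatr_eq0//.
rewrite ger0_norm ?subr_ge0//; move: h2; rewrite -natr1; lra.
Qed.

Let cvg_grid r : grid n r @[n --> \oo] --> clamp 0 T r.
Proof.
apply/cvgrPdist_le => e e0; near=> n; apply: (le_trans (grid_dist n r)).
by near: n; apply: (cvgr_le (0 : R)) => //; exact: cvg_harmonic.
Unshelve. all: by end_near. Qed.

(* Processes are only constrained on [[0, T]]; stopping time at both ends by
   [clamp 0 T] makes them jointly measurable on the whole line. *)
Lemma jointly_measurable_process X : continuous_process T X ->
  (forall t, 0 <= t -> t <= T -> measurable_fun setT (X t)) ->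
  measurable_fun setT (fun z : R * Omega => X (clamp 0 T z.1) z.2).
Proof.
move=> cX mX.
(* Enough cells to cover [[0, T]], its right end included; [h n] samples [X] at their left ends. *)
pose N n := (Num.truncn (T * n.+1%:R)).+1.
pose D n k : set R := [set r | k%:R <= clamp 0 T r * n.+1%:R < k.+1%:R].
pose h n (z : R * Omega) : R :=
  \sum_(k < N n) \1_(D n k) z.1 * X (clamp 0 T (k%:R / n.+1%:R)) z.2.
have mc : measurable_fun setT (clamp 0 T) by apply: continuous_measurable_fun; exact: continuous_clampT.
have mD n k : measurable (D n k).
  have -> : D n k = (fun r => clamp 0 T r * n.+1%:R) @^-1` `[k%:R, k.+1%:R[.
    by apply/seteqP; split=> r /=; rewrite in_itv.
  by rewrite -[X in measurable X]setTI; apply: measurable_funM => //; exact: measurable_itv.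
have hE n z : h n z = X (clamp 0 T (grid n z.1)) z.2.
  have c0 : 0 <= clamp 0 T z.1 * n.+1%:R by rewrite mulr_ge0// clampT_ge0.
  set m := Num.truncn (clamp 0 T z.1 * n.+1%:R).
  have mN : (m < N n)%N by rewrite ltnS; apply: le_truncn; rewrite ler_wpM2r// clampT_le.
  rewrite /h (bigD1 (Ordinal mN))//= big1 ?addr0.
    by rewrite indicE mem_set ?mul1r//; exact: truncn_itv.
  move=> k km; rewrite indicE memNset ?mul0r// => /truncn_def km'.
  by move: km; rewrite -val_eqE/= /m km' eqxx.
apply: (measurable_fun_cvg (h := h)).
  move=> n; apply: measurable_sum => k; apply: measurable_funM.
    exact: (measurableT_comp (measurable_indic (mD n k))).
  by apply: (measurableT_comp (mX _ _ _)) => //; [exact: clampT_ge0|exact: clampT_le].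
move=> z _; under eq_fun do rewrite hE.
have -> : X (clamp 0 T z.1) z.2 = X (clamp 0 T (clamp 0 T z.1)) z.2.
  by rewrite (clampT_id (clampT_ge0 _) (clampT_le _)).
apply: (@cvg_comp _ _ _ (fun n => grid n z.1) (fun r => X (clamp 0 T r) z.2)); first exact: cvg_grid.
exact: continuous_process_clampT.
Qed.

(** The exceptional sets are merged over the countably many clamped times [k / n.+1]; continuity of
    the paths covers the others. *)
Lemma indistinguishable_of_pointwise (P : probability Omega R) X1 X2 :
  continuous_process T X1 -> continuous_process T X2 ->
  (forall t, 0 <= t -> t <= T -> {ae P, forall w, X1 t w = X2 t w}) ->
  indistinguishable T P X1 X2.
Proof.
move=> c1 c2 X12.
have : {ae P, forall w, forall n k, X1 (clamp 0 T (k%:R / n.+1%:R))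
  w = X2 (clamp 0 T (k%:R / n.+1%:R)) w}.
  apply/ae_foralln => n; apply/ae_foralln => k.
  by apply: X12; [exact: clampT_ge0|exact: clampT_le].
apply: filterS => w hw t; rewrite in_itv/= => /andP[t0 tT].
rewrite -(clampT_id t0 tT) -(clampT_id (clampT_ge0 t) (clampT_le t)).
have l1 : X1 (clamp 0 T (grid n t)) w @[n --> \oo] --> X1 (clamp 0 T (clamp 0 T t)) w.
  apply: (@cvg_comp _ _ _ (grid ^~ t) (fun r => X1 (clamp 0 T r) w)); first exact: cvg_grid.
  exact: continuous_process_clampT.
have l2 : X2 (clamp 0 T (grid n t)) w @[n --> \oo] --> X2 (clamp 0 T (clamp 0 T t)) w.
  apply: (@cvg_comp _ _ _ (grid ^~ t) (fun r => X2 (clamp 0 T r) w)); first exact: cvg_grid.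
  exact: continuous_process_clampT.
suff e : (fun n => X1 (clamp 0 T (grid n t)) w) = (fun n => X2 (clamp 0 T (grid n t)) w).
  by move: l1; rewrite e => l1; apply: (cvg_unique _ l1 l2).
by apply/funext => n; rewrite /grid hw.
Qed.

End ContinuousProcess.

(** * Bounds on integrals of possibly nonmeasurable functions *)

Section RintegralBounded.
Context {R : realType} {d : measure_display} {T : measurableType d}.
Variable mu : {measure set T -> \bar R}.
Local Open Scope ereal_scope.
Import HBNNSimple.

(* No measurability of [f]: the integral of a nonnegative function is a
   supremum over the simple functions below it. *)
Lemma nonmeasurable_integral_le (D : set T) (f : T -> \bar R) (M : R) : measurable D ->
  (0 <= M)%R -> (forall x, D x -> 0 <= f x <= M%:E) ->
  0 <= \int[mu]_(x in D) f x <= M%:E * mu D.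
Proof.
move=> mD M0 fM; have f0 x : D x -> 0 <= f x by move=> /fM/andP[].
apply/andP; split; first exact: integral_ge0.
rewrite -integral_cst// ge0_integralE// [leRHS]ge0_integralE//.
apply: ereal_sup_le => _ /= [h hf <-]; exists h => // x; apply: (le_trans (hf x)).
by rewrite !patchE; case: ifPn => // /set_mem/fM/andP[].
Qed.

(** Meant for the drift before its measurability in time is established: that measurability rests on
    the continuity of the laws, which rests on this bound. *)
Lemma norm_Rintegral_le_bound (D : set T) (f : T -> R) (M m : R) : measurable D ->
  (0 <= M)%R -> mu D = m%:E -> (forall x, D x -> `|f x| <= M)%R ->
  (`|Rintegral mu D f| <= M * m)%R.
Proof.
move=> mD M0 muD fM; rewrite /Rintegral integralE.
have fp x : D x -> 0 <= ((EFin \o f)^\+ x) <= M%:E.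
  move=> /fM h; rewrite funeposE/= le_max lexx orbT/= ge_max !lee_fin M0 andbT.
  exact: le_trans (ler_norm _) h.
have fn x : D x -> 0 <= ((EFin \o f)^\- x) <= M%:E.
  move=> /fM h; rewrite funenegE/= le_max lexx orbT/= ge_max !lee_fin M0 andbT.
  by rewrite (le_trans _ h)// -normrN ler_norm.
have := nonmeasurable_integral_le mD M0 fp; have := nonmeasurable_integral_le mD M0 fn.
rewrite muD -EFinM -/(EFin \o f).
case: (integral _ _ _) => [u| |]; rewrite ?lee_fin ?andbF//.
case: (integral _ _ _) => [v| |]; rewrite ?lee_fin ?andbF//=.
by move=> /andP[u0 uM] /andP[v0 vM]; rewrite ler_norml; apply/andP; split; lra.
Qed.

End RintegralBounded.

(** * From Ito integrals to the class [ito_class] *)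

Section ItoIntegral.
Context {R : realType} {T : R} {d : measure_display} {Omega : measurableType d}.
Variables (P : probability Omega R) (F : R -> set (set Omega)).
Variable B : R -> Omega -> R.
Hypotheses (filF : filtration T F) (bmB : brownian_motion T P F B).
Hypothesis T0 : 0 <= T.
Notation mu := (@lebesgue_measure R).
Notation elem := (@elem R T d Omega F).
Notation ito_class := (@ito_class R T d Omega P F B).

(** [lint] clamps times to [[0, t]] while [sp_int] only caps them at [t]; the two agree because the
    times of [S] are nonnegative. *)
Lemma simple_process_elems (S : simple_process) : simple_adapted T F S ->
  exists L : seq elem, (forall r w, lval L r w = sp_val S r w) /\
    (forall t w, 0 <= t -> t <= T -> lint B 0 t L w = sp_int S B t w).
Proof.
move=> [S0 Sinc ST Sco].
have St0 i : (i <= sp_size S)%N -> 0 <= sp_time S i.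
  elim: i => [//|i IH] iS; apply: (le_trans (IH (ltnW iS))); exact: Sinc.
have StT i : (i <= sp_size S)%N -> sp_time S i <= T.
  move=> /subnKC; move: (_ - i)%N => k; elim: k i => [|k IH] i ik.
    by move: ST; rewrite -ik addn0.
  by apply: (le_trans (Sinc i _)); [rewrite -ik addnS ltnS leq_addr|apply: IH; rewrite addSnnS].
suff H k : (k <= sp_size S)%N -> exists L : seq elem,
   (forall r w, lval L r w = \sum_(i < k) sp_coef S i w * \1_(`]sp_time S i,
     sp_time S i.+1]%classic) r) /\
   (forall t w, 0 <= t -> t <= T -> lint B 0 t L w = \sum_(i < k) sp_coef S i w *
    (B (Num.min (sp_time S i.+1) t) w - B (Num.min (sp_time S i) t) w)).
  exact: H.
elim: k => [|k IH] kS.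
  by exists [::]; split=> *; rewrite /lval /lint big_nil big_ord0.
have [L [Lv Li]] := IH (ltnW kS); have [Fco bco] := Sco _ kS.
have k0 := St0 _ (ltnW kS); have kT := StT _ (ltnW kS).
have mco : measurable_fun setT (sp_coef S k).
  exact: (filtration_measurable filF k0 kT Fco).
pose u : elem := Elem k0 (Sinc _ kS) (StT _ kS) mco bco (fun=> Fco).
exists (rcons L u); split=> [r w|t w t0 tT].
  by rewrite /lval -cats1 big_cat big_seq1 big_ord_recr/= -Lv.
rewrite /lint -cats1 big_cat big_seq1 big_ord_recr/= -Li//; congr (_ + _ * (B _ _ - B _ _)).
  by rewrite /clamp max_r 1?minC// le_min t0 St0.
by rewrite /clamp max_r 1?minC// le_min t0 St0// ltnW.
Qed.

Lemma near_lt_cvg0 (u : nat -> \bar R) (e : R) : 0 < e -> u @ \oo --> 0%E ->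
  \forall n \near \oo, (u n < e%:E)%E.
Proof. by move=> e0 u0; apply: (u0 [set x | (x < e%:E)%E]); apply: open_ereal_lt'; rewrite lte_fin. Qed.

Lemma Ex_le_integral (f : Omega -> R) (g : Omega -> \bar R) (e : R) :
  measurable_fun setT f -> (forall w, 0 <= f w) -> (forall w, (f w)%:E = g w) ->
  (\int[P]_w g w < e%:E)%E -> L1 P f /\ Ex P f <= e.
Proof.
move=> mf f0 fg ge.
have fe : (\int[P]_w (f w)%:E < e%:E)%E by under eq_integral do rewrite fg.
have Lf : L1 P f.
  apply: (L1P mf); under eq_integral do rewrite ger0_norm//.
  exact: lt_trans fe (ltry _).
by split=> //; rewrite -lee_fin ExE// ltW.
Qed.

(** The approximating sequence does not depend on time, so a single large [n] serves the integrand
    and any two times at once. *)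
Lemma ito_integral_ito_class (H I : R -> Omega -> R) :
  measurable_fun setT (fun z : R * Omega => H (clamp 0 T z.1) z.2) ->
  (exists K, forall r w, 0 <= r -> r <= T -> `|H r w| <= K) ->
  ito_integral T P F B H I -> ito_class (fun r w => H (clamp 0 T r) w) I.
Proof.
move=> mH [K HK] [_ _ adI _ [S [Sad SH SI]]].
have Hb : exists K, forall r w, `|H (clamp 0 T r) w| <= K.
  by exists K => r w; apply: HK; [exact: clamp_ge|exact: clamp_le].
have mI t : 0 <= t -> t <= T -> measurable_fun setT (I t).
  by move=> t0 tT; apply: (filtration_measurable filF t0 tT); apply: adI; rewrite in_itv/= t0.
have appI t e : 0 <= t -> t <= T -> 0 < e -> \forall n \near \oo, forall L : seq elem,
    (forall t w, 0 <= t -> t <= T -> lint B 0 t L w = sp_int (S n) B t w) ->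
    L2 P (fun w => lint B 0 t L w - I t w) /\ Ex P (fun w => (lint B 0 t L w - I t w) ^+ 2) <= e.
  move=> t0 tT e0; have ht : t \in `[0, T] by rewrite in_itv/= t0.
  apply: filterS (near_lt_cvg0 e0 (SI t ht)) => n hn L hL.
  have mLI : measurable_fun setT (fun w => lint B 0 t L w - I t w).
    by apply: measurable_funB; [exact: (L2_measurable (lint0_L2 filF bmB L t0 tT))|exact: mI].
  have [] := Ex_le_integral (f := fun w => (lint B 0 t L w - I t w) ^+ 2) _ _ _ hn.
  - exact: measurable_funX.
  - by move=> w; exact: sqr_ge0.
  - by move=> w; rewrite real_normK ?num_real// hL.
  - by move=> h1 h2; split.
split=> //.
  move=> t t0 tT; near \oo => n.
  have [L [_ Li]] := simple_process_elems (Sad n).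
  have [h _] : L2 P (fun w => lint B 0 t L w - I t w) /\ Ex P (fun w => (lint B 0 t L w - I t w)
    ^+ 2) <= 1.
    by apply: (near (appI t 1 t0 tT ltr01) n) => //.
  (* [I t] is an elementary integral minus an error, both in L2. *)
  have := L2B (lint0_L2 filF bmB L t0 tT) h.
  by under eq_fun do rewrite subKr.
move=> s t e s0 sT t0 tT e0; near \oo => n.
have [L [Lv Li]] := simple_process_elems (Sad n).
exists L; split; last 2 first.
- by have [] := near (appI s e s0 sT e0) n _ L Li.
- by have [] := near (appI t e t0 tT e0) n _ L Li.
have hn : (\int[P]_w (\int[mu]_(s in `[0%R, T]) (`|sp_val (S n) s w - H s w| ^+ 2)%:E) < e%:E)%E.
  by near: n; apply: near_lt_cvg0.
have [mD bD] := lval_time_sqr_L1 L mH Hb.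
have [_ _ D1 Dint] := Ex_time_sqr_L1 P T0 mD bD.
pose G r w := (lval L r w - H (clamp 0 T r) w) ^+ 2.
have [] // := Ex_le_integral (f := fun w => \int[mu]_(r in `]0, T]) G r w) _ _ _ hn.
- exact: (L1_measurable D1).
- by move=> w; apply: Rintegral_ge0 => r _; exact: sqr_ge0.
move=> w; transitivity (\int[mu]_(r in `[0%R, T]) (G r w)%:E)%E.
  (* The closed interval of [ito_integral] and the half-open one used here differ by a null set. *)
  have h := Dint w; rewrite -integral_itv_obnd_cbnd; last exact: (measurable_int _ h).
  by rewrite fineK//; exact: (integrable_fin_num _ h).
apply: eq_integral => r /set_mem/=; rewrite in_itv/= => /andP[r0 rT].
by rewrite real_normK ?num_real// /G Lv clampT_id.
Unshelve. all: by end_near. Qed.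

End ItoIntegral.

(** * Laws and the Wasserstein distance *)

Section Laws.
Context {R : realType} {d : measure_display} {Omega : measurableType d}.
Variable P : probability Omega R.

Lemma integral_law (U : Omega -> R) (m : probability (measurableTypeR R) R) (f : R -> \bar R) :
  measurable_fun setT U -> (forall A : set R, measurable A -> m A = P (U @^-1` A)) ->
  measurable_fun setT f -> (forall y, 0 <= f y)%E ->
  (\int[m]_y f y = \int[P]_w f (U w))%E.
Proof.
move=> mU mE mf f0.
have mU' : @measurable_fun _ _ Omega (measurableTypeR R) setT U by exact: mU.
pose W : {mfun Omega >-> measurableTypeR R} := @mfun_Sub _ _ Omega (measurableTypeR R) _ (mem_set mU').
transitivity (\int[distribution P W]_y f y)%E.
  by apply: eq_measure_integral => A mA _; exact: mE.
rewrite ge0_integral_pushforward//.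
Qed.

(** The joint law of [(U, V)] is a coupling, and its cost is the right-hand side. *)
Lemma wasserstein1_le (U V : Omega -> R) (m n : probability (measurableTypeR R) R) :
  measurable_fun setT U -> measurable_fun setT V -> L1 P (fun w => U w - V w) ->
  (forall A : set R, measurable A -> m A = P (U @^-1` A)) ->
  (forall A : set R, measurable A -> n A = P (V @^-1` A)) ->
  (wasserstein 1 m n <= (Ex P (fun w => `|U w - V w|))%:E)%E.
Proof.
move=> mU mV UV mE nE.
have mUV : @measurable_fun _ _ Omega (measurableTypeR R * measurableTypeR R)%type setT (fun w => (U w, V w)).
  exact: measurable_fun_pair.
pose W : {mfun Omega >-> (measurableTypeR R * measurableTypeR R)%type} := @mfun_Sub _ _ Omega (measurableTypeR R * measurableTypeR R)%type _ (mem_set mUV).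
have WE w : W w = (U w, V w) by [].
apply: ereal_inf_lbound; exists (distribution P W : probability _ _).
  move=> A mA; rewrite /distribution /pushforward mE// nE//; split; congr (P _).
    by apply/seteqP; split=> w /= => [[]|].
  by apply/seteqP; split=> w /= => [[]|].
rewrite invr1 poweRe1; last by apply: integral_ge0.
rewrite ge0_integral_pushforward//=.
  rewrite ExE; last exact: L1_norm.
  by under eq_integral do rewrite powRr1//.
have : measurable_fun setT (fun z : measurableTypeR R * measurableTypeR R => `|z.1 - z.2| `^ 1).
  under eq_fun do rewrite powRr1//.
  apply: (measurableT_comp (f := fun y : R => `|y|)); first exact: normr_measurable.
  exact: measurable_funB.
by move=> h; apply/measurable_EFinP.
Qed.

Lemma L2_finite_moment2 (U : Omega -> R) (m : probability (measurableTypeR R) R) : L2 P U ->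
  (forall A : set R, measurable A -> m A = P (U @^-1` A)) -> finite_moment 2 m.
Proof.
move=> [mU LU] mE; rewrite /finite_moment.
have mp : measurable_fun setT (fun y : R => (`|y| `^ 2)%:E).
  apply/measurable_EFinP; under eq_fun do rewrite -[2]/(2%:R) powR_mulrn//.
  by apply: measurable_funX; exact: normr_measurable.
rewrite (integral_law mU mE mp) => [|y]; last by rewrite lee_fin powR_ge0.
have /integrableP[_] := LU; congr (_ < +oo)%E; apply: eq_integral => w _.
by rewrite -[2 in RHS]/(2%:R) powR_mulrn//= ger0_norm ?sqr_ge0// real_normK// num_real.
Qed.

End Laws.

(** * A priori estimates for one solution *)

Section Solution.
Context {R : realType} {T : R} {d : measure_display} {Omega : measurableType d}.
Variables (P : probability Omega R) (F : R -> set (set Omega)).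
Variable B : R -> Omega -> R.
Hypotheses (filF : filtration T F) (bmB : brownian_motion T P F B).
Hypothesis T0 : 0 <= T.
Notation mu := (@lebesgue_measure R).
Notation ito_class := (@ito_class R T d Omega P F B).
Variables (x M : R) (b : R -> R -> Pspace (1 : R) -> R) (sigma : R -> R -> R).
Hypothesis M0 : 0 <= M.
Hypothesis mb : measurable_fun (`[0, T] `*` [set: R] `*` [set: Pspace (1 : R)])
  (fun z : R * R * Pspace (1 : R) => b z.1.1 z.1.2 z.2).
Hypothesis msigma : measurable_fun (`[0, T] `*` [set: R]) (fun z : R * R => sigma z.1 z.2).
Hypothesis bM : forall t y (m : Pspace (1 : R)), t \in `[0, T] -> `|b t y m| <= M.
Hypothesis sigmaM : forall t y, t \in `[0, T] -> `|sigma t y| <= M.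
Variables (X I : R -> Omega -> R) (law : R -> Pspace (1 : R)).
Hypotheses (adX : adapted T F X) (cX : continuous_process T X).
Hypothesis lawE : forall t, t \in `[0, T] -> forall A : set R, measurable A ->
  Pspace_law (law t) A = P (X t @^-1` A).
Hypothesis itoI : ito_integral T P F B (fun s w => sigma s (X s w)) I.
Hypothesis solX : {ae P, forall w, forall t, t \in `[0, T] ->
  X t w = x + (\int[mu]_(s in `[0, t]) b s (X s w) (law s)) + I t w}.

Notation cl := (clamp 0 T).

Lemma solution_measurable t : 0 <= t -> t <= T -> measurable_fun setT (X t).
Proof.
by move=> t0 tT; apply: (filtration_measurable filF t0 tT); apply: adX; rewrite in_itv/= t0.
Qed.

Lemma solution_diffusion_measurable :
  measurable_fun setT (fun z : R * Omega => sigma (cl z.1) (X (cl z.1) z.2)).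
Proof.
apply: (measurable_comp (F := `[0, T]%classic `*` [set: R]) (f := fun z : R * R => sigma z.1 z.2)
  (g := fun z : R * Omega => (cl z.1, X (cl z.1) z.2))) => //.
- by apply: measurableX => //; exact: measurable_itv.
- by move=> _ [z _ <-]; split=> //=; exact: clampT_in.
apply: measurable_fun_pair; last exact: (jointly_measurable_process T0 cX solution_measurable).
apply: measurableT_comp => //.
by apply: continuous_measurable_fun; exact: continuous_clampT.
Qed.

Lemma solution_ito_class : ito_class (fun r w => sigma (cl r) (X (cl r) w)) I.
Proof.
apply: (ito_integral_ito_class filF bmB T0 (H := fun s w => sigma s (X s w)) _ _ itoI).
  exact: solution_diffusion_measurable.
by exists M => r w r0 rT; apply: sigmaM; rewrite in_itv/= r0.
Qed.

Lemma solution_drift_bound : {ae P, forall w, forall t, 0 <= t -> t <= T ->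
  `|X t w - I t w| <= `|x| + M * T}.
Proof.
apply: filterS solX => w hw t t0 tT; rewrite hw ?in_itv/= ?t0//.
rewrite addrK (le_trans (ler_normD _ _))// lerD2l.
apply: (@le_trans _ _ (M * (t - 0))); last by rewrite subr0 ler_wpM2l.
have mD : @measurable _ (measurableTypeR R) `[0, t]%classic by exact: measurable_itv.
apply: (norm_Rintegral_le_bound mD M0).
  apply: (eq_trans (lebesgue_measure_itv `[0, t])); rewrite /= lte_fin.
  by case: (ltP 0 t) => [_|t0']; [|rewrite (_ : t = 0) ?subrr//; apply/le_anti/andP].
move=> r; rewrite /= in_itv/= => /andP[r0 rt]; apply: bM.
by rewrite in_itv/= r0 (le_trans rt).
Qed.

(** The drift part is bounded almost surely and the Ito part is in L2. *)
Lemma solution_L2 t : 0 <= t -> t <= T -> L2 P (X t).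
Proof.
move=> t0 tT; have [_ _ h _] := solution_ito_class; have It := h t t0 tT.
have mXI : measurable_fun setT (fun w => X t w - I t w).
  by apply: measurable_funB; [exact: solution_measurable|exact: L2_measurable It].
suff XI : L2 P (fun w => X t w - I t w).
  by have := L2D XI It; under eq_fun do rewrite subrK.
have h2 : {ae P, forall w, `|(X t w - I t w) ^+ 2| <= (`|x| + M * T) ^+ 2}.
  apply: filterS solution_drift_bound => w hw.
  by rewrite normrX lerXn2r ?nnegrE ?hw// addr_ge0// mulr_ge0.
split=> //; apply: L1P; first exact: measurable_funX.
apply: (@le_lt_trans _ _ (\int[P]_w ((`|x| + M * T) ^+ 2)%:E)%E); last first.
  by rewrite integral_cst// [X in (_ * X)%E](probability_setT P) mule1 ltry.
apply: ae_ge0_le_integral => //.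
- by apply/measurable_EFinP; apply: measurableT_comp; [exact: normr_measurable|exact: measurable_funX].
- by move=> w _; rewrite lee_fin sqr_ge0.
- by apply: filterS h2 => w hw _; rewrite lee_fin.
Qed.

Lemma solution_finite_moment2 t : 0 <= t -> t <= T -> finite_moment 2 (Pspace_law (law t)).
Proof.
move=> t0 tT; apply: (L2_finite_moment2 (solution_L2 t0 tT)).
by apply: lawE; rewrite in_itv/= t0.
Qed.

Let clL2 t : L2 P (X (cl t)).
Proof. by apply: solution_L2; [exact: clampT_ge0|exact: clampT_le]. Qed.

Let IL2 t : L2 P (I (cl t)).
Proof.
by have [_ _ h _] := solution_ito_class; apply: h; [exact: clampT_ge0|exact: clampT_le].
Qed.

Let ito_incr_le s t : 0 <= s -> s <= T -> 0 <= t -> t <= T ->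
  Ex P (fun w => (I s w - I t w) ^+ 2) <= 4 * (M ^+ 2 * `|s - t|).
Proof.
wlog st : s t / t <= s.
  move=> h s0 sT t0 tT; have [ts|/ltW st] := leP t s; first exact: h.
  have := h _ _ st t0 tT s0 sT; rewrite distrC; apply: le_trans.
  by rewrite le_eqVlt; apply/orP; left; apply/eqP/eq_Ex => w; ring.
move=> s0 sT t0 tT; rewrite ger0_norm ?subr_ge0//.
apply: (ito_class_incr_sqr_le filF bmB T0 solution_ito_class) => // r w.
by rewrite -real_normK ?num_real// lerXn2r ?nnegrE//; apply: sigmaM; exact: clampT_in.
Qed.

Let ito_incr_small t e : 0 < e -> \forall s \near t,
  Ex P (fun w => `|I (cl s) w - I (cl t) w|) <= e.
Proof.
(* Used with [z = e / 2] and [N = M ^ 2]: at time distance at most [z^2 / (4 N + 1)] the mean square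
   is at most [z^2]. *)
have aux (z q D N : R) : 0 < z -> 0 <= N -> D <= z ^+ 2 / (4 * N + 1) -> q <= 4 * (N * D)
  -> z + z^-1 * q <= z + z.
  move=> z0 N0 hD hq; rewrite lerD2l mulrC ler_pdivrMr//; apply: (le_trans hq).
  rewrite mulrA; apply: (@le_trans _ _ (4 * N * (z ^+ 2 / (4 * N + 1)))).
    by rewrite ler_wpM2l// mulr_ge0.
  rewrite mulrCA -expr2 ler_piMr ?sqr_ge0// ler_pdivrMr; lra.
move=> e0; have e20 : 0 < e / 2 by rewrite divr_gt0.
have d0 : 0 < (e / 2) ^+ 2 / (4 * M ^+ 2 + 1).
  by rewrite divr_gt0// ?exprn_gt0// ltr_wpDl// mulr_ge0// sqr_ge0.
near=> s; apply: (le_trans (Ex_norm_le_sqr (L2B (IL2 s) (IL2 t)) e20)).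
rewrite [leRHS](splitr e); apply: aux e20 (sqr_ge0 M) _ (ito_incr_le _ _ _ _).
all: rewrite ?clampT_ge0 ?clampT_le//.
apply: (le_trans (clampT_dist T0 _ _)); rewrite distrC.
by near: s; apply: cvgr_dist_le; [exact: cvg_id|].
Unshelve. all: by end_near. Qed.

Let A s w := X (cl s) w - I (cl s) w.

(** Splitting the drift integral at an intermediate time would require its integrability, not known
    at this stage; dominated convergence along the continuous paths of [X - I] is used instead. *)
Let drift_incr_small t e : 0 < e -> \forall s \near t,
  Ex P (fun w => `|A s w - A t w|) <= e.
Proof.
have mA s : measurable_fun setT (A s) by apply: L2_measurable; exact: L2B.
have K0 : 0 <= `|x| + M * T by rewrite addr_ge0// mulr_ge0.
have AK s : {ae P, forall w, setT w -> `|(`|A s w - A t w|)| <= 2 * (`|x| + M * T)}.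
  apply: filterS solution_drift_bound => w hw _; rewrite normr_id.
  rewrite (le_trans (ler_normB _ _))// mulr_natl mulr2n.
  by apply: lerD; apply: hw; rewrite ?clampT_ge0 ?clampT_le.
have := @continuity_under_integral _ _ _ P (fun s w => `|A s w - A t w|) setT measurableT
  (t - 1) (t + 1) _ _ (fun=> 2 * (`|x| + M * T)) _ (fun s _ => AK s).
have AL s : L1 P (fun w => `|A s w - A t w|).
  by apply: L1_norm; apply: L2_L1; apply: L2B; apply: L2B.
have cA w : continuous (A ^~ w).
  have [_ _ _ cI _] := itoI => r.
  by apply: cvgB; exact: continuous_process_clampT.
move=> /(_ _ _ _ t)h e0.
have {}h : {for t, continuous (fun s => Ex P (fun w => `|A s w - A t w|))}.
  apply: h; first by move=> s _; exact: AL.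
  - apply: aeW => w _ r _; apply: cvg_norm.
    by apply: cvgB; [exact: cA|exact: cvg_cst].
  - exact: (L1_cst P).
  - by rewrite inE/= in_itv/=; apply/andP; split; lra.
have : \forall s \near t, `|Ex P (fun w => `|A t w - A t w|) - Ex P (fun w => `|A s w - A t w|)| <= e.
  by move/cvgrPdist_le: h; apply.
apply: filterS => s; rewrite (_ : Ex P (fun w => `|A t w - A t w|) = 0).
  by rewrite sub0r normrN; apply: le_trans; exact: ler_norm.
by rewrite -[RHS](Ex_cst P 0); apply: eq_Ex => w; rewrite subrr normr0.
Qed.

Lemma solution_Ex_continuous t e : 0 < e -> \forall s \near t,
  Ex P (fun w => `|X (cl s) w - X (cl t) w|) <= e.
Proof.
move=> e0; have e20 : 0 < e / 2 by rewrite divr_gt0.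
apply: filterS2 (ito_incr_small t e20) (drift_incr_small t e20) => s hI hA.
have LA : L1 P (fun w => `|A s w - A t w|).
  by apply: L1_norm; apply: L2_L1; apply: L2B; apply: L2B.
have LI : L1 P (fun w => `|I (cl s) w - I (cl t) w|).
  by apply: L1_norm; apply: L2_L1; apply: L2B.
rewrite (splitr e); apply: le_trans (lerD hA hI); rewrite -ExD//.
apply: Ex_le; [by apply: L1_norm; apply: L2_L1; apply: L2B|exact: L1D|].
move=> w; apply: le_trans (ler_normD _ _); rewrite le_eqVlt; apply/orP; left.
by apply/eqP; congr (`|_|); rewrite /A; ring.
Qed.

(** The [wasserstein_open] sets generate the sigma-algebra, and their preimages are open: at nearby
    times the positions are close in mean, hence their laws are close in [W_1]. *)
Lemma law_clamp_measurable : measurable_fun setT (fun r => law (cl r)).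
Proof.
apply: (measurability (@wasserstein_open R 1)) => //.
move=> _ [U oU <-]; rewrite setTI.
apply: open_measurable; rewrite openE => t /= Ut.
have [e e0 he] := oU _ Ut.
have e20 : 0 < e / 2 by rewrite divr_gt0.
apply: filterS (solution_Ex_continuous t e20) => s hs; apply: he.
apply: le_lt_trans (wasserstein1_le (P := P) (U := X (cl t)) (V := X (cl s)) _ _ _ _ _) _.
- exact: L2_measurable.
- exact: L2_measurable.
- by apply: L2_L1; exact: L2B.
- by apply: lawE; exact: clampT_in.
- by apply: lawE; exact: clampT_in.
rewrite lte_fin (@le_lt_trans _ _ (e / 2))//; last lra.
by under eq_Ex do rewrite distrC.
Qed.

Lemma solution_drift_measurable w :
  measurable_fun setT (fun r => b (cl r) (X (cl r) w) (law (cl r))).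
Proof.
apply: (measurable_comp (F := `[0, T]%classic `*` [set: R] `*` [set: Pspace (1 : R)])
  (f := fun z : R * R * Pspace (1 : R) => b z.1.1 z.1.2 z.2)
  (g := fun r : R => (cl r, X (cl r) w, law (cl r)))) => //.
- by do 2!apply: measurableX => //; exact: measurable_itv.
- by move=> _ [r _ <-]; split=> //=; split=> //=; exact: clampT_in.
have mc : measurable_fun setT cl by apply: continuous_measurable_fun; exact: continuous_clampT.
apply: measurable_fun_pair; last exact: law_clamp_measurable.
apply: measurable_fun_pair => //.
by apply: continuous_measurable_fun; exact: continuous_process_clampT.
Qed.

Let drift r w := b (cl r) (X (cl r) w) (law (cl r)).

Lemma solution_drift_integrable w s t : s <= t ->
  mu.-integrable (`]s, t] : set R) (EFin \o (drift ^~ w)).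
Proof.
move=> st; apply: (bounded_itv_integrable st (solution_drift_measurable w) (K := M)).
by move=> r; apply: bM; exact: clampT_in.
Qed.

(** With the drift now measurable in time, its integral may be split. The null set is that of the
    equation, hence common to all [s] and [t]. *)
Lemma solution_increment : {ae P, forall w, forall s t, 0 <= s -> s <= t -> t <= T ->
  X t w - X s w - (I t w - I s w) = \int[mu]_(r in `]s, t]) drift r w}.
Proof.
have hX w t : 0 <= t -> t <= T ->
    \int[mu]_(r in `[0, t]) b r (X r w) (law r) = \int[mu]_(r in `]0, t]) drift r w.
  move=> t0 tT; rewrite /Rintegral; congr fine.
  transitivity (\int[mu]_(r in `[0%R, t]) (drift r w)%:E)%E; last first.
    rewrite -integral_itv_obnd_cbnd//.
    exact: (measurable_int _ (solution_drift_integrable w t0)).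
  apply: eq_integral => r /set_mem/=; rewrite in_itv/= => /andP[r0 rt].
  by rewrite /drift clampT_id// (le_trans rt).
apply: filterS solX => w hw s t s0 st tT.
have t0 := le_trans s0 st; have sT := le_trans st tT.
rewrite (hw t) ?in_itv/= ?t0// (hw s) ?in_itv/= ?s0// !hX//.
by rewrite (Rintegral_itv_cat s0 st (solution_drift_integrable w t0)); ring.
Qed.

End Solution.

(** * Moduli of continuity *)

Section Convexity.
Context {R : realType}.
Implicit Types f kappa : R -> R.

Lemma convex0_le_scale f l u : convex_function (`[0, +oo[%classic : set R) f ->
  f 0 = 0 -> 0 <= l -> l <= 1 -> 0 <= u -> f (l * u) <= l * f u.
Proof.
move=> cf f0 l0 l1 u0.
have := cf (Itv01 l0 l1) u 0; rewrite !inE/= !in_itv/= u0 lexx => /(_ isT isT).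
by rewrite [X in f X]convRE [in leRHS]convRE/= f0 !mulr0 !addr0.
Qed.

Lemma modulus_gt0 kappa u : strictly_increasing_on_nneg kappa -> kappa 0 = 0 ->
  0 < u -> 0 < kappa u.
Proof. by move=> inc k0 u0; rewrite -k0; exact: inc. Qed.

Lemma modulus_mono kappa u v : strictly_increasing_on_nneg kappa ->
  0 <= u -> u <= v -> kappa u <= kappa v.
Proof. by move=> inc u0; rewrite le_eqVlt => /orP[/eqP->//|uv]; apply/ltW/inc. Qed.

Lemma concave0_scale_le kappa l u : convex_function (`[0, +oo[%classic : set R) (fun u => - kappa u) ->
  kappa 0 = 0 -> 0 <= l -> l <= 1 -> 0 <= u -> l * kappa u <= kappa (l * u).
Proof.
move=> ck k0 l0 l1 u0; have := convex0_le_scale ck _ l0 l1 u0.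
by rewrite k0 oppr0 mulrN lerN2; apply.
Qed.

(** Up to [u0] monotonicity suffices; beyond it, concavity and [kappa 0 = 0] make [kappa u / u]
    nonincreasing. *)
Lemma concave0_le_affine kappa u0 u : convex_function (`[0, +oo[%classic : set R) (fun u => - kappa u) ->
  strictly_increasing_on_nneg kappa -> kappa 0 = 0 -> 0 < u0 -> 0 <= u ->
  kappa u <= kappa u0 * (1 + u / u0).
Proof.
move=> ck inc k0 u0p up; have ku0 := modulus_gt0 inc k0 u0p.
have [uu|uu] := leP u u0.
  apply: (le_trans (modulus_mono inc up uu)); rewrite ler_peMr ?(ltW ku0)// lerDl.
  by rewrite divr_ge0// ltW.
have u1 : 0 < u by exact: lt_trans uu.
have := concave0_scale_le ck k0 (_ : 0 <= u0 / u) (_ : u0 / u <= 1) up.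
rewrite divfK ?gt_eqF// divr_ge0 ?(ltW u0p)// ler_pdivrMr// mul1r (ltW uu) => /(_ isT isT) h.
apply: (@le_trans _ _ (kappa u0 * (u / u0))); last by rewrite ler_wpM2l ?(ltW ku0)// lerDr.
rewrite (_ : kappa u = u0 / u * kappa u * (u / u0)).
  by rewrite ler_wpM2r// divr_ge0// ltW.
by field; rewrite !gt_eqF.
Qed.

(** Convexity puts [rho ^ 2] below its chord on [[0, 1]]; beyond 1 the bound [2 M] on [v] takes
    over. *)
Lemma sqr_modulus_le_linear (rho : R -> R) (M u v : R) : strictly_increasing_on_nneg rho ->
  rho 0 = 0 -> convex_function (`[0, +oo[%classic : set R) (fun u => rho u ^+ 2) ->
  `|v| <= rho `|u| -> `|v| <= 2 * M -> v ^+ 2 <= (rho 1 ^+ 2 + 4 * M ^+ 2) * `|u|.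
Proof.
move=> inc r0 cr vu vM; have v2 : v ^+ 2 = `|v| ^+ 2 by rewrite real_normK// num_real.
have M0 : 0 <= M by have := normr_ge0 v; lra.
have [u1|u1] := leP `|u| 1.
  have := convex0_le_scale cr _ (normr_ge0 u) u1 ler01; rewrite r0 mulr1 expr0n => /(_ erefl) h.
  have h2 : v ^+ 2 <= rho `|u| ^+ 2.
    by rewrite v2 lerXn2r ?nnegrE ?(le_trans _ vu).
  have := sqr_ge0 M; have := normr_ge0 u; nra.
have : v ^+ 2 <= 4 * M ^+ 2.
  rewrite v2 (_ : 4 * M ^+ 2 = (2 * M) ^+ 2); last by ring.
  by rewrite lerXn2r ?nnegrE// mulr_ge0.
have := sqr_ge0 (rho 1); have := sqr_ge0 M; nra.
Qed.

End Convexity.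

(** Nonnegativity replaces the uniform bound of [measurable_Ex_time], which is not at hand for the
    process [|Y|] below. *)
Lemma measurable_Ex_time_ge0 (R : realType) (d : measure_display)
  (Omega : measurableType d) (P : probability Omega R) (G : R -> Omega -> R) :
  measurable_fun setT (fun z : R * Omega => G z.1 z.2) ->
  (forall r w, 0 <= G r w) -> measurable_fun setT (fun r => Ex P (G r)).
Proof.
move=> mG G0.
have mG' : measurable_fun setT (fun z : R * Omega => (G z.1 z.2)%:E).
  exact/measurable_EFinP.
have G0' (z : R * Omega) : (0 <= (G z.1 z.2)%:E)%E by rewrite lee_fin.
exact: (measurableT_comp (fine_measurable measurableT)
  (measurable_fun_fubini_tonelli_F (m2 := P) _ mG' G0')).
Qed.

(** * Comparison of two solutions *)

Section Uniqueness.
Context {R : realType} {T : R} {d : measure_display} {Omega : measurableType d}.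
Variables (P : probability Omega R) (F : R -> set (set Omega)).
Variable B : R -> Omega -> R.
Hypotheses (filF : filtration T F) (bmB : brownian_motion T P F B).
Hypothesis T0 : 0 <= T.
Notation mu := (@lebesgue_measure R).
Variables (x M C : R) (b : R -> R -> Pspace (1 : R) -> R) (sigma : R -> R -> R).
Variables rho kappa : R -> R.
Hypothesis M0 : 0 <= M.
Hypothesis mb : measurable_fun (`[0, T] `*` [set: R] `*` [set: Pspace (1 : R)])
  (fun z : R * R * Pspace (1 : R) => b z.1.1 z.1.2 z.2).
Hypothesis msigma : measurable_fun (`[0, T] `*` [set: R]) (fun z : R * R => sigma z.1 z.2).
Hypothesis bM : forall t y (m : Pspace (1 : R)), t \in `[0, T] -> `|b t y m| <= M.
Hypothesis sigmaM : forall t y, t \in `[0, T] -> `|sigma t y| <= M.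
Hypothesis C0 : 0 < C.
Hypothesis bC : forall t y (m n : Pspace (1 : R)), t \in `[0, T] ->
  ((`|b t y m - b t y n|)%:E <= C%:E * wasserstein 1 (Pspace_law m) (Pspace_law n))%E.
Hypotheses (rho_inc : strictly_increasing_on_nneg rho) (rho0 : rho 0 = 0)
  (rho_convex : convex_function (`[0, +oo[%classic : set R) (fun u : R => rho u ^+ 2))
  (sigma_rho : forall t y z, t \in `[0, T] -> `|sigma t y - sigma t z| <= rho `|y - z|).
Hypotheses (kappa_inc : strictly_increasing_on_nneg kappa) (kappa0 : kappa 0 = 0)
  (kappa_concave : convex_function (`[0, +oo[%classic : set R) (fun u : R => - kappa u))
  (kappa_diverges : diverges_at_0 (fun u : R => (kappa u)^-1))
  (b_kappa : forall t y z (m : Pspace (1 : R)), t \in `[0, T] ->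
    finite_moment 2 (Pspace_law m) -> `|b t y m - b t z m| <= kappa `|y - z|).
Variables (X1 X2 I1 I2 : R -> Omega -> R) (law1 law2 : R -> Pspace (1 : R)).
Hypotheses (adX1 : adapted T F X1) (cX1 : continuous_process T X1)
  (adX2 : adapted T F X2) (cX2 : continuous_process T X2).
Hypothesis lawE1 : forall t, t \in `[0, T] -> forall A : set R, measurable A ->
  Pspace_law (law1 t) A = P (X1 t @^-1` A).
Hypothesis lawE2 : forall t, t \in `[0, T] -> forall A : set R, measurable A ->
  Pspace_law (law2 t) A = P (X2 t @^-1` A).
Hypothesis itoI1 : ito_integral T P F B (fun s w => sigma s (X1 s w)) I1.
Hypothesis itoI2 : ito_integral T P F B (fun s w => sigma s (X2 s w)) I2.
Hypothesis solX1 : {ae P, forall w, forall t, t \in `[0, T] ->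
  X1 t w = x + (\int[mu]_(s in `[0, t]) b s (X1 s w) (law1 s)) + I1 t w}.
Hypothesis solX2 : {ae P, forall w, forall t, t \in `[0, T] ->
  X2 t w = x + (\int[mu]_(s in `[0, t]) b s (X2 s w) (law2 s)) + I2 t w}.
Hypotheses (start1 : {ae P, forall w, X1 0 w = x}) (start2 : {ae P, forall w, X2 0 w = x}).

Notation cl := (clamp 0 T).

Let cl0 r : 0 <= cl r. Proof. exact: clampT_ge0. Qed.
Let clT r : cl r <= T. Proof. exact: clampT_le. Qed.
Let clin r : cl r \in `[0, T]. Proof. exact: clampT_in. Qed.

Let Y r w := X1 (cl r) w - X2 (cl r) w.
Let H r w := sigma (cl r) (X1 (cl r) w) - sigma (cl r) (X2 (cl r) w).
Let J r w := I1 r w - I2 r w.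
Let g r := Ex P (fun w => `|Y r w|).
(** An extension of [kappa] that is monotone, hence measurable, on the whole line. *)
Let kappap u := kappa (Num.max 0 u).
(** Dominates the distance between the two drifts. Drifts bounded by [M] differ by at most [2 * M];
    this cut makes [q] bounded whatever the growth of [kappa]. *)
Let q r w := Num.min (2 * M) (kappap `|Y r w| + C * g r).
(** The factor 2 is the mean of [1 + |Y r| / g r], from the affine bound on the concave [kappa]. *)
Let theta u := 2 * kappa u + C * u.

Let mX1 := solution_measurable filF adX1.
Let mX2 := solution_measurable filF adX2.
Let X1L2 := solution_L2 filF bmB T0 M0 msigma bM sigmaM adX1 cX1 itoI1 solX1.
Let X2L2 := solution_L2 filF bmB T0 M0 msigma bM sigmaM adX2 cX2 itoI2 solX2.

Let YL2 r : L2 P (Y r). Proof. by apply: L2B; [exact: X1L2|exact: X2L2]. Qed.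

Let mY : measurable_fun setT (fun z : R * Omega => Y z.1 z.2).
Proof. by apply: measurable_funB; exact: jointly_measurable_process. Qed.

Let g0 r : 0 <= g r. Proof. by apply: Ex_ge0 => w. Qed.

Let gcl r : g (cl r) = g r.
Proof. by apply: eq_Ex => w; rewrite /Y clampT_id. Qed.

Let mg : measurable_fun setT g.
Proof.
apply: (@measurable_Ex_time_ge0 _ _ _ P (fun r w => `|Y r w|)) => //.
by apply: measurableT_comp => //; exact: normr_measurable.
Qed.

Let kappa_ge0 u : 0 <= u -> 0 <= kappa u.
Proof. by move=> u0; rewrite -kappa0; exact: modulus_mono. Qed.

Let kappap_norm (u : R) : kappap `|u| = kappa `|u|.
Proof. by rewrite /kappap max_r. Qed.

Let mkappap : measurable_fun setT kappap.
Proof.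
apply: nondecreasing_measurable => // u v uv; rewrite /kappap; apply: (modulus_mono kappa_inc).
  by rewrite le_max lexx.
by rewrite ge_max !le_max lexx uv orbT.
Qed.

Let mq : measurable_fun setT (fun z : R * Omega => q z.1 z.2).
Proof.
apply: measurable_minr => //; apply: measurable_funD.
  apply: (measurableT_comp mkappap); apply: measurableT_comp => //; exact: normr_measurable.
by apply: measurable_funM => //; exact: (measurableT_comp mg).
Qed.

Let qQ r w : 0 <= q r w <= 2 * M.
Proof.
rewrite /q ge_min lexx le_min mulr_ge0//=.
by rewrite andbT addr_ge0// ?mulr_ge0 ?(ltW C0)// kappap_norm kappa_ge0.
Qed.

Let HJ : @ito_class R T d Omega P F B H J.
Proof.
have h1 := solution_ito_class filF bmB T0 msigma sigmaM adX1 cX1 itoI1.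
have h2 := solution_ito_class filF bmB T0 msigma sigmaM adX2 cX2 itoI2.
exact: (ito_classB filF bmB T0 h1 h2).
Qed.

Let HY r w : H r w ^+ 2 <= (rho 1 ^+ 2 + 4 * M ^+ 2) * `|Y r w|.
Proof.
apply: sqr_modulus_le_linear => //; first exact: sigma_rho.
rewrite (le_trans (ler_normB _ _))// mulr_natl mulr2n.
by apply: lerD; exact: sigmaM.
Qed.

Let drift_gap r w : `|b (cl r) (X1 (cl r) w) (law1 (cl r)) - b (cl r) (X2 (cl r) w)
  (law2 (cl r))| <= q r w.
Proof.
rewrite /q le_min; apply/andP; split.
  rewrite (le_trans (ler_normB _ _))// mulr_natl mulr2n.
  by apply: lerD; exact: bM.
(* The intermediate drift pairs the second position with the first law, so that [kappa] is applied
   at a law known to have a second moment. *)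
rewrite -(subrKA (b (cl r) (X2 (cl r) w) (law1 (cl r)))).
rewrite (le_trans (ler_normD _ _))// kappap_norm; apply: lerD.
  apply: b_kappa => //; exact: (solution_finite_moment2 filF bmB T0 M0 msigma bM sigmaM adX1 cX1 lawE1 itoI1 solX1).
rewrite -lee_fin; apply: (le_trans (bC _ _ _ (clin r))); rewrite EFinM.
apply: lee_wpmul2l; first by rewrite lee_fin ltW.
apply: wasserstein1_le; [exact: mX1|exact: mX2|exact: L2_L1 (YL2 r)|exact: lawE1|exact: lawE2].
Qed.

Let Yq s t : 0 <= s -> s <= t -> t <= T -> {ae P, forall w,
  `|Y t w - Y s w - (J t w - J s w)| <= \int[mu]_(r in `]s, t]) q r w}.
Proof.
move=> s0 st tT; have t0 := le_trans s0 st; have sT := le_trans st tT.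
have h1 := solution_increment filF bmB T0 M0 mb msigma bM sigmaM adX1 cX1 lawE1 itoI1 solX1.
have h2 := solution_increment filF bmB T0 M0 mb msigma bM sigmaM adX2 cX2 lawE2 itoI2 solX2.
apply: filterS2 h1 h2 => w /(_ s t s0 st tT) e1 /(_ s t s0 st tT) e2.
rewrite /Y /J !clampT_id//.
rewrite (_ : _ - _ = X1 t w - X1 s w - (I1 t w - I1 s w) - (X2 t w - X2 s w - (I2 t w - I2 s w)));
  last by ring.
rewrite e1 e2.
have mD : @measurable _ (measurableTypeR R) `]s, t]%classic by exact: measurable_itv.
have i1 := solution_drift_integrable filF bmB T0 M0 mb msigma bM sigmaM adX1 cX1 lawE1 itoI1 solX1 w st.
have i2 := solution_drift_integrable filF bmB T0 M0 mb msigma bM sigmaM adX2 cX2 lawE2 itoI2 solX2 w st.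
rewrite -RintegralB//.
have iB := integrableB mD i1 i2.
apply: le_trans (le_normr_Rintegral mD iB) _.
apply: le_Rintegral => //.
- exact: integrable_norm iB.
- apply: (@bounded_time_integrable _ _ _ _ (2 * M) mq _ _ _ st w) => r w'.
  by have /andP[q0 qM] := qQ r w'; rewrite ger0_norm.
Qed.

Let qL r : L1 P (q r).
Proof.
apply: (@L1_bounded _ _ _ _ _ (2 * M)); first exact: (jointly_measurable_space mq r).
by move=> w; have /andP[q0 qM] := qQ r w; rewrite ger0_norm.
Qed.

Let Ex_q_le r : Ex P (q r) <= theta (g r).
Proof.
have YL := L1_norm (L2_L1 (YL2 r)).
(* The affine bound needs a positive base point; if [g r = 0], then [Y r] vanishes almost everywhere
   and [q r] with it. *)
have [gr0|gr0] := eqVneq (g r) 0.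
  rewrite gr0 /theta kappa0 !mulr0 addr0 -[leRHS](Ex_cst P).
  apply: Ex_ae_le => //; first exact: L1_cst.
  apply: filterS (Ex_eq0_ae (L2_L1 (YL2 r)) gr0) => w Yw.
  by rewrite /q gr0 mulr0 addr0 kappap_norm Yw normr0 kappa0 ge_min lexx orbT.
have gp : 0 < g r by rewrite lt0r gr0 g0.
pose k := kappa (g r).
have LR : L1 P (fun w => (k + C * g r) + k / g r * `|Y r w|).
  by apply: L1D; [exact: L1_cst|exact: L1Z].
apply: (@le_trans _ _ (Ex P (fun w => (k + C * g r) + k / g r * `|Y r w|))); last first.
  rewrite ExD; [|exact: L1_cst|exact: L1Z]; rewrite Ex_cst ExZ// -/(g r) divfK//.
  by rewrite /theta -/k; lra.
apply: Ex_le => // w; rewrite /q ge_min; apply/orP; right.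
have := concave0_le_affine kappa_concave kappa_inc kappa0 gp (normr_ge0 (Y r w)).
rewrite kappap_norm -/k mulrDr mulr1 mulrA [k * _ / _]mulrAC; lra.
Qed.

Let Y00 : Ex P (fun w => `|Y 0 w|) = 0.
Proof.
apply/le_anti/andP; split; last exact: g0.
rewrite -[leRHS](Ex_cst P); apply: Ex_ae_le; [exact: L1_norm (L2_L1 (YL2 0))|exact: L1_cst|].
apply: filterS2 start1 start2 => w h1 h2.
by rewrite /Y clampT_id// h1 h2 subrr normr0.
Qed.

Let g_le t : 0 <= t -> t <= T -> g t <= \int[mu]_(r in `]0, t]) Ex P (q r).
Proof.
move=> t0 tT; apply: (Ex_norm_le_drift filF bmB T0 (c := rho 1 ^+ 2 + 4 * M ^+ 2)
  (H2 := (2 * M) ^+ 2) _ _ mY HJ _ _ mq qQ Yq _ Y00 t0 tT).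
- move=> s s0 sT; rewrite /Y clampT_id//.
  by apply: (measurable_wrtB (filtration_sigma_algebra filF s0 sT)); [apply: adX1|apply: adX2];
    rewrite in_itv/= s0.
- by move=> s _ _; exact: L2_L1.
- by apply: addr_ge0; [exact: sqr_ge0|apply: mulr_ge0 => //; exact: sqr_ge0].
- by move=> r w _ _; exact: HY.
- move=> r w; rewrite -real_normK ?num_real// lerXn2r ?nnegrE ?mulr_ge0//.
  rewrite (le_trans (ler_normB _ _))// mulr_natl mulr2n.
  by apply: lerD; exact: sigmaM.
Qed.

Let mEq : measurable_fun setT (fun r => Ex P (q r)).
Proof.
apply: (@measurable_Ex_time _ _ _ P q (2 * M)) => // r w.
by have /andP[q0 qM] := qQ r w; rewrite ger0_norm.
Qed.

Let Eq_bound r : `|Ex P (q r)| <= 2 * M.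
Proof.
apply: (norm_Ex_time_le P mq) => r' w.
by have /andP[q0' qM] := qQ r' w; rewrite ger0_norm.
Qed.

Let g_bound r : 0 <= g r <= 2 * M * T.
Proof.
rewrite g0 -gcl (le_trans (g_le (cl0 r) (clT r)))//.
apply: (@le_trans _ _ (2 * M * (cl r - 0))); last first.
  by rewrite subr0 ler_wpM2l// mulr_ge0.
apply: Rintegral_itv_le_cst => //.
  exact: (bounded_itv_integrable _ mEq Eq_bound).
by move=> s _ _; exact: le_trans (ler_norm _) (Eq_bound s).
Qed.

Let theta_mono u v : 0 <= u -> u <= v -> theta u <= theta v.
Proof.
move=> u0 uv; rewrite /theta lerD ?ler_wpM2l ?(ltW C0)//.
exact: modulus_mono.
Qed.

Let g_osgood t : 0 <= t -> t <= T -> g t <= \int[mu]_(r in `]0, t]) theta (g r).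
Proof.
move=> t0 tT; apply: (le_trans (g_le t0 tT)).
have mD : @measurable _ (measurableTypeR R) `]0, t]%classic by exact: measurable_itv.
apply: le_Rintegral => //.
- exact: (bounded_itv_integrable _ mEq Eq_bound).
- apply: (@bounded_itv_integrable _ _ (theta (2 * M * T))) => //.
    have -> : (fun r => theta (g r)) = (fun r => 2 * kappap (g r) + C * g r).
      by apply/funext => r; rewrite /theta /kappap max_r.
    apply: measurable_funD; apply: measurable_funM => //.
    exact: (measurableT_comp mkappap).
  move=> r; have /andP[h1 h2] := g_bound r.
  rewrite ger0_norm ?theta_mono// /theta addr_ge0 ?mulr_ge0 ?kappa_ge0//.
  exact: ltW.
Qed.

Lemma solutions_indistinguishable : indistinguishable T P X1 X2.
Proof.
have k1 : 0 < kappa 1 by exact: modulus_gt0.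
have kC : 0 <= C / kappa 1 by rewrite divr_ge0 ?ltW.
(* By concavity [kappa u >= u * kappa 1] for [0 <= u <= 1], so [C * u] is at most [C / kappa 1]
   times [kappa u]. *)
have D0 : 0 <= 2 + C / kappa 1 by rewrite addr_ge0.
have gz : forall t, 0 <= t -> t <= T -> g t = 0.
  apply: (osgood T0 D0 (kappa := kappa) (theta := theta) (M := 2 * M * T)) => //.
  - by move=> u v; exact: modulus_mono.
  - by move=> u; exact: modulus_gt0.
  - move=> u u0 u1; rewrite /theta [leRHS]mulrDl lerD2l.
    have := concave0_scale_le kappa_concave kappa0 (ltW u0) u1 ler01; rewrite mulr1 => h.
    by rewrite -mulrA ler_pM2l// mulrC ler_pdivlMr.
  - by move=> u u0; rewrite /theta addr_gt0 ?mulr_gt0//; exact: modulus_gt0.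
  (* Doubling the argument at most doubles a concave modulus: scale [2 u] by one half. *)
  - move=> u u0; have h2 : (2^-1 : R) <= 1 by lra.
    have h0 : 0 <= (2^-1 : R) by lra.
    have u20 : 0 <= 2 * u by exact: mulr_ge0.
    have := concave0_scale_le kappa_concave kappa0 h0 h2 u20.
    by rewrite mulKf ?pnatr_eq0// /theta => h; lra.
apply: (indistinguishable_of_pointwise T0) => // t t0 tT.
apply: filterS (Ex_eq0_ae (L2_L1 (YL2 t)) (gz t t0 tT)) => w.
by rewrite /Y clampT_id// => /eqP; rewrite subr_eq0 => /eqP.
Qed.

End Uniqueness.

Unset Implicit Arguments.

Theorem theorem3p3 (R : realType) (T x : R)
  (b : R -> R -> Pspace (1 : R) -> R) (sigma : R -> R -> R)
  (T_gt0 : 0 < T)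
  (b_measurable : measurable_fun (`[0, T] `*` [set: R] `*` [set: Pspace (1 : R)])
     (fun z : R * R * Pspace (1 : R) => b z.1.1 z.1.2 z.2))
  (sigma_measurable : measurable_fun (`[0, T] `*` [set: R])
     (fun z : R * R => sigma z.1 z.2))
  (b_bounded : exists M, forall t y (mu : Pspace (1 : R)),
     t \in `[0, T] -> `|b t y mu| <= M)
  (sigma_bounded : exists M, forall t y, t \in `[0, T] -> `|sigma t y| <= M)
  (b_lipschitz_measure : exists2 C : R, 0 < C &
     forall t y (mu nu : Pspace (1 : R)), t \in `[0, T] ->
       ((`|b t y mu - b t y nu|)%:E <=
        C%:E * wasserstein 1 (Pspace_law mu) (Pspace_law nu))%E)
  (sigma_modulus : exists rho : R -> R,
     [/\ strictly_increasing_on_nneg rho,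
         rho 0 = 0,
         convex_function (`[0, +oo[%classic : set R) (fun u : R => rho u ^+ 2),
         diverges_at_0 (fun u : R => (rho u ^+ 2)^-1) &
         forall t y z, t \in `[0, T] ->
           `|sigma t y - sigma t z| <= rho `|y - z|])
  (b_modulus : exists kappa : R -> R,
     [/\ strictly_increasing_on_nneg kappa,
         kappa 0 = 0,
         (* kappa is concave *)
         convex_function (`[0, +oo[%classic : set R) (fun u : R => - kappa u),
         diverges_at_0 (fun u : R => (kappa u)^-1) &
         forall t y z (mu : Pspace (1 : R)), t \in `[0, T] ->
           finite_moment 2 (Pspace_law mu) ->
           `|b t y mu - b t z mu| <= kappa `|y - z|]) :
  pathwise_uniqueness T x b sigma.
Proof.
have [Mb bMb] := b_bounded; have [Ms sMs] := sigma_bounded.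
have [C C0 bC] := b_lipschitz_measure.
have [rho [rho_inc rho0 rho_convex _ sigma_rho]] := sigma_modulus.
have [kappa [kappa_inc kappa0 kappa_concave kappa_div b_kappa]] := b_modulus.
move=> d Omega P F B [filF _ _] bmB X1 X2.
move=> [adX1 cX1 start1 [law1 [I1 [lawE1 itoI1 solX1]]]].
move=> [adX2 cX2 start2 [law2 [I2 [lawE2 itoI2 solX2]]]].
(* Absolute values make the common bound nonnegative and at least each of [Mb] and [Ms]. *)
have M0 : 0 <= `|Mb| + `|Ms| by rewrite addr_ge0.
have bM t y m : t \in `[0, T] -> `|b t y m| <= `|Mb| + `|Ms|.
  by move=> /bMb/le_trans; apply; rewrite (le_trans (ler_norm Mb))// lerDl.
have sM t y : t \in `[0, T] -> `|sigma t y| <= `|Mb| + `|Ms|.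
  by move=> /sMs/le_trans; apply; rewrite (le_trans (ler_norm Ms))// lerDr.
exact: (solutions_indistinguishable filF bmB (ltW T_gt0) M0 b_measurable sigma_measurable
  bM sM C0 bC rho_inc rho0 rho_convex sigma_rho kappa_inc kappa0 kappa_concave kappa_div
  b_kappa adX1 cX1 adX2 cX2 lawE1 lawE2 itoI1 itoI2 solX1 solX2 start1 start2).
Qed.
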